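(* Let $m\in\mathbb N$, let $\mathcal B$ be an arbitrary real $2m\times 2m$ matrix, and let $(A_{\mathcal B},D_1(A_{\mathcal B}))$ be the operator in $\mathbf X_1=(L^1(0,1))^{2m}$ given by $$A_{\mathcal B}\begin{pmatrix}\boldsymbol\upsilon\\ \boldsymbol\varpi\end{pmatrix}=\begin{pmatrix}(-c_j\,\partial_x\upsilon_j)_{j\in J^+}\\ (c_j\,\partial_x\varpi_j)_{j\in J^-}\end{pmatrix},$$ $$D_1(A_{\mathcal B})=\left\{\begin{pmatrix}\boldsymbol\upsilon\\ \boldsymbol\varpi\end{pmatrix}\in (W^{1,1}(0,1))^{2m}:\ \begin{pmatrix}\boldsymbol\upsilon(0)\\ \boldsymbol\varpi(1)\end{pmatrix}=\mathcal B\begin{pmatrix}\boldsymbol\upsilon(1)\\ \boldsymbol\varpi(0)\end{pmatrix}\right\}.$$ Then $(A_{\mathcal B},D_1(A_{\mathcal B}))$ generates a $C_0$-semigroup on $\mathbf X_1$.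
   Context: The index set $\{1,\dots,2m\}$ is the disjoint union of $J^+=\{1,\dots,m^+\}$ and $J^-=\{m^++1,\dots,2m\}$ for some $0\le m^+\le 2m$. Elements of $(L^1(0,1))^{2m}$ are written $(\boldsymbol\upsilon,\boldsymbol\varpi)$ with $\boldsymbol\upsilon=(\upsilon_j)_{j\in J^+}$, $\boldsymbol\varpi=(\varpi_j)_{j\in J^-}$. The functions $c_j:[0,1]\to(0,\infty)$, $j\in J^+\cup J^-$, are given, continuous and (strictly) positive on $[0,1]$. The spaces are real, and $W^{1,1}(0,1)$ is the Sobolev space of functions in $L^1(0,1)$ with weak derivative in $L^1(0,1)$, whose elements have well-defined values at $0$ and $1$. *)

(* Defs.v *)
From HB Require Import structures.
From mathcomp Require Import all_boot all_order all_algebra.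
From mathcomp Require Import all_classical all_reals all_analysis.
From mathcomp Require Import measurable_realfun.

Set Implicit Arguments.
Unset Strict Implicit.
Unset Printing Implicit Defensive.

Import Order.TTheory GRing.Theory Num.Theory.
Import numFieldNormedType.Exports.

Local Open Scope classical_set_scope.
Local Open Scope ring_scope.

(* The library defines the Lebesgue spaces as types of a.e.-classes of
   measurable functions but gives them no algebraic or normed structure;
   [L1 mu] is the library's L^1 space made into a real normed module. *)
Section L1.
Context {d} {T : measurableType d} {R : realType}.
Variable mu : {measure set T -> \bar R}.

Definition L1 : Type := LspaceType1 mu.

(* a representative, chosen once and for all, of the class [u] *)
Definition L1fun (u : L1) : T -> R := u.

HB.instance Definition _ := gen_eqMixin L1.
HB.instance Definition _ := gen_choiceMixin L1.

Lemma L1_Lfun (u : L1) : L1fun u \in Lfun mu 1.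
Proof.
rewrite inE; apply/andP; split; rewrite inE /=.
  exact: (@measurable_funPT _ _ _ _
    (repr (u : {mfun_ mu, T >-> measurableTypeR R}))).
exact: Lebesgue_finite.
Qed.

Lemma L1_ext (u v : L1) : L1fun u = L1fun v %[ae mu] -> u = v.
Proof.
case: u v => [u [[pu]]] [v [[pv]]]; rewrite /L1fun /= => uv.
have e : u = v by rewrite -[u]reprK -[v]reprK; apply/eqmodP/asboolP.
by subst v; rewrite (Prop_irrelevance pu pv).
Qed.

Lemma Lfun1_ae (f g : T -> R) : measurable_fun setT g ->
  f = g %[ae mu] -> f \in Lfun mu 1 -> g \in Lfun mu 1.
Proof.
move=> mg fg /[dup] fL /andP[]; rewrite inE /= => mf _.
have /integrableP[mEf ife] := (Lfun1_integrable mu f).1 fL.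
have /measurable_EFinP mEg := mg.
apply/Lfun1_integrable/integrableP; split => //.
rewrite (_ : (\int[mu]_x `|(EFin \o g) x| = \int[mu]_x `|(EFin \o f) x|)%E)//.
apply: ge0_ae_eq_integral => //; try by apply/measurableT_comp.
by move: fg; apply: filterS => x /= /[apply] ->.
Qed.

Lemma L1_class_exists (f : T -> R) : f \in Lfun mu 1 ->
  exists u : L1, L1fun u = f %[ae mu].
Proof.
move=> /[dup] fL /andP[]; rewrite inE /= => mf _.
pose g : {mfun T >-> measurableTypeR R} :=
  HB.pack f (isMeasurableFun.Build _ _ T (measurableTypeR R) f mf).
pose q : {mfun_ mu, T >-> measurableTypeR R} :=
  (\pi_({mfun_ mu, T >-> measurableTypeR R}) g)%qT.
have qf : (repr q : T -> R) = f %[ae mu].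
  by have /eqmodP/asboolP := reprK q.
have qL : (repr q : T -> R) \in Lfun mu 1.
  apply: (@Lfun1_ae f) => //; last by move: qf; apply: filterS => x /[apply].
  exact: (@measurable_funPT _ _ _ _ (repr q)).
have qfin : finite_norm mu 1 (q : T -> R) by move: qL => /andP[_]; rewrite inE.
pose u : L1 := HB.pack q (isFinLebesgue.Build _ T R mu _ (@lexx _ _ 1%E) q qfin).
by exists u.
Qed.

Let p1 : (1 <= 1 :> \bar R)%E := lexx 1%E.

Lemma Lfun1_0 : (\0 : T -> R) \in Lfun mu 1.
Proof. by case: (Lfun_submod_closed mu p1). Qed.

Lemma Lfun1_lin a (f g : T -> R) : f \in Lfun mu 1 -> g \in Lfun mu 1 ->
  (fun x => a * f x + g x) \in Lfun mu 1.
Proof. by case: (Lfun_submod_closed mu p1) => _; exact. Qed.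

(* the class of [f]; it is 0 when [f] is not integrable *)
Definition L1_class (f : T -> R) : L1 :=
  match pselect (f \in Lfun mu 1) with
  | left fL => sval (cid (L1_class_exists fL))
  | right _ => sval (cid (L1_class_exists Lfun1_0))
  end.

Lemma L1_classE (f : T -> R) : f \in Lfun mu 1 ->
  L1fun (L1_class f) = f %[ae mu].
Proof. by rewrite /L1_class => fL; case: pselect => // fL'; case: cid. Qed.

Definition L1_zero : L1 := L1_class \0.
Definition L1_add (u v : L1) : L1 := L1_class (L1fun u \+ L1fun v).
Definition L1_opp (u : L1) : L1 := L1_class (\- L1fun u).
Definition L1_scale (a : R) (u : L1) : L1 := L1_class (fun x => a * L1fun u x).

Lemma L1_zeroE : L1fun L1_zero = \0 %[ae mu].
Proof. exact/L1_classE/Lfun1_0. Qed.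

Lemma L1_addE (u v : L1) : L1fun (L1_add u v) = L1fun u \+ L1fun v %[ae mu].
Proof.
apply: L1_classE; rewrite (_ : _ \+ _ = fun x => 1 * L1fun u x + L1fun v x).
  by apply: Lfun1_lin; exact: L1_Lfun.
by apply/funext => x; rewrite mul1r.
Qed.

Lemma L1_scaleE a (u : L1) : L1fun (L1_scale a u) = (fun x => a * L1fun u x) %[ae mu].
Proof.
apply: L1_classE; rewrite (_ : (fun x => _) = fun x => a * L1fun u x + \0 x).
  by apply: Lfun1_lin; [exact: L1_Lfun|exact: Lfun1_0].
by apply/funext => x; rewrite addr0.
Qed.

Lemma L1_oppE (u : L1) : L1fun (L1_opp u) = \- L1fun u %[ae mu].
Proof.
apply: L1_classE; rewrite (_ : \- _ = fun x => -1 * L1fun u x + \0 x).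
  by apply: Lfun1_lin; [exact: L1_Lfun|exact: Lfun1_0].
by apply/funext => x; rewrite addr0 mulN1r.
Qed.

Let addA : associative L1_add.
Proof.
move=> u v w; apply: L1_ext.
apply: (filterS3 _ _ (L1_addE u v) (L1_addE v w)
  (filterI (L1_addE u (L1_add v w)) (L1_addE (L1_add u v) w))).
by move=> x /(_ I) /= e1 /(_ I) /= e2 [/(_ I) /= -> /(_ I) /= ->] _; rewrite e1 e2 addrA.
Qed.

Let addC : commutative L1_add.
Proof. by move=> u v; rewrite /L1_add; congr L1_class; apply/funext => x /=; rewrite addrC. Qed.

Let add0 : left_id L1_zero L1_add.
Proof.
move=> u; apply: L1_ext; move: (L1_addE L1_zero u) L1_zeroE.
by apply: filterS2 => x /(_ I) /= -> /(_ I) /= -> _; rewrite add0r.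
Qed.

Let addN : left_inverse L1_zero L1_opp L1_add.
Proof.
move=> u; apply: L1_ext; move: (L1_addE (L1_opp u) u) (L1_oppE u) L1_zeroE.
by apply: filterS3 => x /(_ I) /= -> /(_ I) /= -> /(_ I) /= -> _; rewrite addNr.
Qed.

HB.instance Definition _ := GRing.isZmodule.Build L1 addA addC add0 addN.

Let scaleA a b u : L1_scale a (L1_scale b u) = L1_scale (a * b) u.
Proof.
apply: L1_ext.
move: (L1_scaleE a (L1_scale b u)) (L1_scaleE b u) (L1_scaleE (a * b) u).
by apply: filterS3 => x /(_ I) /= -> /(_ I) /= -> /(_ I) /= -> _; rewrite /= mulrA.
Qed.

Let scale1 : left_id 1 L1_scale.
Proof.
move=> u; apply: L1_ext; move: (L1_scaleE 1 u).
by apply: filterS => x /(_ I) /= -> _; rewrite /= mul1r.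
Qed.

Let scaleDr : right_distributive L1_scale +%R.
Proof.
move=> a u v; apply: L1_ext.
apply: (filterS3 _ _ (filterI (L1_scaleE a u) (L1_scaleE a v)) (L1_addE u v)
  (filterI (L1_scaleE a (L1_add u v))
           (L1_addE (L1_scale a u) (L1_scale a v)))).
move=> x [/(_ I) /= e1 /(_ I) /= e2] /(_ I) /= e3 [/(_ I) /= -> /(_ I) /= ->] _.
by rewrite e1 e2 e3 mulrDr.
Qed.

Let scaleDl u : {morph L1_scale^~ u : a b / a + b}.
Proof.
move=> a b; apply: L1_ext.
apply: (filterS2 _ _ (filterI (L1_scaleE a u) (L1_scaleE b u))
  (filterI (L1_scaleE (a + b) u)
           (L1_addE (L1_scale a u) (L1_scale b u)))).
move=> x [/(_ I) /= e1 /(_ I) /= e2] [/(_ I) /= -> /(_ I) /= ->] _.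
by rewrite e1 e2 mulrDl.
Qed.

HB.instance Definition _ :=
  GRing.Zmodule_isLmodule.Build R L1 scaleA scale1 scaleDr scaleDl.

Lemma L1fun0 : L1fun 0 = \0 %[ae mu]. Proof. exact: L1_zeroE. Qed.
Lemma L1funD u v : L1fun (u + v) = L1fun u \+ L1fun v %[ae mu].
Proof. exact: L1_addE. Qed.
Lemma L1funN u : L1fun (- u) = \- L1fun u %[ae mu].
Proof. exact: L1_oppE. Qed.
Lemma L1funZ a u : L1fun (a *: u) = (fun x => a * L1fun u x) %[ae mu].
Proof. exact: L1_scaleE. Qed.

Definition L1_norm (u : L1) : R := \int[mu]_x `|L1fun u x|.

Lemma L1_integrable (u : L1) : mu.-integrable setT (EFin \o L1fun u).
Proof. exact/Lfun1_integrable/L1_Lfun. Qed.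

Lemma L1_measurable (u : L1) : measurable_fun setT (L1fun u).
Proof. by have /integrableP[/measurable_EFinP] := L1_integrable u. Qed.

Lemma L1_norm_ae (u : L1) (f : T -> R) : measurable_fun setT f ->
  L1fun u = f %[ae mu] -> L1_norm u = \int[mu]_x `|f x|.
Proof.
move=> mf uf; congr fine; apply: ge0_ae_eq_integral => //.
- by apply/measurable_EFinP/measurableT_comp => //; exact: L1_measurable.
- by apply/measurable_EFinP/measurableT_comp.
- by move: uf; apply: filterS => x /= /[apply] ->.
Qed.

Let normD u v : L1_norm (u + v) <= L1_norm u + L1_norm v.
Proof.
have iu := integrable_norm (L1_integrable u).
have iv := integrable_norm (L1_integrable v).
have muv : measurable_fun setT (L1fun u \+ L1fun v).
  by apply: measurable_funD; exact: L1_measurable.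
rewrite (L1_norm_ae muv (L1funD u v)) /L1_norm -RintegralD//.
apply: le_Rintegral => //.
- apply: (@integrable_norm _ _ _ _ _ (L1fun u \+ L1fun v)).
  exact: (integrableD measurableT (L1_integrable u) (L1_integrable v)).
- exact: (integrableD measurableT iu iv).
- by move=> x _; exact: ler_normD.
Qed.

Let normZ a u : L1_norm (a *: u) = `|a| * L1_norm u.
Proof.
have mau : measurable_fun setT (fun x => a * L1fun u x).
  by apply: measurable_funM => //; exact: L1_measurable.
rewrite (L1_norm_ae mau (L1funZ a u)) /L1_norm -RintegralZl//.
  by apply: eq_Rintegral => x _; exact: normrM.
exact: integrable_norm (L1_integrable u).
Qed.

Let norm0_eq0 u : L1_norm u = 0 -> u = 0.
Proof.
move=> u0; apply: L1_ext.
have : (\int[mu]_x `|(EFin \o L1fun u) x| = 0)%E.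
  rewrite -[LHS]fineK; first by congr EFin.
  by have /integrableP[_] := L1_integrable u;
    rewrite ge0_fin_numE // integral_ge0.
move/ae_eq_integral_abs.
have /integrableP[mu_ _] := L1_integrable u.
move=> /(_ measurableT mu_) ae0.
by apply: (filterS2 _ _ ae0 L1fun0) => x /(_ I) [/= ->] /(_ I) /= ->.
Qed.

HB.instance Definition _ := Lmodule_isNormed.Build R L1 normD normZ norm0_eq0.

Lemma L1_normE (u : L1) : `|u| = \int[mu]_x `|L1fun u x|.
Proof. by []. Qed.
End L1.

Coercion L1fun : L1 >-> Funclass.

(* Finite powers of a normed module, with the sum of the norms of the
   components: (L^1)^n then carries its usual norm. *)
Section ffun_normed.
Context {R : realType} {I : finType} {V : normedModType R}.
Implicit Types u v : {ffun I -> V}.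

Definition ffun_norm u : R := \sum_i `|u i|.

Let normD u v : ffun_norm (u + v) <= ffun_norm u + ffun_norm v.
Proof.
rewrite /ffun_norm -big_split /=; apply: ler_sum => i _.
by rewrite ffunE ler_normD.
Qed.

Let normZ a u : ffun_norm (a *: u) = `|a| * ffun_norm u.
Proof.
by rewrite /ffun_norm mulr_sumr; apply: eq_bigr => i _; rewrite ffunE normrZ.
Qed.

Let norm0_eq0 u : ffun_norm u = 0 -> u = 0.
Proof.
move=> /eqP; rewrite psumr_eq0// => /allP u0; apply/ffunP => i.
rewrite ffunE; apply/eqP; rewrite -normr_eq0.
by have := u0 i (mem_index_enum _).
Qed.

HB.instance Definition _ :=
  Lmodule_isNormed.Build R {ffun I -> V} normD normZ norm0_eq0.

Lemma ffun_normE u : `|u| = \sum_i `|u i|. Proof. by []. Qed.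

End ffun_normed.

Section semigroup.
Context {R : realType} {X : normedModType R}.

(* only the values of [S] at nonnegative times matter *)
Record C0_semigroup (S : R -> X -> X) : Prop := {
  C0_linear : forall t, 0 <= t -> linear (S t);
  C0_bounded : forall t, 0 <= t -> continuous (S t);
  C0_id : forall x, S 0 x = x;
  C0_add : forall s t, 0 <= s -> 0 <= t -> forall x, S (s + t) x = S s (S t x);
  C0_cvg : forall x, S t x @[t --> 0^'+] --> x
}.

(* [(A, D)] is the infinitesimal generator of [S]; the values of [A] outside
   [D] are irrelevant *)
Definition is_generator (S : R -> X -> X) (D : set X) (A : X -> X) : Prop :=
  D = [set x | cvg (t^-1 *: (S t x - x) @[t --> 0^'+])] /\
  forall x, D x -> t^-1 *: (S t x - x) @[t --> 0^'+] --> A x.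

Definition generates_C0_semigroup (D : set X) (A : X -> X) : Prop :=
  exists S, C0_semigroup S /\ is_generator S D A.

End semigroup.

Section sobolev.
Context {R : realType}.

Definition lebesgue01 : {measure set (measurableTypeR R) -> \bar R} :=
  mrestr lebesgue_measure (measurable_itv `]0, 1[%R).

Definition L1_01 := L1 lebesgue01.

(* the class of the restriction of [f] to (0, 1) *)
Definition L1_01_class (f : R -> R) : L1_01 := L1_class lebesgue01 (f \_ `]0, 1[).

Definition test_function (phi : R -> R) : Prop :=
  [/\ forall n x, derivable (derive1n n phi) x 1,
      compact (closure [set x | phi x != 0]) &
      closure [set x | phi x != 0] `<=` `]0, 1[].

Definition is_weak_derivative (u w : L1_01) : Prop :=
  forall phi, test_function phi ->
    \int[lebesgue01]_x (u x * derive1 phi x) =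
    - \int[lebesgue01]_x (w x * phi x).

Definition W11 : set L1_01 := [set u | exists w, is_weak_derivative u w].

(* unique when it exists; 0 outside [W11] *)
Definition weak_derivative (u : L1_01) : L1_01 := xget 0 (is_weak_derivative u).

Definition continuous_rep (u : L1_01) (g : R -> R) : Prop :=
  {within `[0, 1], continuous g} /\ (u : R -> R) = g %[ae lebesgue01].

(* the value at [x] in [0, 1] of the continuous representative of [u] *)
Definition value_at (u : L1_01) (x : R) : R :=
  xget (fun=> 0) (continuous_rep u) x.

End sobolev.
Arguments L1_01 : clear implicits.

Section transport.
Context {R : realType} (m mplus : nat).

Definition X1 := {ffun 'I_(2 * m) -> L1_01 R}.

(* Indices are shifted by one: J^+ = {0, ..., mplus - 1}. *)
Definition Jplus (j : 'I_(2 * m)) : bool := (j < mplus)%N.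

(* (v(0), w(1)) *)
Definition inflow (u : X1) : 'cV[R]_(2 * m) :=
  \col_j (if Jplus j then value_at (u j) 0 else value_at (u j) 1).

(* (v(1), w(0)) *)
Definition outflow (u : X1) : 'cV[R]_(2 * m) :=
  \col_j (if Jplus j then value_at (u j) 1 else value_at (u j) 0).

(* For u in the domain and c continuous on [0, 1] the products below are
   integrable, so that [L1_01_class] takes its intended value. *)
Definition transport_op (c : 'I_(2 * m) -> R -> R) (u : X1) : X1 :=
  [ffun j => L1_01_class (fun x =>
     if Jplus j then - c j x * weak_derivative (u j) x
     else c j x * weak_derivative (u j) x)].

Definition transport_dom (B : 'M[R]_(2 * m)) : set X1 :=
  [set u : X1 | (forall j, W11 (u j)) /\ inflow u = B *m outflow u].

End transport.
Arguments X1 : clear implicits.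

(* Main.v *)
(* Measuring position by travel time from the inflow end turns every component
   into a function on (0, tau_j) that moves right at speed 1. For times up to
   delta <= min_j tau_j, what enters through the inflow end of component j is
   the combination, with weights B_jk, of what leaves the other components, and
   that is read off the present state; so on this time range the solution is an
   explicit translation of an extended signal on (-delta, tau_j). This local
   semigroup extends to all times, for an arbitrary matrix B and without any
   dissipativity estimate.
   For the generator, u is in the domain with A u = v exactly when each signal of
   u is, up to a constant g_j, minus the primitive of that of v, where the g_j are
   coupled by B. Such signals have L^1-convergent difference quotients since
   averages of translates converge in L^1; conversely, integrating the
   convergent difference quotient over (0, b) and letting t -> 0 at a.e. b
   recovers the primitive, and at b = tau_j the boundary condition. *)
From HB Require Import structures.
Require Import Defs.
From mathcomp Require Import all_boot all_order all_algebra.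
From mathcomp Require Import all_classical all_reals all_analysis.
From mathcomp Require Import measurable_realfun.
From mathcomp Require Import ring lra.

Set Implicit Arguments.
Unset Strict Implicit.
Unset Printing Implicit Defensive.

Import Order.TTheory GRing.Theory Num.Theory.
Import numFieldNormedType.Exports.

Local Open Scope classical_set_scope.
Local Open Scope ring_scope.

(** * Extending a local semigroup *)

(** Two obstacles shape the development. Elements of L1 are a.e. classes, while the flow is built
    from compositions with translations and charts. [wbounded] isolates the one inequality that
    makes such a composition well defined on classes, linear and bounded; lift, pull, translation,
    delay and multiplication are all instances. Moreover, [is_generator] asks for equality of the
    domain with the set of convergence, and that domain is phrased with weak derivatives and a
    chosen continuous representative. It is therefore rewritten once and for all as an a.e. identity
    between lifts and primitives ([flux]), by a du Bois-Reymond argument with explicit test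
    functions; the semigroup part then never meets a test function. The bound delta <= tau_k ensures
    that a point of (-delta, 0) shifted by tau_k lands in (0, tau_k), where the present state is
    known, so that the feedback through B is never iterated inside one signal. The gluing uses the
    step delta / 2, because adding two remainders requires additivity up to twice the step. *)

Section local_semigroup.
Context {R : realType} {X : normedModType R}.
Variables (S0 : R -> X -> X) (h : R).
Hypothesis h_gt0 : 0 < h.
Hypothesis S0_linear : forall t : R, 0 <= t <= h -> linear (S0 t).
Hypothesis S0_continuous : forall t : R, 0 <= t <= h -> continuous (S0 t).
Hypothesis S00 : forall x, S0 0 x = x.
Hypothesis S0D : forall s t : R, 0 <= s -> 0 <= t -> s + t <= h *+ 2 ->
  forall x, S0 (s + t) x = S0 s (S0 t x).

Definition extend_semigroup (t : R) : X -> X :=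
  let k := Num.truncn (t / h) in iter k (S0 h) \o S0 (t - h *+ k).

Lemma extend_semigroupE k (r : R) : 0 <= r < h ->
  extend_semigroup (h *+ k + r) = iter k (S0 h) \o S0 r.
Proof.
move=> /andP[r0 rh]; rewrite /extend_semigroup.
have -> : Num.truncn ((h *+ k + r) / h) = k.
  apply: truncn_def; rewrite mulrDl -(mulr_natl h) mulfK ?gt_eqF//.
  rewrite lerDl divr_ge0 ?(ltW h_gt0)//= -natr1 ltrD2l.
  by rewrite ltr_pdivrMr ?mul1r.
by rewrite addrAC subrr add0r.
Qed.

Lemma extend_semigroup_small t : 0 <= t < h -> extend_semigroup t = S0 t.
Proof. by move=> th; rewrite -[t]add0r -(mulr0n h) extend_semigroupE// mulr0n add0r. Qed.

Lemma euclidean_decomposition (t : R) : 0 <= t ->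
  exists k (r : R), 0 <= r < h /\ t = h *+ k + r.
Proof.
move=> t0; exists (Num.truncn (t / h)), (t - h *+ Num.truncn (t / h)).
have th0 : 0 <= t / h by rewrite divr_ge0// ltW.
have /andP[k1 k2] := truncn_itv th0.
split; last by rewrite addrC subrK.
rewrite subr_ge0 ltrBlDr addrC -mulrSr -!(mulr_natl h).
by rewrite -ler_pdivlMr// k1 -ltr_pdivrMr.
Qed.

Let h0 : 0 <= h <= h. Proof. by rewrite lexx ltW. Qed.

(** Both orders of one step h and one step r give [S0 (r + h)], and r + h stays within the range 2h
    where [S0D] applies. *)
Lemma iter_S0_commute k r x : 0 <= r <= h ->
  S0 r (iter k (S0 h) x) = iter k (S0 h) (S0 r x).
Proof.
move=> /andP[r0 rh]; elim: k x => [//|k ih] x; rewrite !iterS -ih.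
rewrite -!S0D ?(ltW h_gt0)//; first by rewrite addrC.
  by rewrite mulr2n lerD2l.
by rewrite mulr2n lerD2r.
Qed.

Lemma extend_semigroup_linear t : 0 <= t -> linear (extend_semigroup t).
Proof.
move=> /euclidean_decomposition[k [r [rh ->]]]; rewrite extend_semigroupE//.
have rh' : 0 <= r <= h by case/andP: rh => -> /ltW.
move=> a x y /=; rewrite (S0_linear rh').
by elim: k => [//|k ih]; rewrite !iterS ih (S0_linear h0).
Qed.

Lemma extend_semigroup_continuous t : 0 <= t -> continuous (extend_semigroup t).
Proof.
move=> /euclidean_decomposition[k [r [rh ->]]]; rewrite extend_semigroupE//.
have rh' : 0 <= r <= h by case/andP: rh => -> /ltW.
elim: k => [|k ih] x; first exact: S0_continuous rh' x.
rewrite (_ : _ \o _ = S0 h \o (iter k (S0 h) \o S0 r)); last first.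
  by apply/funext.
by apply: continuous_comp; [exact: ih|exact: S0_continuous].
Qed.

(** Write both times as multiples of h plus remainders r, q < h. The remainders combine because r +
    q <= 2h, and their sum carries at most one further step h; this is why [S0D] is assumed up to
    2h. *)
Lemma extend_semigroupD s t : 0 <= s -> 0 <= t -> forall x,
  extend_semigroup (s + t) x = extend_semigroup s (extend_semigroup t x).
Proof.
move=> /euclidean_decomposition[k [r [rh ->]]].
move=> /euclidean_decomposition[l [q [qh ->]]] x.
have /andP[r0 rlt] := rh; have /andP[q0 qlt] := qh.
have rq2 : r + q <= h *+ 2 by rewrite mulr2n lerD// ltW.
rewrite (extend_semigroupE k rh) (extend_semigroupE l qh) /=.
rewrite iter_S0_commute ?r0 ?ltW// -iterD -S0D//.
rewrite addrACA -mulrnDr; have [rqh|hrq] := ltP (r + q) h.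
  by rewrite extend_semigroupE// rqh addr_ge0.
have -> : h *+ (k + l) + (r + q) = h *+ (k + l).+1 + (r + q - h).
  by rewrite mulrSr -addrA; congr (_ + _); rewrite addrC subrK.
have rqh : 0 <= r + q - h < h.
  by rewrite subr_ge0 hrq ltrBlDr ltrD.
(* The carried step h is moved next to the remainder r + q - h, and the two merge back into
   [S0 (r + q)]. *)
rewrite extend_semigroupE//= -iterS iterSr -S0D ?(ltW h_gt0)//; last 2 first.
  by case/andP: rqh.
  by rewrite addrC subrK.
by rewrite [h + _]addrC subrK.
Qed.

Lemma near_extend_semigroup :
  \forall t \near (0 : R)^'+, extend_semigroup t = S0 t.
Proof.
by near=> t; apply: extend_semigroup_small; apply/andP; split.
Unshelve. all: by end_near. Qed.

(** Continuity at 0 and the generator depend only on small times, where the extension is [S0].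
    Stating the hypothesis as an equivalence on pairs (x, v) yields at once the equality of domains
    and the value of the generator. *)
Lemma extend_semigroupP (D : set X) (A : X -> X) :
  (forall x, S0 t x @[t --> 0^'+] --> x) ->
  (forall x v, (t^-1 *: (S0 t x - x) @[t --> 0^'+] --> v) <-> D x /\ A x = v) ->
  generates_C0_semigroup D A.
Proof.
move=> S0x DA; exists extend_semigroup.
have lim x : t^-1 *: (extend_semigroup t x - x) @[t --> 0^'+] =
    t^-1 *: (S0 t x - x) @[t --> 0^'+].
  apply/funext => B; apply/propext; split; apply: filterS2 near_extend_semigroup.
    by move=> t /= ->.
  by move=> t /= ->.
split; split.
- exact: extend_semigroup_linear.
- exact: extend_semigroup_continuous.
- by move=> x; rewrite extend_semigroup_small ?lexx.
- exact: extend_semigroupD.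
- move=> x; apply: cvg_trans (S0x x); apply: near_eq_cvg.
  by near=> t; rewrite (near near_extend_semigroup t).
- apply/seteqP; split => x /=; rewrite lim.
    by move=> Dx; apply/cvg_ex; exists (A x); apply/DA.
  by move=> /cvg_ex[v /DA[]].
- by move=> x Dx; rewrite lim; apply/DA.
Unshelve. all: by end_near. Qed.

End local_semigroup.

(** * Weighted composition operators on L1 *)

Section almost_everywhere_facts.
Context {d} {T : measurableType d} {R : realType}.
Variable mu : {measure set T -> \bar R}.
Implicit Types P Q : T -> Prop.

Lemma aeS P Q : (forall x, P x -> Q x) ->
  {ae mu, forall x, P x} -> {ae mu, forall x, Q x}.
Proof. by move=> PQ; apply: filterS. Qed.

Lemma aeI P Q : {ae mu, forall x, P x} -> {ae mu, forall x, Q x} ->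
  {ae mu, forall x, P x /\ Q x}.
Proof. exact: filterI. Qed.

Lemma ae_eqP (f g : T -> R) : f = g %[ae mu] <-> {ae mu, forall x, f x = g x}.
Proof. by split; apply: aeS => x // /(_ I). Qed.

Lemma L1_aeD (u v : L1 mu) : {ae mu, forall x, (u + v) x = u x + v x}.
Proof. exact/ae_eqP/L1funD. Qed.

Lemma L1_aeZ a (u : L1 mu) : {ae mu, forall x, (a *: u) x = a * u x}.
Proof. exact/ae_eqP/L1funZ. Qed.

Lemma L1_ae_lin a (u v : L1 mu) :
  {ae mu, forall x, (a *: u + v) x = a * u x + v x}.
Proof.
apply: aeS (aeI (L1_aeD (a *: u) v) (L1_aeZ a u)) => x [eD eZ].
by apply: (etrans eD); congr (_ + _).
Qed.

End almost_everywhere_facts.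

Section weighted_composition.
Context {d1 d2} {T1 : measurableType d1} {T2 : measurableType d2}
  {R : realType}.
Variables (mu1 : {measure set T1 -> \bar R}) (mu2 : {measure set T2 -> \bar R}).
Implicit Types (C : R) (m : T2 -> R) (phi : T2 -> T1).

(* The inequality says that the image under [phi] of the measure of density
   [`|m|] with respect to [mu2] is at most [C] times [mu1]. *)
Definition wbounded C m phi : Prop :=
  [/\ measurable_fun setT m, measurable_fun setT phi, 0 <= C &
    forall f : T1 -> \bar R, measurable_fun setT f -> (forall x, 0 <= f x)%E ->
    (\int[mu2]_x (`|m x|%:E * f (phi x)) <= C%:E * \int[mu1]_x f x)%E].

(** [L1_class] returns 0 on non-integrable functions, so this is the intended operator only under
    [wbounded]. *)
Definition wcomp m phi (u : L1 mu1) : L1 mu2 :=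
  L1_class mu2 (fun x => m x * u (phi x)).

(** Testing the inequality on the indicator of a null set N shows that m vanishes a.e. on the
    preimage of N. Nothing is known where m = 0, since phi may send that set into a null set. *)
Lemma wbounded_ae C m phi (P : T1 -> Prop) : wbounded C m phi ->
  {ae mu1, forall x, P x} -> {ae mu2, forall x, m x != 0 -> P (phi x)}.
Proof.
move=> [mm mphi C0 mC] [N [mN N0 PN]].
have mf : measurable_fun setT (EFin \o \1_N : T1 -> \bar R).
  by apply/measurable_EFinP; exact: measurable_indic.
have f0 x : (0 <= (EFin \o \1_N : T1 -> \bar R) x)%E by rewrite lee_fin.
have := mC _ mf f0.
rewrite integral_indic// setIT N0 mule0 => le0.
have : (\int[mu2]_x `|(`|m x|%:E * (EFin \o \1_N) (phi x))| = 0)%E.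
  apply/eqP; rewrite eq_le integral_ge0// andbT (le_trans _ le0)//.
  under eq_integral do rewrite gee0_abs ?mule_ge0 ?lee_fin//.
  by [].
move/ae_eq_integral_abs => /(_ measurableT) [].
  apply: emeasurable_funM.
    by apply/measurable_EFinP/measurableT_comp.
  by apply: measurableT_comp.
move=> M [mM M0 PM]; exists M; split => // x /= xP.
apply: PM => /= e; apply: xP => mx; apply: contrapT => Px.
have /mem_set xN : N (phi x) by exact: PN.
have /eqP := e I; rewrite indicE xN mule1 eqe normr_eq0.
by apply/negP.
Qed.

Lemma wbounded_measurable C m phi (f : T1 -> R) : wbounded C m phi ->
  measurable_fun setT f -> measurable_fun setT (fun x => m x * f (phi x)).
Proof.
by move=> [mm mphi _ _] mf; apply: measurable_funM => //; exact: measurableT_comp.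
Qed.

Lemma wbounded_le C m phi (f : T1 -> R) : wbounded C m phi ->
  measurable_fun setT f ->
  (\int[mu2]_x `|m x * f (phi x)|%:E <= C%:E * \int[mu1]_x `|f x|%:E)%E.
Proof.
move=> [mm mphi C0 mC] mf.
under eq_integral do rewrite normrM EFinM.
by apply: (mC (fun x => `|f x|%:E)) => //; apply/measurable_EFinP/measurableT_comp.
Qed.

Lemma wbounded_Lfun C m phi (f : T1 -> R) : wbounded C m phi ->
  f \in Lfun mu1 1 -> (fun x => m x * f (phi x)) \in Lfun mu2 1.
Proof.
move=> b /Lfun1_integrable/integrableP[/measurable_EFinP mf fi].
apply/Lfun1_integrable/integrableP; split.
  exact/measurable_EFinP/(wbounded_measurable b).
apply: le_lt_trans (wbounded_le b mf) _.
by rewrite lte_mul_pinfty// lee_fin; case: b.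
Qed.

Lemma wcompE C m phi (u : L1 mu1) : wbounded C m phi ->
  {ae mu2, forall x, wcomp m phi u x = m x * u (phi x)}.
Proof. by move=> b; apply/ae_eqP/L1_classE/(wbounded_Lfun b)/L1_Lfun. Qed.

Lemma wcomp_norm C m phi (u : L1 mu1) : wbounded C m phi ->
  `|wcomp m phi u| <= C * `|u|.
Proof.
move=> b; have mu := L1_measurable u.
have -> : `|wcomp m phi u| = \int[mu2]_x `|m x * u (phi x)|.
  by apply: L1_norm_ae (wbounded_measurable b mu) _; apply/ae_eqP/(wcompE u b).
have iu : (\int[mu1]_x `|u x|%:E)%E \is a fin_num.
  by have /integrable_norm := L1_integrable u; exact: integrable_fin_num.
have -> : C * `|u| = fine (C%:E * \int[mu1]_x `|u x|%:E)%E by rewrite fineM.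
apply: fine_le; rewrite ?fin_numM//; last exact: wbounded_le.
apply: integrable_fin_num => //.
by apply: integrable_norm; apply/Lfun1_integrable/(wbounded_Lfun b)/L1_Lfun.
Qed.

Lemma wcomp_linear C m phi : wbounded C m phi -> linear (wcomp m phi).
Proof.
move=> b a u v; apply/L1_ext/ae_eqP.
have := wbounded_ae b (L1_ae_lin a u v).
move=> /aeI/(_ (wcompE (a *: u + v) b)).
move=> /aeI/(_ (aeI (wcompE u b) (wcompE v b))).
move=> /aeI/(_ (L1_ae_lin a (wcomp m phi u) (wcomp m phi v))).
apply: aeS => x [[[e wE] [uE vE]] /esym eD]; apply: etrans eD.
rewrite uE vE; apply: (etrans wE).
(* The a.e. identity for [a *: u + v] transfers through phi only where the weight is nonzero;
   elsewhere both sides vanish. *)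
have [->|/e {}e] := eqVneq (m x) 0; first by rewrite !mul0r mulr0 addr0.
by apply: (etrans (congr1 _ e)); rewrite mulrDr mulrCA.
Qed.

End weighted_composition.

Section weighted_composition_comp.
Context {d1 d2 d3} {T1 : measurableType d1} {T2 : measurableType d2}
  {T3 : measurableType d3} {R : realType}.
Variables (mu1 : {measure set T1 -> \bar R}) (mu2 : {measure set T2 -> \bar R})
  (mu3 : {measure set T3 -> \bar R}).

Lemma wbounded_comp C C' (m : T2 -> R) (phi : T2 -> T1) (m' : T3 -> R)
    (phi' : T3 -> T2) :
  wbounded mu1 mu2 C m phi -> wbounded mu2 mu3 C' m' phi' ->
  wbounded mu1 mu3 (C' * C) (fun x => m' x * m (phi' x)) (phi \o phi').
Proof.
move=> [mm mphi C0 b] [mm' mphi' C0' b']; split.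
- by apply: measurable_funM => //; exact: measurableT_comp.
- exact: measurableT_comp.
- exact: mulr_ge0.
move=> f mf f0; rewrite EFinM -muleA.
apply: (@le_trans _ _ (C'%:E * \int[mu2]_x (`|m x|%:E * f (phi x)))%E).
  rewrite (eq_integral (fun x => `|m' x|%:E *
      (fun y => `|m y|%:E * f (phi y)) (phi' x))%E).
    apply: b'; last by move=> x; rewrite mule_ge0// lee_fin.
    apply: emeasurable_funM; last exact: measurableT_comp.
    by apply/measurable_EFinP/measurableT_comp.
  by move=> x _; rewrite normrM EFinM muleA.
by apply: lee_wpmul2l; [rewrite lee_fin|exact: b].
Qed.

End weighted_composition_comp.

(** * Change of variables: from sets to functions *)

Section change_of_measure.
Context {d1 d2} {T1 : measurableType d1} {T2 : measurableType d2}
  {R : realType}.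
Variables (mu1 : {measure set T1 -> \bar R}) (mu2 : {measure set T2 -> \bar R}).

Import HBNNSimple.

(** The usual extension: simple functions by linearity, then monotone convergence along an
    increasing approximation of f. *)
Lemma ge0_integral_change (k : T2 -> R) (phi : T2 -> T1) :
  measurable_fun setT k -> measurable_fun setT phi -> (forall x, 0 <= k x) ->
  (forall A, measurable A ->
    (\int[mu2]_x (k x * \1_A (phi x))%:E = mu1 A)%E) ->
  forall f : T1 -> \bar R, measurable_fun setT f -> (forall x, 0 <= f x)%E ->
  (\int[mu2]_x ((k x)%:E * f (phi x)) = \int[mu1]_x f x)%E.
Proof.
move=> mk mphi k0 kA f mf f0.
pose f_ := nnsfun_approx measurableT mf.
have f_cvg y : (f_ n y)%:E @[n --> \oo] --> f y.
  by apply: cvg_nnsfun_approx.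
transitivity (limn (fun n => \int[mu2]_x ((k x)%:E * (f_ n (phi x))%:E)))%E.
  rewrite -monotone_convergence//.
  - apply: eq_integral => x _; apply/esym/cvg_lim => //.
    by apply: cvgeZl => //; exact: f_cvg.
  - move=> n; apply: emeasurable_funM; first exact/measurable_EFinP.
    by apply/measurable_EFinP; apply: measurableT_comp.
  - by move=> n x _; rewrite mule_ge0// lee_fin.
  - move=> x _ m n mn; apply: lee_wpmul2l; rewrite lee_fin//.
    exact/lefP/nd_nnsfun_approx.
transitivity (limn (fun n => \int[mu1]_x (f_ n x)%:E))%E; last first.
  rewrite -monotone_convergence//.
  - by apply: eq_integral => y _; apply/cvg_lim.
  - by move=> n; exact/measurable_EFinP.
  - by move=> n x _; rewrite lee_fin.
  - by move=> x _ m n mn; rewrite lee_fin; exact/lefP/nd_nnsfun_approx.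
congr (limn _); apply/funext => n.
under eq_integral do rewrite fimfunE -fsumEFin//.
under [RHS]eq_integral do rewrite fimfunE -fsumEFin//.
have nn r x : (0 <= (r * \1_(f_ n @^-1` [set r]) x)%:E)%E.
  by rewrite lee_fin indicE; case: (boolP (x \in _)) => [|_];
    rewrite ?mulr0// inE /= => <-; rewrite mulr1.
have mf_ r : measurable_fun setT (\1_(f_ n @^-1` [set r]) : T1 -> R).
  exact: measurable_indic.
rewrite [RHS]ge0_integral_fsum//; last first.
  by move=> r; apply/measurable_EFinP/measurable_funM.
under eq_integral => x _ do rewrite ge0_mule_fsumr//.
rewrite ge0_integral_fsum//; last 2 first.
- move=> r; apply: emeasurable_funM; first exact/measurable_EFinP.
  apply/measurable_EFinP/measurable_funM => //.
  exact: (measurableT_comp (mf_ r)).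
- by move=> r x _; apply: mule_ge0; rewrite ?lee_fin// -lee_fin.
apply: eq_fsbigr => r; rewrite inE /= => -[x _ rE].
have r0 : 0 <= r by rewrite -rE.
rewrite (eq_integral (fun x => r%:E *
    (k x * \1_(f_ n @^-1` [set r]) (phi x))%:E)%E); last first.
  by move=> y _; rewrite -!EFinM mulrCA.
rewrite ge0_integralZl//; last 2 first.
- apply/measurable_EFinP/measurable_funM => //.
  exact: (measurableT_comp (mf_ r)).
- by move=> y _; rewrite lee_fin mulr_ge0.
rewrite kA//; under eq_integral do rewrite EFinM.
rewrite ge0_integralZl//; last exact/measurable_EFinP.
by rewrite integral_indic// setIT.
Qed.

(** The signed case follows from the nonnegative one applied to f + |f| and to |f|, whose difference
    is f. *)
Lemma Rintegral_change (k : T2 -> R) (phi : T2 -> T1) (f : T1 -> R) :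
  measurable_fun setT k -> measurable_fun setT phi -> (forall x, 0 <= k x) ->
  (forall f : T1 -> \bar R, measurable_fun setT f -> (forall x, 0 <= f x)%E ->
  (\int[mu2]_x ((k x)%:E * f (phi x)) = \int[mu1]_x f x)%E) ->
  mu1.-integrable setT (EFin \o f) ->
  mu2.-integrable setT (EFin \o (fun x => k x * f (phi x))) /\
  \int[mu2]_x (k x * f (phi x)) = \int[mu1]_x f x.
Proof.
move=> mk mphi k0 kE intf.
have b : wbounded mu1 mu2 1 k phi.
  split => // g mg g0; rewrite mul1e -kE//.
  by under eq_integral do rewrite ger0_norm//.
have int2 (g : T1 -> R) : mu1.-integrable setT (EFin \o g) ->
    mu2.-integrable setT (EFin \o (fun x => k x * g (phi x))).
  by move=> /Lfun1_integrable /(wbounded_Lfun b) /Lfun1_integrable.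
split; first exact: int2.
have intn : mu1.-integrable setT (EFin \o (fun x => `|f x|)).
  exact: integrable_norm.
have intD : mu1.-integrable setT (EFin \o (fun x => f x + `|f x|)).
  exact: (integrableD measurableT intf intn).
have ge0E (g : T1 -> R) : mu1.-integrable setT (EFin \o g) ->
    (forall x, 0 <= g x) ->
    \int[mu2]_x (k x * g (phi x)) = \int[mu1]_x g x.
  move=> /integrableP[mg _] g0; congr fine; rewrite -kE//.
rewrite -(addrK (\int[mu1]_x `|f x|) (\int[mu1]_x f x)) -RintegralD//.
rewrite -(ge0E _ intD); last first.
  by move=> x; have := ler_norm (- f x); rewrite normrN => ?; lra.
rewrite -(ge0E _ intn)// -RintegralB//; 
  [|exact: (int2 _ intD)|exact: (int2 _ intn)].
by apply: eq_Rintegral => x _; rewrite mulrDr addrK.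
Qed.

End change_of_measure.

(** * Lebesgue measure restricted to the unit interval *)

Section unit_interval.
Context {R : realType}.
Notation mu := (@lebesgue_measure R).
Notation m01 := (@lebesgue01 R).

Lemma lebesgue01C : m01 (~` `]0, 1[) = 0%E.
Proof. by rewrite /lebesgue01/= /mrestr setICl measure0. Qed.

Lemma ge0_integral01 (f : R -> \bar R) : measurable_fun setT f ->
  (forall x, 0 <= f x)%E ->
  (\int[m01]_x f x = \int[mu]_(x in `]0%R, 1%R[) f x)%E.
Proof.
move=> mf f0; rewrite (@ge0_negligible_integral _ _ _ m01 setT (~` `]0, 1[))//.
- rewrite setTD setCK; apply: eq_measure_integral => A mA AI.
  by rewrite /lebesgue01/= /mrestr setIidl.
- exact: measurableC.
- exact: lebesgue01C.
Qed.

Lemma integral01 (f : R -> \bar R) : measurable_fun setT f ->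
  (\int[m01]_x f x = \int[mu]_(x in `]0%R, 1%R[) f x)%E.
Proof.
move=> mf; rewrite integralE [RHS]integralE.
by rewrite !ge0_integral01//; [exact: measurable_funeneg|exact: measurable_funepos].
Qed.

(** [lebesgue01] is a measure on the whole line for which the complement of (0, 1) is null. *)
Lemma ae01 (P : R -> Prop) : {ae m01, forall x, P x} <->
  {ae mu, forall x, 0 < x < 1 -> P x}.
Proof.
split=> [] [N [mN N0 PN]].
  exists (N `&` `]0, 1[); split => //; first exact: measurableI.
  by move=> x /= /not_implyP[x01 nP]; split; [exact: PN|rewrite /= in_itv].
exists (N `|` ~` `]0, 1[); split.
- by apply: measurableU => //; exact: measurableC.
- rewrite /lebesgue01/= /mrestr setIUl setICl setU0.
  by apply/eqP; rewrite -measure_le0 -N0 le_measure// inE//; exact: measurableI.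
- move=> x nP; have [x01|] := boolP (0 < x < 1).
    by left; apply: PN => /= /(_ x01).
  by right => /=; rewrite in_itv /=; apply/negP.
Qed.

End unit_interval.

(** * Translations and reflections of the line *)

Section translation_invariance.
Context {R : realType}.
Notation mu := (@lebesgue_measure R).

(** By uniqueness of Lebesgue measure it is enough to compare the two measures on half-open
    intervals. *)
Lemma pushforward_shift (t : R) (A : set R) : measurable A ->
  pushforward mu (fun x : measurableTypeR R => x - t : measurableTypeR R) A = mu A.
Proof.
have mt : measurable_fun setT (fun x : R => x - t) by exact: measurable_funB.
move=> mA; apply/esym/lebesgue_measure_unique => //= _ [[a b]] _ <-.
rewrite /pushforward.
have -> : (fun x : R => x - t) @^-1` `]a, b] = `]a + t, b + t]%classic.
  by apply/seteqP; split => x /=; rewrite !in_itv/= lerBlDr ltrBrDr.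
by rewrite !lebesgue_measure_itv/= !lte_fin ltrD2r -!EFinB opprD addrACA subrr addr0.
Qed.

Lemma ge0_integral_shift (t : R) (f : R -> \bar R) : measurable_fun setT f ->
  (forall x, 0 <= f x)%E -> (\int[mu]_x f (x - t)%R = \int[mu]_x f x)%E.
Proof.
move=> mf f0.
have mt : measurable_fun setT (fun x : R => x - t) by exact: measurable_funB.
have := @ge0_integral_pushforward _ _ _ _ R (fun x : measurableTypeR R =>
  x - t : measurableTypeR R) mt mu setT f measurableT mf (fun x _ => f0 x).
rewrite preimage_setT => <-.
by apply: eq_measure_integral => A mA _; exact: pushforward_shift.
Qed.

Lemma ge0_integral_opp (f : R -> \bar R) : measurable_fun setT f ->
  (forall x, 0 <= f x)%E -> (\int[mu]_x f (- x)%R = \int[mu]_x f x)%E.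
Proof.
move=> mf f0.
have mt : measurable_fun setT (fun x : R => - x) by exact: oppr_measurable.
have := @ge0_integral_pushforward _ _ _ _ R (fun x : measurableTypeR R =>
  - x : measurableTypeR R) mt mu setT f measurableT mf (fun x _ => f0 x).
rewrite preimage_setT => <-.
by apply: eq_measure_integral => A mA _; exact: lebesgue_measureN.
Qed.

Lemma ge0_integral_reflect (t : R) (f : R -> \bar R) : measurable_fun setT f ->
  (forall x, 0 <= f x)%E -> (\int[mu]_x f (t - x)%R = \int[mu]_x f x)%E.
Proof.
move=> mf f0; rewrite -(ge0_integral_opp mf f0).
have mo : measurable_fun setT (fun x : R => f (- x)).
  by apply: measurableT_comp => //; exact: oppr_measurable.
rewrite -(@ge0_integral_shift t (fun x => f (- x)))//.
by apply: eq_integral => x _; rewrite opprB.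
Qed.

Lemma wbounded_shift (t : R) :
  wbounded mu mu 1 (cst 1) (fun x : R => x - t).
Proof.
split => //; first exact: measurable_funB.
move=> f mf f0; rewrite mul1e -(ge0_integral_shift t mf f0).
by under eq_integral do rewrite /= normr1 mul1e.
Qed.

Lemma wbounded_mask d (T : measurableType d) (nu : {measure set T -> \bar R})
  (A : set T) : measurable A -> wbounded nu nu 1 (\1_A : T -> R) id.
Proof.
move=> mA; split => // f mf f0; rewrite mul1e; apply: ge0_le_integral => //.
- by move=> x _; exact: mule_ge0.
- by apply: emeasurable_funM => //; apply/measurable_EFinP/measurableT_comp.
- move=> x _; rewrite indicE; case: (x \in A); first by rewrite normr1 mul1e.
  by rewrite normr0 mul0e.
Qed.

Lemma Rintegral_shift (t : R) (f : R -> R) :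
  mu.-integrable setT (EFin \o f) ->
  mu.-integrable setT (EFin \o (fun x => f (x - t))) /\
  \int[mu]_x f (x - t) = \int[mu]_x f x.
Proof.
move=> intf; have mt : measurable_fun setT (fun x : R => x - t) by exact: measurable_funB.
have [|x|g mg g0|] := @Rintegral_change _ _ _ _ R mu mu (cst 1) _ f _ mt _ _ intf.
- exact: measurable_cst.
- exact: ler01.
- by rewrite -(ge0_integral_shift t mg g0); under eq_integral do rewrite mul1e.
- by move=> i1 i2; split; [move: i1|rewrite -i2];
    under [in X in _ X]eq_fun do rewrite mul1r.
Qed.

End translation_invariance.

(** * Primitives and translations *)

Section primitive.
Context {R : realType}.
Notation mu := (@lebesgue_measure R).
Implicit Types f g : R -> R.

(** Integrating from -oo spares a base point: for functions cut off to (0, 1) or (0, tau) this is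
    the primitive vanishing at the left end. *)
Definition prim f (x : R) : R := \int[mu]_(t in `]-oo, x]) f t.

Lemma Rintegral_ae {d} {T : measurableType d} (nu : {measure set T -> \bar R})
    (A : set T) (f g : T -> R) :
  measurable A -> measurable_fun setT f -> measurable_fun setT g ->
  {ae nu, forall x, A x -> f x = g x} ->
  \int[nu]_(x in A) f x = \int[nu]_(x in A) g x.
Proof.
move=> mA mf mg fg; congr fine; apply: ae_eq_integral => //.
- by apply/measurable_EFinP/measurable_funTS.
- by apply/measurable_EFinP/measurable_funTS.
- by apply: aeS fg => x fgx Ax; rewrite fgx.
Qed.

Lemma primB f (a b : R) : mu.-integrable setT (EFin \o f) -> a <= b ->
  prim f b - prim f a = \int[mu]_(t in `]a, b]) f t.
Proof.
by move=> intf ab; apply: Rintegral_itvB => //; apply: integrableS intf.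
Qed.

Lemma prim_continuous f : mu.-integrable setT (EFin \o f) -> continuous (prim f).
Proof.
move=> intf x.
have ab : x - 1 <= x + 1 by rewrite lerD2l; lra.
have intf' : mu.-integrable `[x - 1, x + 1] (EFin \o f).
  exact: integrableS intf.
have := parameterized_integral_continuous ab intf'.
move=> /continuous_within_itvP => /(_ _)[|cont _ _]; first by rewrite ltrD2l; lra.
have xab : x \in `]x - 1, x + 1[ by rewrite in_itv/=; apply/andP; split; lra.
have cx := cont _ xab.
have cp : (fun y => prim f (x - 1) + parameterized_integral mu (x - 1) y f) y
    @[y --> x] --> prim f (x - 1) + parameterized_integral mu (x - 1) x f.
  by apply: cvgD; [exact: cvg_cst|exact: cx].
have primE y : x - 1 < y ->
    prim f y = prim f (x - 1) + parameterized_integral mu (x - 1) y f.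
  move=> xy; apply/eqP; rewrite addrC -subr_eq primB// ?ltW//.
  rewrite /parameterized_integral -Rintegral_itv_obnd_cbnd//.
  exact: integrableS intf.
rewrite /continuous_at primE ?ltrBlDr ?ltrDl//.
apply: cvg_trans cp; apply: near_eq_cvg; near=> y; apply/esym/primE.
by near: y; apply: (@cvgr_gt _ _ _ _ id x) => //; rewrite ltrBlDr ltrDl.
Unshelve. all: by end_near. Qed.

Lemma prim_derive_ae f : mu.-integrable setT (EFin \o f) ->
  {ae mu, forall x, derivable (prim f) x 1 /\ derive1 (prim f) x = f x}.
Proof.
move=> intf; apply: FTC1Ny => [y|]; first exact: integrableS intf.
by apply: open_integrable_locally => //; exact: openT.
Qed.

Lemma prim_lin (a : R) f g (x : R) : mu.-integrable setT (EFin \o f) ->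
  mu.-integrable setT (EFin \o g) ->
  prim (fun y => a * f y + g y) x = a * prim f x + prim g x.
Proof.
move=> intf intg.
have intf' : mu.-integrable `]-oo, x] (EFin \o f) by exact: integrableS intf.
have intg' : mu.-integrable `]-oo, x] (EFin \o g) by exact: integrableS intg.
rewrite /prim RintegralD//; first by rewrite RintegralZl.
exact: (@integrableZl _ _ _ mu _ (measurable_itv _) a _ intf').
Qed.

Lemma prim_shift f (s t : R) : mu.-integrable setT (EFin \o f) ->
  prim (fun x => f (x - t)) s = prim f (s - t).
Proof.
move=> intf; rewrite /prim [RHS]Rintegral_mkcond Rintegral_mkcond.
have intf' : mu.-integrable setT (EFin \o (f \_ `]-oo, s - t])).
  rewrite -restrict_EFin -integrable_mkcond//.
  exact: integrableS intf.
rewrite -(Rintegral_shift t intf').2; apply: eq_Rintegral => x _.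
rewrite !patchE; congr (if _ then _ else _).
by apply/idP/idP; rewrite !inE /= !in_itv/= lerBrDr subrK.
Qed.

Lemma L1_normE' d (T : measurableType d) (nu : {measure set T -> \bar R})
  (u : L1 nu) : (`|u|%:E = \int[nu]_x `|u x|%:E)%E.
Proof.
rewrite L1_normE fineK//.
by apply: integrable_fin_num => //; exact: integrable_norm (L1_integrable u).
Qed.

Lemma Rintegral_le_norm d (T : measurableType d) (nu : {measure set T -> \bar R})
  (u : L1 nu) (A : set T) : measurable A -> `|\int[nu]_(x in A) u x| <= `|u|.
Proof.
move=> mA; have iA : nu.-integrable A (EFin \o u).
  exact: integrableS (L1_integrable u).
apply: le_trans (le_normr_Rintegral mA iA) _.
rewrite -lee_fin L1_normE' fineK; last first.
  by apply: integrable_fin_num => //; exact: integrable_norm.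
apply: ge0_subset_integral => //.
by apply/measurable_EFinP/measurableT_comp => //; exact: L1_measurable.
Qed.

Lemma integral_cst_cc (a b e : R) : a <= b ->
  (\int[mu]_(x in `[a, b]) e%:E = (e * (b - a))%:E)%E.
Proof.
move=> ab; rewrite integral_cst//= lebesgue_measure_itv/= lte_fin.
move: ab; rewrite le_eqVlt => /predU1P[->|->//].
by rewrite ltxx subrr mulr0 mule0.
Qed.

Lemma lebesgue_measure_oc_fin (a b : R) : (mu `]a, b] < +oo)%E.
Proof. by rewrite lebesgue_measure_itv/=; case: ifP => _; rewrite ltry. Qed.

Lemma measurable_fun_patch (A : set (measurableTypeR R)) (h : R -> \bar R) :
  measurable A -> measurable_fun setT h -> measurable_fun setT (h \_ A).
Proof.
move=> mA mh; have mh' : measurable_fun (setT : set (measurableTypeR R)) h := mh.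
by apply: (measurable_restrictT h mA).1; exact: measurable_funTS mh'.
Qed.

(** Approximate f in L1 by a continuous g, for which translation is uniformly continuous on compact
    sets; the error splits into f - g at x - t, the variation of g, and f - g at x, each at most e /
    3. *)
Lemma translation_continuous f (K e : R) : mu.-integrable setT (EFin \o f) ->
  0 < e -> exists2 d : R, 0 < d & forall t, `|t| < d ->
  (\int[mu]_(x in `[(- K)%R, K]) `|f (x - t) - f x|%:E <= e%:E)%E.
Proof.
move=> intf e0; have [K0|K0] := ltP K 0.
  exists 1 => // t _; rewrite set_itv_ge ?integral_set0 ?lee_fin ?ltW//.
  by rewrite bnd_simp -ltNge; lra.
(* One unit is added on each side so that x - t stays in E for x in [-K, K] and |t| < 1. *)
pose E := `[- K - 1, K + 1]%classic.
have mE : measurable (E : set (measurableTypeR R)) by exact: measurable_itv.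
have Efin : (mu E < +oo)%E.
  by rewrite /E lebesgue_measure_itv/=; case: ifP => _; rewrite ltry.
have mf : measurable_fun setT f by case/integrableP: intf => /measurable_EFinP.
have [g_ [cg _ gcvg]] := approximation_continuous_integrable mE Efin
  (integrableS measurableT mE (@subsetT _ _) intf).
have e3 : 0 < e / 3 by lra.
have [n nE] : exists n, (\int[mu]_(z in E) `|(f z - g_ n z)%:E| < (e / 3)%:E)%E.
  move/fine_cvgP: gcvg => [fin /cvgrPdist_lt/(_ _ e3) near_lt].
  have [N _ /(_ N (leqnn N))[/= finN]] := filterI fin near_lt.
  rewrite sub0r normrN ger0_norm ?fine_ge0 ?integral_ge0// => ltN.
  by exists N; rewrite -lte_fin fineK in ltN.
set g := g_ n in nE; have {}cg : continuous g := cg n.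
have mg : measurable_fun setT g by exact: continuous_measurable_fun.
(* A uniform bound e' on an interval of length 2K contributes at most e / 3; the extra 1 keeps the
   denominator positive when K = 0. *)
pose e' := e / 3 / (K + K + 1).
have e'0 : 0 < e' by rewrite divr_gt0//; lra.
(* Compactness of [-K, K] makes the continuity of (x, t) |-> g (x - t) - g x uniform in x. *)
have unif : \forall t \near (0 : R), `[- K, K] `<=` [set x | `|g (x - t) - g x| < e'].
  have /compact_near_coveringP cov := @segment_compact R (- K) K.
  apply: (cov R (nbhs (0 : R)) (fun t x => `|g (x - t) - g x| < e')) => x _.
  have cx : (fun p : R * R => g (p.1 - p.2) - g p.1) p @[p --> (x, 0 : R)] -->
      g (x - 0) - g x.
    apply: cvgB.
      apply: continuous_cvg; first exact: cg.
      by apply: cvgB; [exact: cvg_fst|exact: cvg_snd].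
    by apply: continuous_cvg; [exact: cg|exact: cvg_fst].
  move/cvgrPdist_lt : cx => /(_ _ e'0).
  rewrite subr0 subrr; apply: filterS => -[y t] /=.
  by rewrite sub0r normrN.
have [d d0 dP] : exists2 d : R, 0 < d & forall t, `|t| < d ->
    `[- K, K] `<=` [set x | `|g (x - t) - g x| < e'].
  move/nbhs_ballP : unif => [d /= d0 dP]; exists d => // t td.
  by apply: dP; rewrite /ball/= sub0r normrN.
exists (Num.min d 1); first by rewrite lt_min d0 ltr01.
move=> t; rewrite lt_min => /andP[td t1].
have mfg : measurable_fun setT (fun z => `|f z - g z|%:E).
  by apply/measurable_EFinP/measurableT_comp => //; exact: measurable_funB.
have shiftm h : measurable_fun setT h -> measurable_fun setT (fun x : R => h (x - t) : R).
  by move=> mh; apply: measurableT_comp => //; exact: measurable_funB.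
have I1 : (\int[mu]_(x in `[(- K)%R, K]) `|f (x - t) - g (x - t)|%:E <= (e / 3)%:E)%E.
  apply: le_trans (ltW nE).
  rewrite integral_mkcond [leRHS]integral_mkcond.
  have mE' : measurable_fun setT ((fun z => `|(f z - g z)%:E|%E) \_ E).
    exact: measurable_fun_patch mE mfg.
  rewrite -(ge0_integral_shift t mE'); last first.
    by move=> x; rewrite patchE; case: ifP.
  have mfgt : measurable_fun setT (fun x : R => `|f (x - t) - g (x - t)|%:E).
    apply/measurable_EFinP; apply: measurableT_comp => //.
    by apply: measurable_funB; exact: shiftm.
  apply: ge0_le_integral => //.
  - by move=> x _; rewrite patchE; case: ifP; rewrite ?lee_fin.
  - exact: measurable_fun_patch (measurable_itv _) mfgt.
  - by apply: (measurableT_comp mE'); exact: measurable_funB.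
  - move=> x _; rewrite !patchE; case: ifPn => [|_]; last first.
      by case: ifP => _; rewrite ?abse_ge0.
    rewrite inE /= in_itv/= => /andP[x1 x2]; rewrite mem_set//.
    rewrite /E/= in_itv/=; move: t1; rewrite ltr_norml => /andP[? ?].
    by apply/andP; split; lra.
have I2 : (\int[mu]_(x in `[(- K)%R, K]) `|g (x - t) - g x|%:E <= (e / 3)%:E)%E.
  apply: (@le_trans _ _ (\int[mu]_(x in `[(- K)%R, K]) e'%:E)%E).
    apply: ge0_le_integral => //.
    - apply/measurable_funTS/measurable_EFinP/measurableT_comp => //.
      by apply: measurable_funB => //; exact: shiftm.
    - by move=> x xK; rewrite lee_fin ltW//; exact: dP.
  rewrite integral_cst_cc ?lee_fin; last lra.
  rewrite opprK /e' -mulrA ger_pMr//.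
  by rewrite mulrC ler_pdivrMr; lra.
have I3 : (\int[mu]_(x in `[(- K)%R, K]) `|f x - g x|%:E <= (e / 3)%:E)%E.
  apply: le_trans (ltW nE); apply: ge0_subset_integral => //.
    by apply/measurable_funTS.
  by apply: subset_itv; rewrite bnd_simp; lra.
have -> : (e%:E = (e / 3)%:E + ((e / 3)%:E + (e / 3)%:E))%E.
  by rewrite -!EFinD; congr EFin; lra.
apply: le_trans (leeD I1 (leeD I2 I3)).
have m1 : measurable_fun `[- K, K] (fun x => `|f (x - t) - g (x - t)|%:E).
  apply/measurable_funTS/measurable_EFinP/measurableT_comp => //.
  by apply: measurable_funB; exact: shiftm.
have m2 : measurable_fun `[- K, K] (fun x => `|g (x - t) - g x|%:E).
  apply/measurable_funTS/measurable_EFinP/measurableT_comp => //.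
  by apply: measurable_funB => //; exact: shiftm.
have m3 : measurable_fun `[- K, K] (fun x => `|f x - g x|%:E).
  exact: measurable_funTS.
rewrite -ge0_integralD//.
rewrite -ge0_integralD//; last 2 first.
- by move=> x _; exact: adde_ge0.
- exact: emeasurable_funD.
apply: ge0_le_integral => //.
- apply/measurable_funTS/measurable_EFinP/measurableT_comp => //.
  by apply: measurable_funB => //; exact: shiftm.
- by apply: emeasurable_funD => //; exact: emeasurable_funD.
- move=> x _; rewrite -!EFinD lee_fin.
  rewrite -[f (x - t) - f x](subrKA (g (x - t))) (le_trans (ler_normD _ _))//.
  rewrite lerD2l -[g (x - t) - f x](subrKA (g x)) (le_trans (ler_normD _ _))//.
  by rewrite lerD2l distrC.
Qed.

(** The quantity under the norm is the integral of f (s - q) - f s over q in [0, t]. Tonelli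
    exchanges the integrals in s and q, leaving an integral over [0, t] of quantities bounded by
    e. *)
Lemma average_le f (A : set (measurableTypeR R)) (t e : R) : measurable A -> 0 < t ->
  mu.-integrable setT (EFin \o f) ->
  (forall q, 0 <= q <= t -> (\int[mu]_(s in A) `|f (s - q) - f s|%:E <= e%:E)%E) ->
  (\int[mu]_(s in A) `|prim f s - prim f (s - t) - t * f s|%:E <= (t * e)%:E)%E.
Proof.
move=> mA t0 intf fe.
have mf : measurable_fun setT f by case/integrableP: intf => /measurable_EFinP.
pose F (z : measurableTypeR R * measurableTypeR R) : \bar R :=
  (\1_A z.1 * \1_`[0, t] z.2 * `|f (z.1 - z.2) - f z.1|)%:E.
have mF : measurable_fun setT F.
  apply/measurable_EFinP/measurable_funM; first apply: measurable_funM.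
  - by apply: measurableT_comp => //; exact: measurable_indic.
  - by apply: measurableT_comp => //; exact: measurable_indic.
  - apply: measurableT_comp => //; apply: measurable_funB.
      by apply: measurableT_comp => //; exact: measurable_funB.
    exact: measurableT_comp.
have F0 z : (0 <= F z)%E by rewrite lee_fin !mulr_ge0.
have mp : measurable_fun setT (prim f).
  by apply: continuous_measurable_fun; exact: prim_continuous.
have mq (s : R) : measurable_fun setT (fun r : R => `|f r - f s|%:E).
  by apply/measurable_EFinP/measurableT_comp => //; exact: measurable_funB.
have mprim : measurable_fun setT
    (fun s => `|prim f s - prim f (s - t) - t * f s|%:E).
  apply/measurable_EFinP; apply: measurableT_comp => //.
  apply: measurable_funB; last exact: measurable_funM.
  apply: measurable_funB => //; apply: measurableT_comp => //.
  exact: measurable_funB.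
have mshift q : measurable_fun setT (fun s : R => `|f (s - q) - f s|%:E).
  apply/measurable_EFinP; apply: measurableT_comp => //.
  apply: measurable_funB => //; apply: measurableT_comp => //.
  exact: measurable_funB.
apply: (@le_trans _ _ (\int[mu]_s \int[mu]_q F (s, q))%E).
  rewrite integral_mkcond; apply: ge0_le_integral => //.
  - by move=> s _; rewrite patchE; case: ifP; rewrite ?lee_fin.
  - exact: measurable_fun_patch mA mprim.
  - exact: measurable_fun_fubini_tonelli_F.
  move=> s _; rewrite patchE; case: ifPn => [As|nAs]; last exact: integral_ge0.
  have ints : mu.-integrable `]s - t, s] (EFin \o f) by exact: integrableS intf.
  have intc : mu.-integrable `]s - t, s] (EFin \o cst (f s)).
    apply: (@measurable_bounded_integrable _ _ _ mu (cst (f s))) => //.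
      exact: lebesgue_measure_oc_fin.
    by exists `|f s|; split => // M fM x _; exact: ltW.
  rewrite primB//; last by rewrite lerBlDr lerDl ltW.
  have -> : t * f s = \int[mu]_(r in `]s - t, s]) f s.
    rewrite Rintegral_cst//= lebesgue_measure_itv/= lte_fin ltrBlDr ltrDl t0 mulrC.
    by congr (_ * _); rewrite /= opprB addrC subrK.
  rewrite -RintegralB// EFin_normr_Rintegral//; last first.
    have mI : measurable (`]s - t, s]%classic : set (measurableTypeR R)).
    exact: measurable_itv.
    exact: (integrableB mI ints intc).
  apply: le_trans.
    apply: le_abse_integral => //.
    by apply/measurable_EFinP/measurable_funTS; exact: measurable_funB.
  rewrite integral_mkcond.
  have mr : measurable_fun setT ((fun r : R => `|f r - f s|%:E) \_ `]s - t, s]).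
    exact: measurable_fun_patch (measurable_itv _) (mq s).
  (* The substitution r = s - q maps ]s - t, s] to [0, t[, whatever s is, so that the order of
     integration can be exchanged. *)
  rewrite -(ge0_integral_reflect s mr); last first.
    by move=> r; rewrite patchE; case: ifP; rewrite ?lee_fin.
  apply: ge0_le_integral => //.
  - by move=> r _; rewrite patchE; case: ifP; rewrite ?lee_fin.
  - apply: (measurableT_comp mr).
    exact: measurable_funB.
  - exact: (measurableT_comp mF (pair1_measurable s)).
  - move=> q _; rewrite /F/= patchE; case: ifPn => [|_]; last by rewrite lee_fin !mulr_ge0.
    rewrite inE /= in_itv/= => /andP[q1 q2].
    rewrite !indicE As mem_set ?mul1r//= in_itv/=; apply/andP; split; lra.
rewrite fubini_tonelli//.
apply: (@le_trans _ _ (\int[mu]_(q in `[0%R, t]) e%:E)%E); last first.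
  by rewrite integral_cst_cc ?(ltW t0)// subr0 (mulrC e) lexx.
rewrite [leRHS]integral_mkcond; apply: ge0_le_integral => //.
- by move=> q _; exact: integral_ge0.
- exact: measurable_fun_fubini_tonelli_G.
- by apply: measurable_fun_patch => //; exact: measurable_cst.
- move=> q _; rewrite patchE; case: ifPn => [qt|qt].
    apply: le_trans (fe q _); last by move: qt; rewrite inE /= in_itv.
    rewrite [leRHS]integral_mkcond; apply: ge0_le_integral => //.
    + exact: (measurableT_comp mF (pair2_measurable q)).
    + exact: measurable_fun_patch mA (mshift q).
    + move=> s _; rewrite patchE /F/= !indicE qt mulr1.
      by case: (s \in A); rewrite ?mul1r ?mul0r.
  rewrite integral0_eq// => s _.
  by rewrite /F/= [\1_`[0, t] _]indicE (negbTE qt) mulr0 mul0r.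
Qed.

End primitive.

(** * Weak derivatives *)

Section smooth_functions.
Context {R : realType}.
Implicit Types f g : R -> R.

(** Carrying a witness for the derivative at each order lets sums, products and affine substitutions
    go by induction, without formulas for iterated derivatives; [smooth_derivable] converts back to
    [derive1n]. *)
Fixpoint smooth_upto (n : nat) f : Prop :=
  if n is n'.+1 then
    exists2 f', (forall x : R, is_derive x 1 f (f' x)) & smooth_upto n' f'
  else True.

Lemma smooth_uptoS n f : smooth_upto n.+1 f -> smooth_upto n f.
Proof.
elim: n f => [//|n ih] f [f' ff' f'n]; exists f' => //; exact: ih.
Qed.

Lemma smooth_upto_add n f g : smooth_upto n f -> smooth_upto n g ->
  smooth_upto n (fun x => f x + g x).
Proof.
elim: n f g => [//|n ih] f g [f' ff' f'n] [g' gg' g'n].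
by exists (fun x => f' x + g' x) => [x|]; [exact: is_deriveD|exact: ih].
Qed.

Lemma smooth_upto_cst n (a : R) : smooth_upto n (cst a).
Proof. by elim: n a => [//|n ih] a; exists (cst 0) => // x; exact: is_derive_cst. Qed.

Lemma smooth_upto_mul n f g : smooth_upto n f -> smooth_upto n g ->
  smooth_upto n (fun x => f x * g x).
Proof.
elim: n f g => [//|n ih] f g fn gn.
have [f' ff' f'n] := fn; have [g' gg' g'n] := gn.
exists (fun x => f x * g' x + g x * f' x) => [x|].
  exact: (is_deriveM (ff' x) (gg' x)).
by apply: smooth_upto_add; apply: ih => //; exact: smooth_uptoS.
Qed.

Lemma smooth_upto_comp_affine n f (a b : R) : smooth_upto n f ->
  smooth_upto n (fun x => f (a * x + b)).
Proof.
elim: n f => [//|n ih] f [f' ff' f'n].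
exists (fun x => f' (a * x + b) * a) => [x|].
  have d : is_derive x 1 (fun y : R => a * y + b) a.
    have dz := @is_deriveZ _ _ _ id a x 1 1 (is_derive_id x 1).
    apply: (is_derive_eq (is_deriveD dz (is_derive_cst b x 1))).
    by rewrite addr0 /GRing.scale/= mulr1.
  exact: (is_derive1_comp (ff' _) d).
by apply: smooth_upto_mul; [exact: ih|exact: smooth_upto_cst].
Qed.

Lemma smooth_derivable f : (forall n, smooth_upto n f) ->
  forall n (x : R), derivable (derive1n n f) x 1.
Proof.
move=> fn n; elim: n f {fn}(fn n.+1) => [|n ih] f [f' ff' f'n] x.
  by have [] := ff' x.
rewrite derive1Sn; suff -> : derive1 f = f' by exact: ih.
by apply/funext => y; rewrite derive1E; have [_ ->] := ff' y.
Qed.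

(* The powers of [x^-1] make the span of this family closed under differentiation. *)
Definition flat (n : nat) (x : R) : R :=
  if 0 < x then x^-1 ^+ n * expR (- x^-1) else 0.

Lemma flat_ge0 n x : 0 <= flat n x.
Proof.
rewrite /flat; case: ltP => // x0.
by rewrite mulr_ge0 ?expR_ge0// exprn_ge0// invr_ge0 ltW.
Qed.

Lemma flat0_le1 x : flat 0 x <= 1.
Proof.
rewrite /flat; case: ltP => // x0; rewrite expr0 mul1r -expR0 ler_expR.
by rewrite oppr_le0 invr_ge0 ltW.
Qed.

Lemma flat_gt0 n x : 0 < x -> 0 < flat n x.
Proof. by move=> x0; rewrite /flat x0 mulr_gt0 ?expR_gt0// exprn_gt0// invr_gt0. Qed.

Lemma flatS n x : flat n.+1 x = x^-1 * flat n x.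
Proof. by rewrite /flat; case: ifP => _; rewrite ?mulr0// exprS mulrA. Qed.

(** With y = 1/x, the exponential series gives y^(n+1) <= (n+1)! exp y, so [flat n.+1] is bounded by
    (n+1)!, and [flat n x] is x times it. The linear bound provides the derivative at 0. *)
Lemma flat_le n x : flat n x <= (n.+1)`!%:R * `|x|.
Proof.
have [x0|x0] := ltP 0 x; last first.
  by rewrite /flat ltNge x0 /= mulr_ge0.
have y0 : 0 <= x^-1 by rewrite invr_ge0 ltW.
rewrite gtr0_norm// -ler_pdivrMr// mulrC -flatS /flat x0 expRN.
rewrite ler_pdivrMr ?expR_gt0// mulrC -ler_pdivrMr ?ltr0n ?fact_gt0//.
by apply: le_trans (expR_ge1Dxn n y0); rewrite lerDr.
Qed.

Lemma is_derive_flat n (x : R) :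
  is_derive x 1 (flat n) (- n%:R * flat n.+1 x + flat n.+2 x).
Proof.
have [x0|x0|<-] := ltgtP 0 x.
- have dV : is_derive x 1 (fun y : R => y^-1) (- x ^- 2).
    have := @is_deriveV _ id x 1 1 _ (is_derive_id x 1).
    by rewrite /GRing.scale/= mulr1; apply; rewrite gt_eqF.
  have dg : is_derive x^-1 1 (fun y : R => y ^+ n * expR (- y))
      (x^-1 ^+ n * - expR (- x^-1) + expR (- x^-1) * (n%:R * x^-1 ^+ n.-1)).
    apply: (@is_deriveM _ _ (fun y : R => y ^+ n) (fun y : R => expR (- y))).
      rewrite (_ : (fun y : R => y ^+ n) = (id : R -> R) ^+ n); last first.
        by apply/funext => y; elim: n => [//|n ih]; rewrite !exprS ih.
      apply: (is_derive_eq (is_deriveX n (is_derive_id x^-1 1))).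
      by rewrite /GRing.scale/= mulr1.
    have dN := is_deriveN (is_derive_id x^-1 1).
    apply: (is_derive_eq (is_derive1_comp (is_derive_expR (- x^-1)) dN)).
    by rewrite mulrN1.
  have := is_derive1_comp dg dV.
  have e : {near x, (fun y : R => y ^+ n * expR (- y)) \o (fun y : R => y^-1) =1 flat n}.
    near=> y; rewrite /flat /= ifT//.
    by near: y; exact: lt_nbhsr.
  move=> /(near_eq_is_derive e) de; apply: (is_derive_eq de).
  rewrite /flat x0; case: n {dg e de} => [|n] /=.
    by rewrite !expr0 oppr0 !mul0r mulr0 addr0 add0r expr2 exprVn; ring.
  have -> : x ^- 2 = x^-1 * x^-1 by rewrite -exprVn expr2.
  by rewrite !exprS; ring.
- have e : {near x, cst 0 =1 flat n}.
    near=> y; rewrite /flat ifF//; apply/negbTE; rewrite -leNgt ltW//.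
    by near: y; exact: lt_nbhsl.
  have /(near_eq_is_derive e) de := is_derive_cst (0 : R) x 1.
  apply: (is_derive_eq de); rewrite /flat ltNge (ltW x0)/=.
  by rewrite !mulr0 addr0.
(* At 0 the difference quotient is [flat n.+1 h], which tends to 0 by the linear bound one index
   higher. *)
- have lim : h^-1 *: (flat n (h *: 1 + 0) - flat n 0) @[h --> (0:R)^'] --> (0 : R).
    apply/cvgr0Pnorm_le => e e0.
    have C0 : 0 < (n.+2)`!%:R :> R by rewrite ltr0n fact_gt0.
    near=> h.
    have -> : flat n 0 = 0 by rewrite /flat ltxx.
    rewrite subr0 addr0 /GRing.scale/= mulr1 -flatS ger0_norm ?flat_ge0//.
    apply: le_trans (flat_le _ _) _; rewrite mulrC -ler_pdivlMr//.
    by near: h; apply: dnbhs0_le; rewrite divr_gt0.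
  rewrite {2 3}/flat ltxx mulr0 addr0; apply: DeriveDef.
    by apply/cvg_ex; exists 0.
  exact/cvg_lim.
Unshelve. all: by end_near. Qed.

Lemma smooth_flat n k : smooth_upto n (flat k).
Proof.
elim: n k => [//|n ih] k; exists (fun x => - k%:R * flat k.+1 x + flat k.+2 x).
  by move=> x; exact: is_derive_flat.
by apply: smooth_upto_add => //; apply: smooth_upto_mul => //; exact: smooth_upto_cst.
Qed.

(** Two flat functions glued back to back: smooth, positive exactly on (-1, 1). It is left
    unnormalised; its total mass is [step 1] below. *)
Definition mollifier (x : R) : R := flat 0 (x + 1) * flat 0 (1 - x).

Lemma smooth_mollifier n : smooth_upto n mollifier.
Proof.
apply: smooth_upto_mul.
  have := smooth_upto_comp_affine 1 1 (smooth_flat n 0).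
  by congr smooth_upto; apply/funext => x; rewrite mul1r.
have := smooth_upto_comp_affine (-1) 1 (smooth_flat n 0).
by congr smooth_upto; apply/funext => x; rewrite mulN1r addrC.
Qed.

Lemma mollifier_ge0 x : 0 <= mollifier x.
Proof. by rewrite mulr_ge0 ?flat_ge0. Qed.

Lemma mollifier_le1 x : mollifier x <= 1.
Proof. by rewrite mulr_ile1 ?flat_ge0 ?flat0_le1. Qed.

Lemma mollifier_gt0 x : `|x| < 1 -> 0 < mollifier x.
Proof. by rewrite ltr_norml => /andP[? ?]; rewrite mulr_gt0 ?flat_gt0//; lra. Qed.

Lemma mollifier_eq0 x : 1 <= `|x| -> mollifier x = 0.
Proof.
rewrite /mollifier /flat ler_normr => /orP[|] x1.
  by rewrite [0 < 1 - x]ltNge (_ : 1 - x <= 0) ?mulr0//; lra.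
by rewrite [0 < x + 1]ltNge (_ : x + 1 <= 0) ?mul0r//; lra.
Qed.

Lemma continuous_mollifier : continuous mollifier.
Proof.
move=> x; apply: differentiable_continuous; apply/derivable1_diffP.
by have [f' d _] := smooth_mollifier 1; have [] := d x.
Qed.

End smooth_functions.

(** * Primitives of L1 functions have weak derivatives *)

Section primitives_and_weak_derivatives.
Context {R : realType}.
Notation mu := (@lebesgue_measure R).
Notation m01 := (@lebesgue01 R).
Implicit Types u v w : L1_01 R.

Lemma L1_01_restrict_integrable u :
  mu.-integrable setT (EFin \o ((u : R -> R) \_ `]0, 1[)).
Proof.
have mu_ : measurable_fun setT (u : R -> R) := L1_measurable u.
have mI : measurable (`]0, 1[%classic : set (measurableTypeR R)) by exact: measurable_itv.
rewrite -restrict_EFin -integrable_mkcond//.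
apply/integrableP; split; first exact/measurable_EFinP/measurable_funTS.
have mau : measurable_fun setT (fun x : R => `|u x|%:E).
  by apply/measurable_EFinP; exact: measurableT_comp.
have /integrableP[_] := L1_integrable u.
by rewrite (ge0_integral01 mau).
Qed.

Lemma Rintegral01 (f : R -> R) : measurable_fun setT f ->
  \int[m01]_x f x = \int[mu]_(x in `]0, 1[) f x.
Proof. by move=> mf; congr fine; apply/integral01/measurable_EFinP. Qed.

Lemma Rintegral_oo_cc (a b : R) (f : R -> R) : measurable_fun setT f ->
  \int[mu]_(x in `]a, b[) f x = \int[mu]_(x in `[a, b]) f x.
Proof.
move=> mf; congr fine; apply/esym/integral_itv_bndoo.
exact/measurable_EFinP/measurable_funTS.
Qed.

Lemma continuous_integrable_cc (f : R -> R) (a b : R) : continuous f ->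
  mu.-integrable `[a, b] (EFin \o f).
Proof.
move=> cf; apply: continuous_compact_integrable; first exact: segment_compact.
exact: continuous_subspaceT.
Qed.

Lemma Rintegral_derive1 (f : R -> R) (a b : R) : a <= b ->
  (forall x : R, derivable f x 1) -> continuous (derive1 f) ->
  \int[mu]_(x in `[a, b]) derive1 f x = f b - f a.
Proof.
rewrite le_eqVlt => /predU1P[<- _ _|ab df cf].
  by rewrite set_itv1 Rintegral_set1 subrr.
have cF : continuous f.
  by move=> x; apply/differentiable_continuous/derivable1_diffP/df.
have fFTC : derivable_oo_LRcontinuous f a b.
  split => [x _| |]; first exact: df.
    by apply: cvg_at_right_filter; exact: cF.
  by apply: cvg_at_left_filter; exact: cF.
have /= := continuous_FTC2 ab (continuous_subspaceT cf) fFTC (fun x _ => erefl).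
by rewrite /Rintegral => ->.
Qed.

Section test_functions.
Variable phi : R -> R.
Hypothesis tphi : test_function phi.

Lemma test_function_derivable (x : R) : derivable phi x 1.
Proof. by case: tphi => d _ _; exact: (d 0%N). Qed.

Lemma test_function_continuous_derive : continuous (derive1 phi).
Proof.
case: tphi => d _ _ x.
by apply/differentiable_continuous/derivable1_diffP; exact: (d 1%N).
Qed.

Lemma test_function_continuous : continuous phi.
Proof.
by move=> x; apply/differentiable_continuous/derivable1_diffP/test_function_derivable.
Qed.

Lemma test_function_outside x : ~ (0 < x < 1) -> phi x = 0.
Proof.
case: tphi => _ _ supp x01; apply: contrapT => phix; apply: x01.
have : closure [set x | phi x != 0] x by apply: subset_closure; exact/eqP.
by move=> /supp /=; rewrite in_itv.
Qed.

Lemma test_function_integral_from a : a <= 1 ->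
  \int[mu]_(x in `[a, 1]) derive1 phi x = - phi a.
Proof.
move=> a1; rewrite Rintegral_derive1//; last first.
- exact: test_function_continuous_derive.
- exact: test_function_derivable.
- by rewrite (test_function_outside (x := 1)) ?ltxx ?andbF// sub0r.
Qed.

(** Integration by parts for W merely integrable: Fubini on the triangle y <= x turns the left side
    into the integral of W y times the integral of phi' over [y, 1], and the latter is - phi y as
    phi vanishes at 1. *)
Lemma prim_test_function (W : R -> R) : mu.-integrable setT (EFin \o W) ->
  (forall x, ~ (0 < x < 1) -> W x = 0) ->
  \int[mu]_(x in `]0, 1[) (prim W x * derive1 phi x) =
  - \int[mu]_(x in `]0, 1[) (W x * phi x).
Proof.
move=> intW W0; set g := derive1 phi.
have cg : continuous g := test_function_continuous_derive.
have mg : measurable_fun setT g by exact: continuous_measurable_fun.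
have mphi : measurable_fun setT phi.
  by apply: continuous_measurable_fun; exact: test_function_continuous.
have mW : measurable_fun setT W by case/integrableP: intW => /measurable_EFinP.
have cP := prim_continuous intW.
have mP : measurable_fun setT (prim W) by exact: continuous_measurable_fun.
have mI : measurable (`]0, 1[%classic : set (measurableTypeR R)) by exact: measurable_itv.
pose D := [set z : measurableTypeR R * measurableTypeR R | z.2 <= z.1].
have mD : measurable D.
  have ms : measurable_fun setT (fun z : measurableTypeR R * measurableTypeR R =>
      z.1 - z.2 : measurableTypeR R) by exact: measurable_funB.
  have := ms measurableT `[0, +oo[%classic (measurable_itv _).
  rewrite setTI; congr measurable; apply/seteqP; split => z /=.
    by rewrite /D/= in_itv/= andbT subr_ge0.
  by rewrite /D/= in_itv/= andbT subr_ge0.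
pose F (z : measurableTypeR R * measurableTypeR R) : \bar R :=
  (\1_(`]0, 1[) z.1 * g z.1 * (\1_D z * W z.2))%:E.
have mF : measurable_fun setT F.
  apply/measurable_EFinP; apply: measurable_funM; apply: measurable_funM.
  - by apply: measurableT_comp => //; exact: measurable_indic.
  - exact: measurableT_comp.
  - exact: measurable_indic.
  - exact: measurableT_comp.
have [M gM] : exists M : R, forall x, 0 < x < 1 -> `|g x| <= M.
  have := @segment_compact R 0 1 => /(continuous_compact (continuous_subspaceT cg)).
  move=> /compact_bounded[M [_ bM]]; exists (M + 1) => x /andP[x0 x1].
  apply: (bM (M + 1)); first by rewrite ltrDl.
  by exists x => //=; rewrite in_itv/= !ltW.
have M0 : 0 <= M by apply: le_trans (gM (1 / 2) _) => //; lra.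
have intF : (mu \x mu)%E.-integrable setT F.
  apply/integrable12ltyP => //.
  apply: (@le_lt_trans _ _ (\int[mu]_(x in `]0%R, 1%R[) (M%:E * \int[mu]_y `|W y|%:E))%E).
    rewrite [leRHS]integral_mkcond; apply: ge0_le_integral => //.
    - by move=> x _; exact: integral_ge0.
    - apply: (@measurable_fun_fubini_tonelli_F _ _ _ _ _ mu (fun z => `|F z|%E)) => //.
      exact: measurableT_comp.
    - by apply: measurable_fun_patch => //; exact: measurable_cst.
    - move=> x _; rewrite patchE; case: ifPn => xI; last first.
        rewrite integral0_eq// => y _.
        by rewrite /F/= indicE (negbTE xI) !mul0r normr0.
      rewrite -ge0_integralZl//; last first.
        by apply/measurable_EFinP; exact: measurableT_comp.
      apply: ge0_le_integral => //.
      + apply: measurableT_comp => //.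
        exact: (measurableT_comp mF (pair1_measurable x)).
      + apply: emeasurable_funM => //.
        by apply/measurable_EFinP; exact: measurableT_comp.
      + move=> y _; rewrite /F/= indicE xI mul1r -EFinM lee_fin !normrM.
        apply: ler_pM => //; first by apply: gM; move: xI; rewrite inE /= in_itv.
        by rewrite ler_piMl// indicE; case: (_ \in _); rewrite ?normr1 ?normr0.
  rewrite integral_cst//= lebesgue_measure_itv/= lte_fin ltr01 sube0 mule1.
  have /integrableP[_ Wfin] := intW.
  by rewrite lte_mul_pinfty.
have inner1 x : (\int[mu]_y F (x, y) = (\1_(`]0, 1[) x * g x * prim W x)%:E)%E.
  rewrite /F/=; under eq_integral do rewrite EFinM.
  have e : (fun y => (\1_D (x, y) * W y)%:E) = (EFin \o W) \_ `]-oo, x].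
    apply/funext => y; rewrite patchE indicE.
    have -> : ((x, y) \in D) = (y \in `]-oo, x]%classic).
      by apply/idP/idP => /set_mem yx; apply/mem_set; move: yx; rewrite /D/= in_itv.
    by case: (y \in _); rewrite ?mul1r ?mul0r.
  rewrite integralZl//; last first.
    by rewrite e -integrable_mkcond//; exact: integrableS intW.
  rewrite e -integral_mkcond /prim [RHS]EFinM /Rintegral fineK//.
  by apply: integrable_fin_num => //; exact: integrableS intW.
(* Only y in (0, 1) matters since W vanishes elsewhere; then x >= y forces x > 0, so the two
   indicators cut out [y, 1[. *)
have inner2 y : (\int[mu]_x F (x, y) = (- (W y * phi y))%:E)%E.
  have [y01|y01] := boolP (0 < y < 1); last first.
    rewrite W0; last exact/negP.
    rewrite mul0r oppr0 integral0_eq// => x _.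
    by rewrite /F/= W0 ?mulr0//; exact/negP.
  rewrite /F/= (eq_integral (fun x : measurableTypeR R =>
      (W y)%:E * ((EFin \o g) \_ `[y, 1%R[) x)%E); last first.
    move=> x _; rewrite patchE !indicE.
    have -> : ((x, y) \in D) = (y <= x).
      by apply/idP/idP => [/set_mem//|yx]; exact/mem_set.
    have -> : (x \in `]0, 1[%classic) = (0 < x < 1).
      by apply/idP/idP => [/set_mem|h]; [|apply/mem_set]; rewrite /= in_itv.
    have -> : (x \in `[y, 1[%classic) = (y <= x < 1).
      by apply/idP/idP => [/set_mem|h]; [|apply/mem_set]; rewrite /= in_itv.
    case: (leP y x) => yx; rewrite ?mul0r ?mulr0 ?mule0//=.
    have -> : 0 < x by case/andP: y01 => + _; move/lt_le_trans; exact.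
    by case: (x < 1); rewrite ?mul0r ?mule0//= !mul1r -EFinM mulrC.
  have intg : mu.-integrable `[y, 1[ (EFin \o g).
    apply: integrableS (continuous_integrable_cc y 1 cg) => //.
    by apply: subset_itvl; rewrite bnd_simp.
  rewrite integralZl//; last by rewrite -integrable_mkcond.
  rewrite -integral_mkcond integral_itv_bndo_bndc; last first.
    by apply/measurable_EFinP/measurable_funTS.
  have /andP[_ /ltW y1] := y01.
  have e := test_function_integral_from y1; rewrite -/g /Rintegral in e.
  rewrite -[X in (_ * X)%E]fineK; first by rewrite [fine _]e -EFinM mulrN.
  by apply: integrable_fin_num => //; exact: continuous_integrable_cc.
have := Fubini intF.
under eq_integral do rewrite inner1.
under [in X in _ = X -> _]eq_integral do rewrite inner2.
move=> /(congr1 fine).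
have -> : fine (\int[mu]_x (\1_(`]0, 1[) x * g x * prim W x)%:E)%E =
    \int[mu]_(x in `]0, 1[) (prim W x * g x).
  rewrite Rintegral_mkcond; apply: eq_Rintegral => x _.
  by rewrite patchE indicE; case: (x \in _); rewrite ?mul1r ?mul0r// mulrC.
move=> ->; rewrite Rintegral_mkcond -[RHS]mulN1r.
have -> : (fun x => W x * phi x) \_ `]0, 1[ = fun x => W x * phi x.
  apply/funext => x; rewrite patchE; case: ifPn => // xI.
  rewrite W0 ?mul0r// => x01; move/negP: xI; apply; rewrite inE /= in_itv/=.
  exact: x01.
rewrite -RintegralZl//.
  by congr fine; apply: eq_integral => x _; rewrite mulN1r.
have [Mp phiM] : exists M : R, forall x, `|phi x| <= M.
  have := @segment_compact R 0 1 =>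
    /(continuous_compact (continuous_subspaceT test_function_continuous)).
  move=> /compact_bounded[N [_ bN]]; exists `|N + 1| => x.
  have [/andP[x0 x1]|x01] := boolP (0 < x < 1); last first.
    by rewrite test_function_outside ?normr0//; exact/negP.
  apply: le_trans (ler_norm _); apply: (bN (N + 1)); first by rewrite ltrDl.
  by exists x => //=; rewrite in_itv/= !ltW.
apply: (@le_integrable _ _ _ mu _ measurableT _ (EFin \o (fun x => Mp * `|W x|))).
- by apply/measurable_EFinP; exact: measurable_funM.
- move=> x _; rewrite /= lee_fin !normrM normr_id mulrC ler_wpM2r//.
  by apply: le_trans (phiM x) _; exact: ler_norm.
- exact: (@integrableZl _ _ _ mu _ measurableT Mp _ (integrable_norm intW)).
Qed.

End test_functions.

(** The primitive is handled by [prim_test_function]; the constant k contributes k times the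
    integral of phi', which is 0 because phi vanishes at both ends. *)
Lemma prim_weak_derivative u w (k : R) :
  {ae m01, forall x, u x = k + prim ((w : R -> R) \_ `]0, 1[) x} ->
  is_weak_derivative u w.
Proof.
move=> uE phi tphi; set g := derive1 phi.
pose W := (w : R -> R) \_ `]0, 1[; rewrite -/W in uE.
have intW : mu.-integrable setT (EFin \o W) := L1_01_restrict_integrable w.
have W0 x : ~ (0 < x < 1) -> W x = 0.
  by move=> x01; rewrite /W patchE memNset//= in_itv.
have cg : continuous g := test_function_continuous_derive tphi.
have mg : measurable_fun setT g by exact: continuous_measurable_fun.
have mphi : measurable_fun setT phi.
  by apply: continuous_measurable_fun; exact: test_function_continuous.
have cP := prim_continuous intW.
have mP : measurable_fun setT (prim W) by exact: continuous_measurable_fun.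
have mu_ : measurable_fun setT (u : R -> R) := L1_measurable u.
have mw : measurable_fun setT (w : R -> R) := L1_measurable w.
have -> : \int[m01]_x (u x * g x) = \int[m01]_x ((k + prim W x) * g x).
  apply: Rintegral_ae => //; [exact: measurable_funM| |].
    by apply: measurable_funM => //; exact: measurable_funD.
  by apply: aeS uE => x -> _.
rewrite Rintegral01; last by apply: measurable_funM => //; exact: measurable_funD.
have -> : \int[m01]_x (w x * phi x) = \int[mu]_(x in `]0, 1[) (w x * phi x).
  by apply: Rintegral01; exact: measurable_funM.
have -> : \int[mu]_(x in `]0, 1[) (w x * phi x) = \int[mu]_(x in `]0, 1[) (W x * phi x).
  by apply: eq_Rintegral => x xI; rewrite /W patchE xI.
rewrite -(prim_test_function tphi intW W0).
have cPg : continuous (fun x => prim W x * g x).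
  by move=> x; apply: cvgM; [exact: cP|exact: cg].
have cc0 (f : R -> R) : continuous f -> mu.-integrable `]0, 1[ (EFin \o f).
  move=> cf; apply: integrableS (continuous_integrable_cc 0 1 cf) => //.
  exact: subset_itv_oo_cc.
have ckg : continuous (fun x => k * g x) by move=> x; apply: cvgMr; exact: cg.
under eq_Rintegral do rewrite mulrDl.
rewrite RintegralD//; [|exact: cc0|exact: cc0].
rewrite RintegralZl//; last exact: cc0.
rewrite (Rintegral_oo_cc 0 1 mg) test_function_integral_from//.
by rewrite (test_function_outside tphi (x := 0)) ?ltxx// oppr0 mulr0 add0r.
Qed.

End primitives_and_weak_derivatives.

(** * The du Bois-Reymond lemma and boundary values *)

Section du_Bois_Reymond.
Context {R : realType}.
Notation mu := (@lebesgue_measure R).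
Notation m01 := (@lebesgue01 R).
Implicit Types u v w : L1_01 R.

Lemma integrable_mul_bounded {d} {T : measurableType d}
    (nu : {measure set T -> \bar R}) (A : set T) (h k : T -> R) (C : R) :
  measurable A -> nu.-integrable A (EFin \o h) -> measurable_fun setT k ->
  (forall x, A x -> `|k x| <= C) ->
  nu.-integrable A (EFin \o (fun x => h x * k x)).
Proof.
move=> mA inth mk kC.
have mh : measurable_fun A h by case/integrableP: inth => /measurable_EFinP.
apply: (@le_integrable _ _ _ nu _ mA _ (EFin \o (fun x => C * `|h x|))).
- apply/measurable_EFinP; apply: measurable_funM => //.
  exact: measurable_funTS.
- move=> x Ax; rewrite /= lee_fin !normrM normr_id mulrC ler_wpM2r//.
  by apply: le_trans (ler_norm _); exact: kC.
- exact: (@integrableZl _ _ _ nu _ mA C _ (integrable_norm inth)).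
Qed.

Lemma L1_01_ext u v :
  {ae mu, forall x, 0 < x < 1 -> u x = v x} -> u = v.
Proof. by move=> /ae01 uv; apply: L1_ext; apply: aeS uv => x + _. Qed.

(** A nonempty open interval has positive measure, so it cannot lie in the exceptional null set. *)
Lemma ae_exists (P : R -> Prop) (a b : R) : a < b ->
  {ae mu, forall x, P x} -> exists2 x, a < x < b & P x.
Proof.
move=> ab [N [mN N0 PN]]; apply: contrapT => noP.
have sub : `]a, b[ `<=` N.
  move=> x /=; rewrite in_itv/= => xab; apply: PN => /= Px.
  by apply: noP; exists x.
have : (mu `]a, b[ <= mu N)%E by apply: le_measure => //; rewrite inE.
rewrite N0 lebesgue_measure_itv/= lte_fin ab -EFinB lee_fin.
by rewrite leNgt subr_gt0 ab.
Qed.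

Lemma mollifier_integrable : mu.-integrable setT (EFin \o (mollifier : R -> R)).
Proof.
have -> : EFin \o mollifier = (EFin \o (mollifier : R -> R)) \_ `[-1, 1].
  apply/funext => x; rewrite patchE; case: ifPn => // xI.
  rewrite /= mollifier_eq0//; move: xI; apply: contraNT.
  rewrite -ltNge ltr_norml => /andP[? ?]; apply/mem_set.
  by rewrite /= in_itv/= !ltW.
rewrite -integrable_mkcond//; apply: continuous_integrable_cc.
exact: continuous_mollifier.
Qed.

(** A smooth transition: 0 up to -1, constant from 1 on. *)
Definition step : R -> R := prim mollifier.

Lemma is_derive_step (x : R) : is_derive x 1 step (mollifier x).
Proof.
have [] := @continuous_FTC1 R mollifier -oo%O x (x + 1).
- by rewrite ltrDl.
- exact: integrableS mollifier_integrable.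
- exact: ltNyr.
- exact: continuous_mollifier.
move=> d1 d2; exact: DeriveDef d1 (etrans (esym (derive1E _ _)) d2).
Qed.

Lemma step_left x : x <= -1 -> step x = 0.
Proof.
move=> x1; rewrite -(mul0r (fine (mu `]-oo, x]))) -Rintegral_cst//.
apply: eq_Rintegral => y; rewrite inE /= in_itv/= => yx.
by rewrite mollifier_eq0// ler_normr; apply/orP; right; lra.
Qed.

Lemma step_right x : 1 <= x -> step x = step 1.
Proof.
move=> x1; apply/eqP; rewrite -subr_eq0 primB//; last exact: mollifier_integrable.
rewrite -(mul0r (fine (mu `]1, x]))) -Rintegral_cst//; apply/eqP.
apply: eq_Rintegral => y; rewrite inE /= in_itv/= => /andP[y1 yx].
by rewrite mollifier_eq0// ler_normr ltW.
Qed.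

(** By the mean value theorem on [-1, 1], [step 1] is twice the mollifier at an interior point.
    Positivity allows division by this mass, in place of normalising. *)
Lemma step1_gt0 : 0 < step 1.
Proof.
have dstep (x : R) : x \in `]-1, 1[%R -> is_derive x 1 step (mollifier x).
  by move=> _; exact: is_derive_step.
have cstep : {within `[-1, 1], continuous step}.
  exact/continuous_subspaceT/prim_continuous/mollifier_integrable.
have [|c c1] := MVT _ dstep cstep; first lra.
rewrite (step_left (lexx (-1))) subr0 => ->; apply: mulr_gt0; last lra.
by apply: mollifier_gt0; rewrite ltr_norml; move: c1; rewrite in_itv.
Qed.

(** A smoothed indicator of [a, b] that rises within e of a and falls within e of b. *)
Definition plateau (a b e x : R) : R :=
  step (e^-1 * x + - (e^-1 * a)) - step (e^-1 * x + - (e^-1 * b)).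

Lemma plateau_outside a b e x : 0 < e -> a <= b ->
  ~ (a - e <= x <= b + e) -> plateau a b e x = 0.
Proof.
move=> e0 ab /negP; rewrite negb_and -!ltNge /plateau -!mulrBr => /orP[] xe.
  by rewrite !step_left ?subrr// mulrC ler_pdivrMr//; lra.
by rewrite (step_right (x := e^-1 * (x - a))) ?(step_right (x := e^-1 * (x - b))) ?subrr//
  mulrC ler_pdivlMr//; lra.
Qed.

Definition scaled_mollifier (a e x : R) : R := e^-1 * mollifier (e^-1 * x + - (e^-1 * a)).

Lemma is_derive_step_affine a e (x : R) :
  is_derive x 1 (fun x => step (e^-1 * x + - (e^-1 * a))) (scaled_mollifier a e x).
Proof.
have d : is_derive x 1 (fun y : R => e^-1 * y + - (e^-1 * a)) e^-1.
  have dz := @is_deriveZ _ _ _ id e^-1 x 1 1 (is_derive_id x 1).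
  apply: (is_derive_eq (is_deriveD dz (is_derive_cst (- (e^-1 * a)) x 1))).
  by rewrite addr0 /GRing.scale/= mulr1.
apply: (is_derive_eq (is_derive1_comp (is_derive_step _) d)).
by rewrite mulrC.
Qed.

Lemma derive1_plateau a b e :
  derive1 (plateau a b e) = fun x => scaled_mollifier a e x - scaled_mollifier b e x.
Proof.
apply/funext => x; rewrite derive1E.
by have [_ ->] := is_deriveB (is_derive_step_affine a e x) (is_derive_step_affine b e x).
Qed.

Lemma test_function_plateau a b e : 0 < e -> a <= b -> 0 < a - e -> b + e < 1 ->
  test_function (plateau a b e).
Proof.
move=> e0 ab ae be.
have supp : closure [set x | plateau a b e x != 0] `<=` `[a - e, b + e].
  rewrite [X in _ `<=` X](closure_id _).1; last exact: interval_closed.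
  apply: closureS => x /= /eqP xne; rewrite in_itv/=.
  by apply: contrapT => xab; apply: xne; exact: plateau_outside.
split.
- apply: smooth_derivable => -[//|n].
  exists (fun x => scaled_mollifier a e x - scaled_mollifier b e x).
    by move=> x; exact: is_deriveB (is_derive_step_affine _ _ _) (is_derive_step_affine _ _ _).
  have smk d : smooth_upto n (scaled_mollifier d e).
    apply: smooth_upto_mul; first exact: smooth_upto_cst.
    exact/smooth_upto_comp_affine/smooth_mollifier.
  have := smooth_upto_add (smk a) (smooth_upto_mul (smooth_upto_cst n (-1)) (smk b)).
  by congr smooth_upto; apply/funext => x; rewrite mulN1r.
- apply: subclosed_compact supp; [exact: closed_closure|exact: segment_compact].
- move=> x /supp /=; rewrite !in_itv/= => /andP[x1 x2].
  by apply/andP; split; [exact: lt_le_trans x1|exact: le_lt_trans be].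
Qed.

Lemma scaled_mollifier_outside a e x :
  0 < e -> ~ (a - e < x < a + e) -> scaled_mollifier a e x = 0.
Proof.
move=> e0 /negP xe; rewrite /scaled_mollifier mollifier_eq0 ?mulr0//.
rewrite -mulrBr normrM gtr0_norm ?invr_gt0// mulrC ler_pdivlMr// mul1r.
by rewrite leNgt; apply: contra xe; rewrite ltr_norml => /andP[? ?]; apply/andP; split; lra.
Qed.

Lemma scaled_mollifier_bound a e x : 0 < e -> 0 <= scaled_mollifier a e x <= e^-1.
Proof.
move=> e0; have e1 : 0 <= e^-1 by rewrite invr_ge0 ltW.
by rewrite /scaled_mollifier mulr_ge0 ?mollifier_ge0//= ler_piMr ?mollifier_le1.
Qed.

Lemma continuous_scaled_mollifier (a e : R) : continuous (scaled_mollifier a e : R -> R).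
Proof.
move=> x; apply: cvgMr; apply: continuous_cvg; first exact: continuous_mollifier.
by apply: cvgD; [apply: cvgMr|exact: cvg_cst].
Qed.

Lemma integral_scaled_mollifier a e :
  0 < e -> \int[mu]_(x in `]a - e, a + e[) scaled_mollifier a e x = step 1.
Proof.
move=> e0; have ck := @continuous_scaled_mollifier a e.
rewrite Rintegral_oo_cc; last exact: continuous_measurable_fun.
have d1 x := is_derive_step_affine a e x.
have e1 : derive1 (fun x => step (e^-1 * x + - (e^-1 * a))) = scaled_mollifier a e.
  by apply/funext => x; rewrite derive1E; have [_ ->] := d1 x.
rewrite -[in LHS]e1 Rintegral_derive1; [|lra|by move=> x; have [] := d1 x|by rewrite e1].
rewrite -!mulrBr (_ : a + e - a = e); last by rewrite addrC addKr.
rewrite (_ : a - e - a = - e); last by rewrite addrC addKr.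
by rewrite mulrN mulVf ?gt_eqF// (step_left (x := -1))// subr0.
Qed.

(** The kernel has mass [step 1] and is at most 1/e on an interval of length 2e, that is, twice the
    density of the plain average; hence the factor 2. At a Lebesgue point the right side tends to 0
    with e. *)
Lemma scaled_mollifier_davg (h : R -> R) a e : 0 < e -> mu.-integrable setT (EFin \o h) ->
  (`|\int[mu]_(x in `]a - e, a + e[) (h x * scaled_mollifier a e x) - h a * step 1|%:E <=
   2%:E * davg h a e)%E.
Proof.
move=> e0 inth; set I := `]a - e, a + e[%classic.
have mI : measurable (I : set (measurableTypeR R)) by exact: measurable_itv.
have ck := @continuous_scaled_mollifier a e.
have mk : measurable_fun setT (scaled_mollifier a e) by exact: continuous_measurable_fun.
have mh : measurable_fun setT h by case/integrableP: inth => /measurable_EFinP.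
have inthI : mu.-integrable I (EFin \o h) by exact: integrableS inth.
have intkI : mu.-integrable I (EFin \o scaled_mollifier a e).
  apply: integrableS (continuous_integrable_cc (a - e) (a + e) ck) => //.
  exact: subset_itv_oo_cc.
have inthk : mu.-integrable I (EFin \o (fun x => h x * scaled_mollifier a e x)).
  apply: (integrable_mul_bounded (C := e^-1)) => // x _.
  by have /andP[k0 k1] := scaled_mollifier_bound a x e0; rewrite ger0_norm.
have inthak : mu.-integrable I (EFin \o (fun x => h a * scaled_mollifier a e x)).
  exact: (@integrableZl _ _ _ mu _ mI (h a) _ intkI).
rewrite -(integral_scaled_mollifier a e0) -RintegralZl// -RintegralB//.
rewrite EFin_normr_Rintegral//; last first.
  exact: (integrableB mI inthk inthak).
have mhk : measurable_fun setT
    (fun x => (h x * scaled_mollifier a e x - h a * scaled_mollifier a e x)%:E).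
  by apply/measurable_EFinP; apply: measurable_funB; exact: measurable_funM.
apply: le_trans; first by apply: le_abse_integral => //; exact: measurable_funTS.
have mha : measurable_fun setT (fun x : R => `|h x - h a|%:E).
  by apply/measurable_EFinP; apply: measurableT_comp => //; exact: measurable_funB.
apply: (@le_trans _ _ (\int[mu]_(x in I) (e^-1%:E * `|h x - h a|%:E))%E).
  apply: ge0_le_integral => //.
  - by apply: measurableT_comp => //; exact: measurable_funTS.
  - by apply: emeasurable_funM => //; exact: measurable_funTS.
  - move=> x _; rewrite /= -EFinM lee_fin -mulrBl normrM mulrC.
    have /andP[k0 k1] := scaled_mollifier_bound a x e0.
    by rewrite ler_wpM2r// ger0_norm.
rewrite ge0_integralZl//; last 2 first.
- exact: measurable_funTS.
- by rewrite lee_fin invr_ge0 ltW.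
rewrite /davg /iavg lebesgue_measure_ball ?(ltW e0)// ball_itv -/I.
rewrite inver mulrn_eq0/= gt_eqF// muleA -EFinM.
have -> : 2 * (e *+ 2)^-1 = e^-1.
  by rewrite -[e *+ 2]mulr_natl invfM mulrA divff ?mul1r// pnatr_eq0.
by [].
Qed.

(* The derivative of [plateau a b e] is a difference of approximate identities at
   [a] and [b], so that testing against it compares [h a] with [h b]. *)
Lemma lebesgue_pt_eq (h : R -> R) a b : mu.-integrable setT (EFin \o h) ->
  (forall phi, test_function phi -> \int[mu]_(x in `]0, 1[) (h x * derive1 phi x) = 0) ->
  0 < a -> a <= b -> b < 1 -> lebesgue_pt h a -> lebesgue_pt h b -> h a = h b.
Proof.
move=> inth h0 a0 ab b1 la lb.
have M0 := step1_gt0.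
apply/eqP; rewrite -subr_eq0 -(mulIr_eq0 _ (mulIf (lt0r_neq0 M0))) -normr_le0.
apply/ler_addgt0Pl => e e0; rewrite addr0.
(* Two points, each with the factor 2 of [scaled_mollifier_davg]: averages below e / 4 add up to an
   error of at most e. *)
have e24 : 2 * (e / 4) = e / 2 by lra.
have e4 : (0 < (e / 4)%:E)%E by rewrite lte_fin divr_gt0.
have near_small (x : R) : lebesgue_pt h x ->
    \forall r \near (0 : R)^'+, (davg h x r < (e / 4)%:E)%E.
  move=> /fine_cvgP[fin /cvgrPdist_lt/(_ (e / 4))].
  rewrite -lte_fin => /(_ e4); apply: filterS2 fin => r fin.
  by rewrite sub0r normrN ger0_norm ?fine_ge0 ?davg_ge0// -lte_fin fineK.
near (0 : R)^'+ => r.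
have r0 : 0 < r by [].
have ra : 0 < a - r by rewrite subr_gt0; near: r; exact: nbhs_right_lt.
have rb : b + r < 1.
  by rewrite -ltrBrDl; near: r; apply: nbhs_right_lt; rewrite subr_gt0.
have da : (davg h a r < (e / 4)%:E)%E by near: r; exact: near_small.
have db : (davg h b r < (e / 4)%:E)%E by near: r; exact: near_small.
have := h0 _ (test_function_plateau r0 ab ra rb); rewrite derive1_plateau.
have mh : measurable_fun setT h by case/integrableP: inth => /measurable_EFinP.
have inthk (d : R) : mu.-integrable setT (EFin \o (fun x => h x * scaled_mollifier d r x)).
  apply: (integrable_mul_bounded (C := r^-1)) => //.
    by apply: continuous_measurable_fun; exact: continuous_scaled_mollifier.
  by move=> x _; have /andP[k0 k1] := scaled_mollifier_bound d x r0; rewrite ger0_norm.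
have localize (d : R) : 0 <= d - r -> d + r <= 1 ->
    \int[mu]_(x in `]0, 1[) (h x * scaled_mollifier d r x) =
    \int[mu]_(x in `]d - r, d + r[) (h x * scaled_mollifier d r x).
  move=> d0 d1; rewrite Rintegral_mkcond [RHS]Rintegral_mkcond.
  apply: eq_Rintegral => x _; rewrite !patchE.
  have [xd|xd] := boolP (d - r < x < d + r).
    rewrite !mem_set//= in_itv//=; case/andP: xd => x1 x2.
    by apply/andP; split; [exact: le_lt_trans x1|exact: lt_le_trans d1].
  have -> : h x * scaled_mollifier d r x = 0.
    by rewrite scaled_mollifier_outside ?mulr0//; exact/negP.
  by rewrite !if_same.
under eq_Rintegral do rewrite mulrBr.
rewrite RintegralB//; [|exact: integrableS (inthk a)|exact: integrableS (inthk b)].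
rewrite !localize; [|lra|lra|lra|lra].
move=> /eqP; rewrite subr_eq0 => /eqP eq_int.
have := scaled_mollifier_davg a r0 inth; have := scaled_mollifier_davg b r0 inth.
(* Testing with the plateau has made the two smoothed integrals equal; J is within e / 2 of both
   [h a * step 1] and [h b * step 1]. *)
rewrite -eq_int; set J := (Rintegral _ _ _).
have bound (d : R) : (davg h d r < (e / 4)%:E)%E ->
    (`|J - h d * step 1|%:E <= 2%:E * davg h d r)%E -> `|J - h d * step 1| <= e / 2.
  move=> dd /le_trans H; rewrite -lee_fin; apply: H.
  have -> : ((e / 2)%:E = 2%:E * (e / 4)%:E)%E by rewrite -EFinM e24.
  by apply: lee_wpmul2l; [rewrite lee_fin|exact: ltW].
move=> /(bound _ db) Jb /(bound _ da) Ja.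
have -> : (h a - h b) * step 1 = (J - h b * step 1) - (J - h a * step 1) by ring.
by apply: le_trans (ler_normB _ _) _; rewrite [leRHS](splitr e) lerD.
Unshelve. all: by end_near. Qed.

(** Almost every point is a Lebesgue point, so the value at one of them in (0, 1) serves as the
    constant and the others are compared with it. *)
Lemma weak_constant (h : R -> R) : mu.-integrable setT (EFin \o h) ->
  (forall phi, test_function phi -> \int[mu]_(x in `]0, 1[) (h x * derive1 phi x) = 0) ->
  exists k, {ae mu, forall x, 0 < x < 1 -> h x = k}.
Proof.
move=> inth h0.
have leb : {ae mu, forall x, lebesgue_pt h x}.
  apply: lebesgue_differentiation; apply: open_integrable_locally => //.
  exact: openT.
have [x0 /andP[x00 x01] lx0] := ae_exists (@ltr01 R) leb.
exists (h x0); apply: aeS leb => x lx /andP[x0' x1'].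
have [xx0|/ltW xx0] := leP x x0; first exact: lebesgue_pt_eq lx lx0.
exact/esym/(lebesgue_pt_eq inth h0 _ _ _ lx0 lx).
Qed.

(** The primitive of w has weak derivative w, so u minus this primitive has vanishing weak
    derivative and is a.e. constant. *)
Lemma weak_derivative_prim u w : is_weak_derivative u w -> exists k,
  {ae m01, forall x, u x = k + prim ((w : R -> R) \_ `]0, 1[) x}.
Proof.
move=> uw; pose W := (w : R -> R) \_ `]0, 1[; rewrite -/W.
have intW : mu.-integrable setT (EFin \o W) := L1_01_restrict_integrable w.
have intu := L1_01_restrict_integrable u.
have cP := prim_continuous intW.
have mP : measurable_fun setT (prim W) by exact: continuous_measurable_fun.
have mI : measurable (`]0, 1[%classic : set (measurableTypeR R)) by exact: measurable_itv.
have intP : mu.-integrable setT (EFin \o (prim W \_ `]0, 1[)).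
  rewrite -restrict_EFin -integrable_mkcond//.
  apply: integrableS (continuous_integrable_cc 0 1 cP) => //.
  exact: subset_itv_oo_cc.
pose h x := ((u : R -> R) \_ `]0, 1[) x - (prim W \_ `]0, 1[) x.
have inth : mu.-integrable setT (EFin \o h) := integrableB measurableT intu intP.
have [phi tphi|k hk] := weak_constant inth; last first.
  exists k; apply/ae01; apply: aeS hk => x hk x01; have := hk x01.
  rewrite /h !patchE mem_set; last by rewrite /= in_itv.
  by move=> <-; rewrite subrK.
have W0 x : ~ (0 < x < 1) -> W x = 0.
  by move=> x01; rewrite /W patchE memNset//= in_itv.
have := uw phi tphi; set g := derive1 phi.
have cg : continuous g := test_function_continuous_derive tphi.
have mg : measurable_fun setT g by exact: continuous_measurable_fun.
have mphi : measurable_fun setT phi.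
  by apply: continuous_measurable_fun; exact: test_function_continuous.
have mu_ : measurable_fun setT (u : R -> R) := L1_measurable u.
have mw : measurable_fun setT (w : R -> R) := L1_measurable w.
rewrite Rintegral01; last exact: measurable_funM.
have -> : \int[m01]_x (w x * phi x) = \int[mu]_(x in `]0, 1[) (W x * phi x).
  rewrite Rintegral01; last exact: measurable_funM.
  by apply: eq_Rintegral => x xI; rewrite /W patchE xI.
rewrite -(prim_test_function tphi intW W0) => /eqP; rewrite -subr_eq0 => /eqP eq0.
rewrite -[RHS]eq0.
have [M gM] : exists M : R, forall x, x \in `[0, 1] -> `|g x| <= M.
  have := @segment_compact R 0 1 => /(continuous_compact (continuous_subspaceT cg)).
  move=> /compact_bounded[M [_ bM]]; exists (M + 1) => x xI.
  by apply: (bM (M + 1)); [rewrite ltrDl|exists x].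
rewrite -RintegralB//; last 2 first.
- apply: (integrable_mul_bounded (C := M)) => //.
    by move: intu; rewrite -restrict_EFin -integrable_mkcond.
  by move=> x xI; apply: gM; exact: subset_itv_oo_cc xI.
- have cPg : continuous (fun x => prim W x * g x).
    by move=> x; apply: cvgM; [exact: cP|exact: cg].
  apply: integrableS (continuous_integrable_cc 0 1 cPg) => //.
  exact: subset_itv_oo_cc.
by apply: eq_Rintegral => x xI; rewrite /h !patchE xI mulrBl.
Qed.

(** If f and g differed at x, they would differ on a relative neighbourhood of x, which contains an
    open interval even when x is an endpoint. This gives boundary values a meaning. *)
Lemma continuous_ae_eq (f g : R -> R) (a b : R) : a < b ->
  {within `[a, b], continuous f} -> {within `[a, b], continuous g} ->
  {ae mu, forall x, a < x < b -> f x = g x} ->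
  forall x, x \in `[a, b] -> f x = g x.
Proof.
move=> ab cf cg fg x xab; apply/eqP; rewrite -subr_eq0; apply: contrapT => /negP fgx.
pose h y := f y - g y.
have ch : {within `[a, b], continuous h}.
  by move=> y; apply: cvgB; [exact: cf|exact: cg].
have e0 : 0 < `|h x| by rewrite normr_gt0.
have /subspace_continuousP/(_ x xab)/cvgrPdist_lt/(_ _ e0) := ch.
rewrite near_withinE => /nbhs_ballP[d /= d0 dP].
(* Intersecting with (a, b) leaves a nonempty open interval also for x = a or x = b. *)
pose a' := Num.max a (x - d); pose b' := Num.min b (x + d).
have xab' : a <= x <= b by move: xab; rewrite in_itv.
have ab' : a' < b'.
  rewrite lt_min !gt_max ab /=; case/andP: xab' => ? ?.
  by apply/andP; split; [|apply/andP; split]; lra.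
have [y /andP[y1 y2] fgy] := ae_exists ab' fg.
move: y1 y2; rewrite gt_max lt_min => /andP[ay xdy] /andP[yb ydx].
have yab : y \in `[a, b] by rewrite in_itv/= !ltW.
have yball : ball x d y by rewrite /ball/= ltr_distlC xdy ydx.
have hy : h y = 0 by rewrite /h fgy ?ay ?yb// subrr.
have : `|h x - h y| < `|h x| := dP y yball yab.
by rewrite hy subr0 ltxx.
Qed.

(** [value_at] evaluates a representative obtained by choice. Any two representatives agree on
    [0, 1] by [continuous_ae_eq], so the explicit one can be used. *)
Lemma continuous_rep_prim u w k :
  {ae m01, forall x, u x = k + prim ((w : R -> R) \_ `]0, 1[) x} ->
  forall x, x \in `[0, 1] -> value_at u x = k + prim ((w : R -> R) \_ `]0, 1[) x.
Proof.
move=> uE; pose P x := k + prim ((w : R -> R) \_ `]0, 1[) x.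
have cP : continuous P.
  by move=> x; apply: cvgD; [exact: cvg_cst|exact/prim_continuous/L1_01_restrict_integrable].
have repP : continuous_rep u P.
  split; first exact: continuous_subspaceT.
  by apply: aeS uE => x -> _.
have [cg ug] := xgetPex (fun=> 0) (ex_intro _ P repP).
move=> x x01; rewrite /value_at.
apply: (continuous_ae_eq ltr01 cg (continuous_subspaceT cP)) => //.
have ug' := aeS (fun y (H : _ -> _) => H I) ug.
by apply/ae01; apply: aeS (aeI ug' uE) => y [<- ->].
Qed.

(** Both candidates have primitives that differ from u by constants, hence from each other by a
    constant on (0, 1); differentiating a.e. recovers w1 and w2. *)
Lemma weak_derivative_unique u w1 w2 :
  is_weak_derivative u w1 -> is_weak_derivative u w2 -> w1 = w2.
Proof.
move=> /weak_derivative_prim[k1 e1] /weak_derivative_prim[k2 e2].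
set W1 := _ \_ _ in e1; set W2 := _ \_ _ in e2.
have i1 : mu.-integrable setT (EFin \o W1) := L1_01_restrict_integrable w1.
have i2 : mu.-integrable setT (EFin \o W2) := L1_01_restrict_integrable w2.
have P12 (x : R) : 0 < x < 1 -> k1 + prim W1 x = k2 + prim W2 x.
  move=> /andP[x0 x1].
  apply: (@continuous_ae_eq (fun x => k1 + prim W1 x) (fun x => k2 + prim W2 x) 0 1).
  - exact: ltr01.
  - apply: continuous_subspaceT => y.
    by apply: cvgD; [exact: cvg_cst|exact/prim_continuous].
  - apply: continuous_subspaceT => y.
    by apply: cvgD; [exact: cvg_cst|exact/prim_continuous].
  - by apply/ae01; apply: aeS (aeI e1 e2) => y [<- <-].
  - by rewrite in_itv/= !ltW.
apply: L1_01_ext.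
apply: aeS (aeI (prim_derive_ae i1) (prim_derive_ae i2)) => x [[d1 D1] [d2 D2]] x01.
have W1x : W1 x = w1 x by rewrite /W1 patchE mem_set//= in_itv.
have W2x : W2 x = w2 x by rewrite /W2 patchE mem_set//= in_itv.
rewrite -W1x -W2x -D1 -D2 !derive1E.
have -> : 'D_1 (prim W1) x = 'D_1 (fun y => (k2 - k1) + prim W2 y) x.
  case/andP: x01 => x0 x1; apply: near_eq_derive; near=> y.
  have y01 : 0 < y < 1.
    apply/andP; split; near: y.
      exact: lt_nbhsr.
    exact: lt_nbhsl.
  by have := P12 y y01; lra.
by rewrite (deriveD (derivable_cst _ _ _) d2) derive_cst add0r.
Unshelve. all: by end_near. Qed.

Lemma weak_derivativeE u w : is_weak_derivative u w -> weak_derivative u = w.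
Proof.
move=> uw; apply: (weak_derivative_unique _ uw).
exact: xgetPex (ex_intro _ w uw).
Qed.

End du_Bois_Reymond.

(** * Travel-time coordinates *)

Section image_of_density.
Context {d} {T : measurableType d} {R : realType}.
Variables (nu : {measure set T -> \bar R}) (k : T -> R) (s : T -> measurableTypeR R).
Hypotheses (k_meas : measurable_fun setT k) (k_ge0 : forall x, 0 <= k x).
Hypothesis s_meas : measurable_fun setT s.

(** The image under s of the measure with density k. It is given a measure structure so that
    uniqueness of Lebesgue measure can be applied to it. *)
Definition density_image (A : set (measurableTypeR R)) : \bar R :=
  (\int[nu]_(x in s @^-1` A) (k x)%:E)%E.

Let mpre (A : set (measurableTypeR R)) : measurable A -> measurable (s @^-1` A).
Proof. by move=> mA; rewrite -[X in measurable X]setTI; exact: s_meas. Qed.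

Let image0 : density_image set0 = 0%E.
Proof. by rewrite /density_image preimage_set0 integral_set0. Qed.

Let image_ge0 A : (0 <= density_image A)%E.
Proof. by apply: integral_ge0 => x _; rewrite lee_fin. Qed.

Let image_sigma_additive : semi_sigma_additive density_image.
Proof.
move=> F mF tF mUF; rewrite /density_image preimage_bigcup ge0_integral_bigcup.
- apply: is_cvg_ereal_nneg_natsum_cond => n _ _.
  by apply: integral_ge0 => x _; rewrite lee_fin.
- by move=> n; exact: mpre.
- by apply/measurable_EFinP; exact: measurable_funTS.
- by move=> x _; rewrite lee_fin.
- apply/trivIsetP => i j _ _ ij; rewrite -preimage_setI.
  by move/trivIsetP : tF => ->//; rewrite preimage_set0.
Qed.

HB.instance Definition _ := isMeasure.Build _ _ _
  density_image image0 image_ge0 image_sigma_additive.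

Lemma ge0_integral_change_lebesgue :
  (forall a b : R, a < b ->
     (\int[nu]_(x in s @^-1` `]a, b]) (k x)%:E = (b - a)%:E)%E) ->
  forall f : R -> \bar R, measurable_fun setT f -> (forall x, 0 <= f x)%E ->
  (\int[nu]_x ((k x)%:E * f (s x)) = \int[lebesgue_measure]_x f x)%E.
Proof.
move=> kab f mf f0.
apply: (@ge0_integral_change _ _ _ _ _ lebesgue_measure nu k s) => // A mA.
transitivity (density_image A).
  rewrite /density_image [RHS]integral_mkcond; apply: eq_integral => x _.
  rewrite patchE indicE /=; have -> : (x \in s @^-1` A) = (s x \in A).
    by apply/idP/idP => /set_mem xA; exact/mem_set.
  by case: (_ \in A); rewrite ?mulr1 ?mulr0.
apply/esym/lebesgue_measure_unique => // _ [[a b]] _ <- /=.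
rewrite lebesgue_measure_itv/= lte_fin; have [ab|ba] := ltP a b.
  by rewrite /density_image kab// EFinB.
by rewrite set_itv_ge ?bnd_simp -?leNgt// -/(density_image set0) image0.
Qed.

End image_of_density.

(** * Primitives of functions bounded away from zero *)

Section signed_primitive.
Context {R : realType}.
Notation mu := (@lebesgue_measure R).
Variable k : R -> R.
Hypothesis k_cont : continuous k.

Definition signed_prim (x : R) : R :=
  \int[mu]_(t in `]0, x]) k t - \int[mu]_(t in `]x, 0]) k t.

Lemma continuous_integrable_oc (a b : R) : mu.-integrable `]a, b] (EFin \o k).
Proof.
apply: integrableS (continuous_integrable_cc a b k_cont) => //.
by apply: subset_itvr; rewrite bnd_simp.
Qed.

Lemma Rintegral_oc_split (a x b : R) : a <= x -> x <= b ->
  \int[mu]_(t in `]a, b]) k t =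
  \int[mu]_(t in `]a, x]) k t + \int[mu]_(t in `]x, b]) k t.
Proof.
move=> ax xb; have := Rintegral_itvB (continuous_integrable_oc a b).
by move=> /(_ x); rewrite !bnd_simp => /(_ ax xb) <-; rewrite addrC subrK.
Qed.

Lemma signed_primB (a b : R) : a <= b ->
  signed_prim b - signed_prim a = \int[mu]_(t in `]a, b]) k t.
Proof.
have z (x y : R) : y <= x -> \int[mu]_(t in `]x, y]) k t = 0.
  by move=> yx; rewrite set_itv_ge ?Rintegral_set0// bnd_simp -leNgt.
move=> ab; rewrite /signed_prim.
have [a0|a0] := leP 0 a.
  have b0 := le_trans a0 ab.
  by rewrite (z b 0 b0) (z a 0 a0) !subr0 (Rintegral_oc_split a0 ab) addrC addKr.
have [b0|b0] := leP 0 b.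
  rewrite (z b 0 b0) (z 0 a (ltW a0)) (Rintegral_oc_split (ltW a0) b0).
  by rewrite subr0 sub0r opprK addrC.
rewrite (z 0 b (ltW b0)) (z 0 a (ltW a0)) (Rintegral_oc_split ab (ltW b0)).
by rewrite !sub0r opprK addrC addrK.
Qed.

Lemma signed_prim0 : signed_prim 0 = 0.
Proof. by rewrite /signed_prim subrr. Qed.

Variables (p q : R).
Hypotheses (p_gt0 : 0 < p) (k_bound : forall x, p <= k x <= q).

Lemma signed_prim_bound (a b : R) : a <= b ->
  p * (b - a) <= signed_prim b - signed_prim a <= q * (b - a).
Proof.
move=> ab; rewrite signed_primB//.
have cst_int (e : R) : \int[mu]_(t in `]a, b]) e = e * (b - a).
  rewrite Rintegral_cst//= lebesgue_measure_itv/= lte_fin.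
  move: ab; rewrite le_eqVlt => /predU1P[->|-> //].
  by rewrite ltxx subrr mulr0.
have int_cst (e : R) : mu.-integrable `]a, b] (EFin \o cst e).
  apply: (@measurable_bounded_integrable _ _ _ mu (cst e)) => //.
    exact: lebesgue_measure_oc_fin.
  by exists `|e|; split => // M eM x _; exact: ltW.
have := continuous_integrable_oc a b => intk.
rewrite -!cst_int; apply/andP; split; apply: le_Rintegral => //.
- exact: int_cst.
- by move=> x _; have /andP[] := k_bound x.
- exact: int_cst.
- by move=> x _; have /andP[] := k_bound x.
Qed.

Lemma signed_prim_lt (a b : R) : (signed_prim a < signed_prim b) = (a < b).
Proof.
have incr (x y : R) : x < y -> signed_prim x < signed_prim y.
  move=> xy; rewrite -subr_gt0; have /andP[+ _] := signed_prim_bound (ltW xy).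
  by apply: lt_le_trans; rewrite mulr_gt0// subr_gt0.
have [ab|ba|->] := ltgtP a b; first exact: incr.
  by apply/negbTE; rewrite -leNgt ltW// incr.
by rewrite ltxx.
Qed.

Let q_gt0 : 0 < q.
Proof. by apply: lt_le_trans p_gt0 _; have /andP[] := k_bound 0; exact: le_trans. Qed.

Lemma signed_prim_dist (a b : R) :
  p * `|b - a| <= `|signed_prim b - signed_prim a| <= q * `|b - a|.
Proof.
wlog ab : a b / a <= b.
  by move=> h; have [/h//|/ltW/h] := leP a b; 
    rewrite [`|b - a|]distrC [`|signed_prim b - _|]distrC.
have /andP[h1 h2] := signed_prim_bound ab.
have ba : 0 <= b - a by rewrite subr_ge0.
rewrite (ger0_norm ba) ger0_norm ?h1//.
by apply: le_trans h1; rewrite mulr_ge0// ltW.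
Qed.

Lemma signed_prim_continuous : continuous signed_prim.
Proof.
move=> x; apply/cvgrPdist_le => e e0; near=> y.
have /andP[_ h] := signed_prim_dist y x; apply: le_trans h _.
rewrite mulrC -ler_pdivlMr//; near: y.
have : 0 < e / q by rewrite divr_gt0.
by move=> /(@cvgr_dist_le _ _ _ _ _ _ _ (@cvg_id _ (nbhs x))).
Unshelve. all: by end_near. Qed.

Lemma signed_prim_surj (y : R) : exists x, signed_prim x = y.
Proof.
(* As the slope is at least p, at b the primitive exceeds |y| and at -b it lies below -|y|; the
   intermediate value theorem applies between them. *)
pose b := (`|y| + 1) / p.
have b0 : 0 < b by rewrite divr_gt0// ltr_wpDl.
have h1 : y <= signed_prim b.
  have /andP[+ _] := signed_prim_bound (ltW b0).
  rewrite signed_prim0 !subr0 /b mulrC divfK ?gt_eqF//; apply: le_trans.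
  by rewrite (le_trans (ler_norm y))// lerDl.
have b0' : - b <= 0 by rewrite oppr_le0 ltW.
have h2 : signed_prim (- b) <= y.
  have /andP[+ _] := signed_prim_bound b0'.
  rewrite signed_prim0 !sub0r opprK /b mulrC divfK ?gt_eqF//.
  rewrite lerNr => /le_trans; apply; have := ler_norm (- y); rewrite normrN => ?.
  by lra.
have bb : - b <= b by apply: le_trans b0' (ltW b0).
have [||x _ <-] := @IVT R signed_prim (- b) b y bb.
- exact/continuous_subspaceT/signed_prim_continuous.
- by rewrite ge_min le_max h2 h1 orbT.
by exists x.
Qed.

End signed_primitive.

(** * Construction of the travel-time charts *)

Section travel_time.
Context {R : realType}.
Notation mu := (@lebesgue_measure R).

(* [s x] is the time a particle of speed [c] needs to travel from the inflow end
   of (0, 1) to [x]; the inflow end is 0 if [fwd] and 1 otherwise. *)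
Record travel_chart (c : R -> R) (fwd : bool) (k s xi : R -> R) (tau p q : R) :
    Prop := TravelChart {
  chart_slowness : forall x, 0 < x < 1 -> k x = (c x)^-1;
  chart_k_meas : measurable_fun setT k;
  chart_p_gt0 : 0 < p;
  chart_k_bound : forall x, p <= k x <= q;
  chart_sK : cancel s xi;
  chart_xiK : cancel xi s;
  chart_s_meas : measurable_fun setT s;
  chart_xi_meas : measurable_fun setT xi;
  chart_tau_gt0 : 0 < tau;
  chart_s_lt : forall x y, (s x < s y) = if fwd then x < y else y < x;
  chart_s0 : s 0 = if fwd then 0 else tau;
  chart_s1 : s 1 = if fwd then tau else 0;
  chart_change : forall f : R -> \bar R, measurable_fun setT f ->
    (forall x, 0 <= f x)%E ->
    (\int[mu]_x ((k x)%:E * f (s x)) = \int[mu]_x f x)%E }.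

(** Composing c with it extends c by its end values to a continuous positive function on the line
    with the same extrema, so that travel time becomes a bijection of the whole line. *)
Definition clamp (x : R) : R := Num.max 0 (Num.min 1 x).

Lemma clamp_in x : clamp x \in `[0, 1].
Proof.
by rewrite in_itv/= /clamp le_max lexx/= ge_max ler01 ge_min lexx.
Qed.

Lemma clamp_id x : 0 <= x <= 1 -> clamp x = x.
Proof. by move=> /andP[x0 x1]; rewrite /clamp (min_idPr x1) (max_idPr x0). Qed.

Lemma continuous_clamp : continuous clamp.
Proof.
move=> x; apply: continuous_max; first exact: cvg_cst.
by apply: continuous_min; [exact: cvg_cst|exact: cvg_id].
Qed.

Lemma continuous_comp_clamp (c : R -> R) : {within `[0, 1], continuous c} ->
  continuous (fun x => c (clamp x)).
Proof.
move=> /subspace_continuousP cc x.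
have /cvgrPdist_le cx := cc _ (clamp_in x).
apply/cvgrPdist_le => e /cx; rewrite near_withinE => nearc.
have H := @continuous_clamp x _ nearc.
apply: (@filterS _ (nbhs x) _ _ _ _ H) => y /=; apply.
exact: clamp_in.
Qed.

Lemma forward_chart (c : R -> R) : {within `[0, 1], continuous c} ->
  (forall x, x \in `[0, 1] -> 0 < c x) ->
  exists k s xi tau p q, travel_chart c true k s xi tau p q.
Proof.
move=> cc c0.
(* The bounds of the slowness: p is the inverse of the maximum of c and q the inverse of its
   minimum. *)
have [a a01 amax] := EVT_max (@ler01 R) cc.
have [b b01 bmin] := EVT_min (@ler01 R) cc.
pose k x := (c (clamp x))^-1.
have k0 x : 0 < k x by rewrite invr_gt0; exact/c0/clamp_in.
have ck : continuous k.
  move=> x; apply: cvgV; first by rewrite gt_eqF//; exact/c0/clamp_in.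
  exact: continuous_comp_clamp.
have p0 : 0 < (c a)^-1 by rewrite invr_gt0; exact: c0.
have kb x : (c a)^-1 <= k x <= (c b)^-1.
  have cx := clamp_in x.
  by rewrite !lef_pV2 ?posrE ?c0//; apply/andP; split; [exact: amax|exact: bmin].
pose s := signed_prim k.
have s_lt x y : (s x < s y) = (x < y) := signed_prim_lt ck p0 kb x y.
have /choice[xi xiK] : forall y, exists x, s x = y.
  by move=> y; exact: (signed_prim_surj ck p0 kb y).
have sK : cancel s xi.
  move=> x; have [xx|xx|//] := ltgtP (xi (s x)) x.
    by move: (xx); rewrite -(s_lt (xi (s x)) x) xiK ltxx.
  by move: (xx); rewrite -(s_lt x (xi (s x))) xiK ltxx.
have cs : continuous s by exact: (@signed_prim_continuous _ _ ck _ _ p0 kb).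
have cxi : continuous xi.
  move=> y; apply/cvgrPdist_le => e e0; near=> z.
  have /andP[h _] := signed_prim_dist ck p0 kb (xi z) (xi y).
  rewrite -/s !xiK in h.
  rewrite -(ler_pM2l p0); apply: le_trans h _; near: z.
  have : 0 < (c a)^-1 * e by rewrite mulr_gt0.
  by move=> /(@cvgr_dist_le _ _ _ _ _ _ _ (@cvg_id _ (nbhs y))).
have s0 : s 0 = 0 by exact: signed_prim0.
have ms : measurable_fun setT s by exact: continuous_measurable_fun.
have mk : measurable_fun setT k by exact: continuous_measurable_fun.
exists k, s, xi, (s 1), (c a)^-1, (c b)^-1; split => //.
- by move=> x /andP[x0 x1]; rewrite /k clamp_id// !ltW.
- exact: continuous_measurable_fun.
- by rewrite -s0 s_lt.
(* The change of variables is checked on intervals: the preimage of ]y, z] is ]xi y, xi z], and the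
   integral of k there is s (xi z) - s (xi y) = z - y. *)
- apply: (@ge0_integral_change_lebesgue _ _ _ mu k s) => // [x|y z yz]; first exact: ltW.
  have -> : s @^-1` `]y, z] = `]xi y, xi z]%classic.
    apply/funext => x; rewrite /preimage /= !in_itv/= -{1}(xiK y) -{1}(xiK z) s_lt.
    by rewrite !leNgt s_lt.
  have xiyz : xi y <= xi z by rewrite leNgt -s_lt !xiK -leNgt ltW.
  have := signed_primB ck xiyz; rewrite -/s !xiK /Rintegral => e.
  rewrite e fineK//; apply: integrable_fin_num => //.
  exact: continuous_integrable_oc.
Unshelve. all: by end_near. Qed.

(** The backward chart is the forward one reflected, tau - s; the integral identity survives because
    Lebesgue measure is invariant under y |-> tau - y. *)
Lemma travel_chart_exists (c : R -> R) (fwd : bool) :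
  {within `[0, 1], continuous c} -> (forall x, x \in `[0, 1] -> 0 < c x) ->
  exists k s xi tau p q, travel_chart c fwd k s xi tau p q.
Proof.
move=> cc c0; have [k [s [xi [tau [p [q ch]]]]]] := forward_chart cc c0.
case: fwd; first by exists k, s, xi, tau, p, q.
case: ch => k1 mk p0 kb sK xiK ms mxi tau0 s_lt s0 s1 change.
have mr : measurable_fun setT (fun y : R => tau - y) by exact: measurable_funB.
exists k, (fun x => tau - s x), (fun y => xi (tau - y)), tau, p, q; split => //.
- by move=> x /=; rewrite opprB addrC subrK sK.
- by move=> y /=; rewrite xiK opprB addrC subrK.
- exact: measurable_funB.
- exact: (measurableT_comp mxi mr).
- by move=> x y; rewrite ltrD2l ltrN2 s_lt.
- by rewrite s0 subr0.
- by rewrite s1 subrr.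
- move=> f mf f0; rewrite -(ge0_integral_reflect tau mf f0).
  by rewrite -(change (fun y => f (tau - y)))//; exact: (measurableT_comp mf mr).
Qed.

End travel_time.

(** * Passing between (0, 1) and the travel-time line *)

Section chart_operators.
Context {R : realType}.
Notation mu := (@lebesgue_measure R).
Notation m01 := (@lebesgue01 R).

Lemma wbounded_mult {d} {T : measurableType d} (nu : {measure set T -> \bar R})
    (C : R) (m : T -> R) : measurable_fun setT m -> (forall x, `|m x| <= C) ->
  wbounded nu nu C m id.
Proof.
move=> mm mC.
have C0 : 0 <= C by apply: le_trans (mC point).
split => // f mf f0; rewrite -ge0_integralZl//; apply: ge0_le_integral => //.
- by move=> x _; exact: mule_ge0.
- by apply: emeasurable_funM => //; apply/measurable_EFinP/measurableT_comp.
- by apply: emeasurable_funM => //; exact: measurable_cst.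
- by move=> x _; apply: lee_wpmul2r => //; rewrite lee_fin.
Qed.

Variables (c : R -> R) (fwd : bool) (k s xi : R -> R) (tau p q : R).
Hypothesis ch : travel_chart c fwd k s xi tau p q.

Definition time_lift (u : L1_01 R) : L1 mu :=
  @wcomp _ _ _ _ R m01 mu (\1_`]0, tau[) xi u.
Definition time_pull (g : L1 mu) : L1_01 R := @wcomp _ _ _ _ R mu m01 (cst 1) s g.

Lemma chart_in x : (0 < s x < tau) = (0 < x < 1).
Proof.
have := chart_s_lt ch; have := chart_s0 ch; have := chart_s1 ch.
case: fwd => s1 s0 s_lt; first by rewrite -{1}s0 -{1}s1 !s_lt.
by rewrite -{1}s1 -{1}s0 !s_lt andbC.
Qed.

Let mI : measurable (`]0, tau[%classic : set (measurableTypeR R)).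
Proof. exact: measurable_itv. Qed.

Let m1 : measurable (`]0, 1[%classic : set (measurableTypeR R)).
Proof. exact: measurable_itv. Qed.

Let indE (a y : R) : \1_(`]0, a[) y = if 0 < y < a then 1 else 0 :> R.
Proof.
rewrite indicE; case: ifPn => h; first by rewrite mem_set//= in_itv.
by rewrite memNset//= in_itv/=; exact/negP.
Qed.

Lemma chart_k_gt0 x : 0 < k x.
Proof. by have /andP[/(lt_le_trans (chart_p_gt0 ch))] := chart_k_bound ch x. Qed.

(** In the chart dy = k dx, and k <= q gives the constant; [pull_wbounded] uses k >= p in the same
    way. *)
Lemma lift_wbounded : wbounded m01 mu q (\1_`]0, tau[) xi.
Proof.
have q0 : 0 <= q.
  by have /andP[/le_trans h /h] := chart_k_bound ch 0; apply: le_trans; rewrite ltW ?(chart_p_gt0 ch).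
have mind : measurable_fun setT (\1_(`]0, tau[) : R -> R) by exact: measurable_indic.
split => //; first exact: chart_xi_meas ch.
move=> f mf f0.
have mg : measurable_fun setT (fun y : R => (`|\1_(`]0, tau[) y|%:E * f (xi y))%E).
  apply: emeasurable_funM; first by apply/measurable_EFinP/measurableT_comp.
  exact: (measurableT_comp mf (chart_xi_meas ch)).
rewrite -(chart_change ch mg); last by move=> y; rewrite mule_ge0// lee_fin.
have mk := chart_k_meas ch.
rewrite -ge0_integralZl//.
rewrite ge0_integral01; last 2 first.
- by apply: emeasurable_funM => //; exact: measurable_cst.
- by move=> x; rewrite mule_ge0.
rewrite [leRHS]integral_mkcond; apply: ge0_le_integral => //.
- by move=> x _; rewrite mule_ge0 ?mule_ge0// lee_fin// ltW// chart_k_gt0.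
- apply: emeasurable_funM; first exact/measurable_EFinP.
  exact: (measurableT_comp mg (chart_s_meas ch)).
- apply: measurable_fun_patch => //.
  by apply: emeasurable_funM => //; exact: measurable_cst.
move=> x _; rewrite patchE indE chart_in (chart_sK ch).
case: ifPn => x01; last by rewrite normr0 mul0e mule0; case: ifP => // _; rewrite mule_ge0.
rewrite mem_set//=; rewrite normr1 mul1e; apply: lee_wpmul2r => //.
by rewrite lee_fin; have /andP[] := chart_k_bound ch x.
Qed.

Lemma pull_wbounded : wbounded mu m01 p^-1 (cst 1) s.
Proof.
have p0 := chart_p_gt0 ch; have ms := chart_s_meas ch.
split => //; first by rewrite invr_ge0 ltW.
move=> f mf f0.
have mfs : measurable_fun setT (fun x => f (s x)) by exact: measurableT_comp.
have mkf : measurable_fun setT (fun x => ((k x)%:E * f (s x))%E).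
  by apply: emeasurable_funM => //; apply/measurable_EFinP; exact: (chart_k_meas ch).
have kf0 x : (0 <= (k x)%:E * f (s x))%E by rewrite mule_ge0// lee_fin ltW// chart_k_gt0.
rewrite -(chart_change ch mf f0) -ge0_integralZl//; last first.
- by rewrite lee_fin invr_ge0 ltW.
under eq_integral do rewrite normr1 mul1e.
rewrite ge0_integral01// [leLHS]integral_mkcond; apply: ge0_le_integral => //.
- by move=> x _; rewrite patchE; case: ifP.
- exact: measurable_fun_patch.
- by apply: emeasurable_funM => //; exact: measurable_cst.
move=> x _; have pk : (1 <= p^-1%:E * (k x)%:E)%E.
  by rewrite -EFinM lee_fin mulrC ler_pdivlMr// mul1r; have /andP[] := chart_k_bound ch x.
rewrite muleA; apply: (@le_trans _ _ (f (s x))).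
  by rewrite patchE; case: ifP.
by rewrite -{1}(mul1e (f (s x))); exact: lee_wpmul2r.
Qed.

Lemma time_lift_linear : linear time_lift.
Proof. exact: wcomp_linear lift_wbounded. Qed.

Lemma time_lift_norm u : `|time_lift u| <= q * `|u|.
Proof. exact: (wcomp_norm u lift_wbounded). Qed.

Lemma time_pull_linear : linear time_pull.
Proof. exact: wcomp_linear pull_wbounded. Qed.

Lemma time_pull_norm g : `|time_pull g| <= p^-1 * `|g|.
Proof. exact: (wcomp_norm g pull_wbounded). Qed.

Lemma liftE u : {ae mu, forall y, time_lift u y = if 0 < y < tau then u (xi y) else 0}.
Proof.
apply: aeS (wcompE u lift_wbounded) => y ->.
by rewrite indE; case: ifP => _; rewrite ?mul1r ?mul0r.
Qed.

Lemma pullE g : {ae m01, forall x, time_pull g x = g (s x)}.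
Proof. by apply: aeS (wcompE g pull_wbounded) => y e; apply: (etrans e); rewrite mul1r. Qed.

Lemma ae_pull (P : R -> Prop) : {ae mu, forall y, 0 < y < tau -> P y} <->
  {ae m01, forall x, P (s x)}.
Proof.
split=> [/(wbounded_ae pull_wbounded) h|/(wbounded_ae lift_wbounded)].
  apply/ae01; move/ae01: h; apply: aeS => x /[swap] x01 /(_ x01).
  by rewrite chart_in; apply => //=; exact: oner_neq0.
apply: aeS => y + y01; rewrite (chart_xiK ch) indE y01; apply; exact: oner_neq0.
Qed.

Lemma lift_at u : {ae m01, forall x, time_lift u (s x) = u x}.
Proof.
have /ae_pull : {ae mu, forall y, 0 < y < tau -> time_lift u y = u (xi y)}.
  by apply: aeS (liftE u) => y -> ->.
by apply: aeS => x ->; rewrite (chart_sK ch).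
Qed.

(** The working principle for identities in [L1_01]: they are checked on lifts, a.e. in (0, tau),
    where translation is explicit. *)
Lemma pull_eqP g u : time_pull g = u <-> {ae mu, forall y, 0 < y < tau -> g y = time_lift u y}.
Proof.
split=> [<-|].
  apply/ae_pull; apply: aeS (aeI (lift_at (time_pull g)) (pullE g)) => x [-> ->//].
move=> /ae_pull h; apply: L1_ext.
by apply: aeS (aeI h (aeI (lift_at u) (pullE g))) => x [e [e1 e2] _]; exact: etrans e2 (etrans e e1).
Qed.

Lemma pull_lift u : time_pull (time_lift u) = u.
Proof. by apply/pull_eqP; apply: aeS (liftE u). Qed.

Lemma lift_pull g : {ae mu, forall y, 0 < y < tau -> time_lift (time_pull g) y = g y}.
Proof. by have /pull_eqP := erefl (time_pull g); apply: aeS => y /[apply]. Qed.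

(** Pulling back does not see g outside (0, tau), so g may be masked first. Unlike [time_pull_norm],
    this allows estimates on signals that carry history at negative times. *)
Lemma pull_norm_le g :
  (`|time_pull g|%:E <= p^-1%:E * \int[mu]_(y in `]0%R, tau[) `|g y|%:E)%E.
Proof.
have bm := wbounded_mask mu mI.
pose g' := wcomp mu (\1_`]0, tau[) id g.
have g'E := wcompE g bm.
have -> : time_pull g = time_pull g'.
  apply/pull_eqP; apply: aeS (aeI (lift_pull g') g'E) => y [h e] y01.
  by rewrite h// e indE y01 mul1r.
apply: le_trans (_ : (p^-1 * `|g'|)%:E <= _)%E.
  by rewrite lee_fin; exact: (wcomp_norm g' pull_wbounded).
rewrite EFinM; apply: lee_wpmul2l; first by rewrite lee_fin invr_ge0 ltW// (chart_p_gt0 ch).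
have mg := L1_measurable g.
rewrite L1_normE' [leRHS]integral_mkcond le_eqVlt; apply/orP; left; apply/eqP.
apply: ge0_ae_eq_integral => //.
- by apply/measurable_EFinP/measurableT_comp => //; exact: L1_measurable.
- by apply: measurable_fun_patch => //; apply/measurable_EFinP/measurableT_comp.
- by move=> y _; rewrite patchE; case: ifP.
- apply: aeS g'E => y e _; rewrite e indicE patchE.
  by case: ifP => _; rewrite ?mul1r// mul0r normr0.
Qed.

End chart_operators.

(** * One component of the operator in travel-time coordinates *)

Section boundary_flux.
Context {R : realType}.
Notation mu := (@lebesgue_measure R).
Notation m01 := (@lebesgue01 R).

Lemma ae_neq (x : R) : {ae mu, forall z, z != x}.
Proof.
exists [set x]; split => //; first exact: lebesgue_measure_set1.
by move=> z /= /negP; rewrite negbK => /eqP.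
Qed.

Variables (c : R -> R) (fwd : bool) (k s xi : R -> R) (tau p q : R).
Hypothesis ch : travel_chart c fwd k s xi tau p q.
Notation liftu := (time_lift xi tau).

(** In the chart the operator is minus the derivative in y, and the inflow end is y = 0; integrating
    from there encodes both that u is sent to v and that its inflow value is g. *)
Definition flux (u v : L1_01 R) (g : R) : Prop :=
  {ae mu, forall y, 0 < y < tau -> liftu u y = g - prim (liftu v) y}.

Let sgn : R := if fwd then -1 else 1.
(** The weak derivative in x that u must have if the operator sends it to v; [speed] is the inverse
    map, from the weak derivative to v. *)
Let slope (v : L1_01 R) : L1_01 R :=
  @wcomp _ _ _ _ R m01 m01 (fun x => sgn * k x) id v.
(** The mask reproduces the cut-off to (0, 1) inside [L1_01_class], so that [transport_componentE]
    is an equality of functions before passing to classes; k is the inverse of c only there. *)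
Let speed (w : L1_01 R) : L1_01 R :=
  @wcomp _ _ _ _ R m01 m01 (fun x => \1_`]0, 1[ x * (sgn * (k x)^-1)) id w.
Let W v : R -> R := (slope v : R -> R) \_ `]0, 1[.

Let sgn1 : `|sgn| = 1. Proof. by rewrite /sgn; case: fwd; rewrite ?normrN normr1. Qed.
Let sgn2 : sgn * sgn = 1. Proof. by rewrite /sgn; case: fwd; rewrite ?mulrNN mulr1. Qed.

Let m1 : measurable (`]0, 1[%classic : set (measurableTypeR R)).
Proof. exact: measurable_itv. Qed.

Let patch01 (f : R -> R) x : (f \_ `]0, 1[) x = if 0 < x < 1 then f x else 0.
Proof.
rewrite patchE; case: ifPn => [/set_mem/=|/negP h]; first by rewrite in_itv/= => ->.
by case: ifPn => // x01; exfalso; apply: h; apply/mem_set; rewrite /= in_itv.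
Qed.

Let slopeE v : {ae m01, forall x, slope v x = sgn * k x * v x}.
Proof.
apply: (@wcompE _ _ _ _ _ _ _ q); apply: wbounded_mult.
  by apply: measurable_funM => //; exact: chart_k_meas ch.
move=> x; rewrite normrM sgn1 mul1r gtr0_norm ?(chart_k_gt0 ch)//.
by have /andP[] := chart_k_bound ch x.
Qed.

(** Inversion is continuous only away from 0, but k equals its maximum with p, and y |-> 1 / max(p,
    y) is continuous on the line. *)
Let measurable_kV : measurable_fun setT (fun x => (k x)^-1).
Proof.
have p0 := chart_p_gt0 ch.
have -> : (fun x => (k x)^-1) = (fun y => (Num.max p y)^-1) \o k.
  by apply/funext => x /=; have /andP[/max_idPr ->] := chart_k_bound ch x.
apply: measurableT_comp (chart_k_meas ch); apply: continuous_measurable_fun => y.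
apply: cvgV; first by rewrite gt_eqF// lt_max p0.
by apply: continuous_max; [exact: cvg_cst|exact: cvg_id].
Qed.

Let speedE w :
  {ae m01, forall x, speed w x = \1_`]0, 1[ x * (sgn * (k x)^-1) * w x}.
Proof.
apply: (@wcompE _ _ _ _ _ _ _ p^-1); apply: wbounded_mult.
  apply: measurable_funM; first exact: measurable_indic.
  exact: measurable_funM.
have p0 := chart_p_gt0 ch.
move=> x; rewrite !normrM sgn1 mul1r (@gtr0_norm _ (k x)^-1) ?invr_gt0 ?(chart_k_gt0 ch)//.
apply: (@le_trans _ _ (k x)^-1).
  apply: ler_piMl; first by rewrite invr_ge0 ltW// (chart_k_gt0 ch).
  by rewrite indicE; case: (_ \in _); rewrite ?normr1 ?normr0.
by rewrite lef_pV2 ?posrE ?(chart_k_gt0 ch)//; have /andP[] := chart_k_bound ch x.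
Qed.

Let ind01 (x : R) : 0 < x < 1 -> \1_`]0, 1[ x = (1 : R).
Proof. by move=> x01; rewrite indicE mem_set//= in_itv. Qed.

Let speedK : cancel slope speed.
Proof.
move=> v; apply: L1_01_ext; move/ae01: (slopeE v); move/ae01: (speedE (slope v)).
move=> h1 h2; apply: aeS (aeI h1 h2) => x [h h'] x01.
have k0 := chart_k_gt0 ch x.
rewrite h// ind01// h'// mul1r -mulrA (mulrA _ sgn) (mulrC _ sgn) !mulrA sgn2 mul1r.
by rewrite mulVf ?gt_eqF// mul1r.
Qed.

Let slopeK : cancel speed slope.
Proof.
move=> v; apply: L1_01_ext; move/ae01: (speedE v); move/ae01: (slopeE (speed v)).
move=> h1 h2; apply: aeS (aeI h1 h2) => x [h h'] x01.
have k0 := chart_k_gt0 ch x.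
rewrite h// h'// ind01// mul1r mulrA (mulrC (sgn * k x)) -(mulrA sgn) (mulrCA sgn).
by rewrite (mulrA sgn) sgn2 mulrA !mulr1 mulVf ?gt_eqF// mul1r.
Qed.

Lemma transport_componentE (w : L1_01 R) :
  L1_01_class (fun x => if fwd then - c x * w x else c x * w x) = speed w.
Proof.
congr L1_class; apply/funext => x; rewrite patch01.
case: ifPn => x01; last by rewrite indicE memNset ?mul0r//= in_itv/=; exact/negP.
rewrite ind01// mul1r (chart_slowness ch x01) invrK /sgn.
by case: fwd; rewrite ?mulN1r ?mul1r.
Qed.

Let intW v : mu.-integrable setT (EFin \o W v).
Proof. exact: L1_01_restrict_integrable. Qed.

Let lift_s v : {ae mu, forall x, liftu v (s x) = if 0 < x < 1 then v x else 0}.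
Proof.
have b : wbounded mu mu 1 k s.
  split => //; [exact: chart_k_meas ch|exact: chart_s_meas ch|].
  move=> g mg g0; rewrite mul1e -(chart_change ch mg g0).
  by under eq_integral => x _ do rewrite gtr0_norm ?(chart_k_gt0 ch)//.
apply: aeS (wbounded_ae b (liftE ch v)) => x; rewrite gt_eqF ?(chart_k_gt0 ch)//.
by move=> ->//; rewrite (chart_in ch) (chart_sK ch).
Qed.

Let kappa v : R := prim (W v) (if fwd then 0 else 1).

(** Substituting y = s z turns the integral up to s x into one over z <= x (forward) or z >= x
    (backward). The constant [kappa] is the primitive of the slope at the inflow end: 0 forward, the
    full integral backward. *)
Let prim_lift v x : 0 <= x <= 1 -> prim (liftu v) (s x) = kappa v - prim (W v) x.
Proof.
move=> /andP[x0 x1]; rewrite /kappa.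
have k0 := chart_k_gt0 ch.
have intv := L1_integrable (liftu v).
have intf : mu.-integrable setT (EFin \o ((liftu v : R -> R) \_ `]-oo, s x])).
  by rewrite -restrict_EFin -integrable_mkcond//; exact: integrableS intv.
have [int2] := @Rintegral_change _ _ _ _ R mu mu k s _ (chart_k_meas ch)
  (chart_s_meas ch) (fun x => ltW (k0 x)) (chart_change ch) intf.
move=> e; have {e} -> : prim (liftu v) (s x) =
    \int[mu]_z (k z * ((liftu v : R -> R) \_ `]-oo, s x]) (s z)).
  by rewrite e /prim Rintegral_mkcond.
have /integrableP[/measurable_EFinP m2 _] := int2.
have mW (I : interval R) : measurable_fun setT (W v \_ [set` I]).
  have : mu.-integrable setT (EFin \o (W v \_ [set` I])).
    rewrite -restrict_EFin -integrable_mkcond//; exact: integrableS (intW v).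
  by case/integrableP => /measurable_EFinP.
have Wk : {ae mu, forall z, k z * liftu v (s z) = sgn * W v z}.
  move/ae01: (slopeE v) => h; apply: aeS (aeI h (lift_s v)) => z [e ->].
  rewrite /W patch01; case: ifPn => z01; last by rewrite !mulr0.
  by rewrite e// !mulrA sgn2 mul1r.
have inE0 (I : interval R) (f : R -> R) z : (f \_ [set` I]) z = if z \in I then f z else 0.
  by rewrite patchE; congr (if _ then _ else _); apply/idP/idP => [/set_mem|h]//; exact/mem_set.
have := chart_s_lt ch; move: Wk; rewrite /sgn; case: (fwd) => Wk s_lt.
  rewrite (_ : prim (W v) 0 = 0) ?sub0r; last first.
    rewrite /prim; apply: (@etrans _ _ (\int[mu]_(t in `]-oo, 0]) 0)).
      apply: eq_Rintegral => z /set_mem/=; rewrite in_itv/= => z0.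
      by rewrite /W patch01; case: ifPn => // /andP[/lt_geF]; rewrite z0.
    by rewrite Rintegral_cst//= mul0r.
  rewrite /prim -[RHS]mulN1r [in RHS]Rintegral_mkcond -RintegralZl//; last first.
    rewrite -restrict_EFin -integrable_mkcond//; exact: integrableS (intW v).
  apply: Rintegral_ae => //; first by apply: measurable_funM => //; exact: (mW `]-oo, x]).
  apply: aeS Wk => z e _; rewrite !inE0 !in_itv/= !leNgt s_lt.
  by case: ifP => _; rewrite ?mulr0.
rewrite primB// [RHS]Rintegral_mkcond.
apply: Rintegral_ae => //; first exact: (mW `]x, 1]).
(* Backward, ]-oo, s x] pulls back to z >= x while the right side integrates over ]x, 1]; they
   differ by the null set {x} and by points where W vanishes. *)
apply: aeS (aeI Wk (ae_neq x)) => z [e zx] _; rewrite !inE0 !in_itv/= leNgt s_lt.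
have -> : ~~ (z < x) = (x < z) by case: ltgtP zx => // ->; rewrite eqxx.
case: ifP => xz /=; last by rewrite mulr0.
rewrite e mul1r; case: leP => // z1.
by rewrite /W patch01; case: ifPn => // /andP[_ /lt_gtF]; rewrite z1.
Qed.

(** Read in the variable x, [flux] is the constant-plus-primitive form that characterises weak
    derivatives. The shift by [kappa] makes g the value at the inflow end. *)
Let fluxE u v g : flux u v g <->
  {ae m01, forall x, u x = (g - kappa v) + prim (W v) x}.
Proof.
apply: (iff_trans (ae_pull ch (fun y => liftu u y = g - prim (liftu v) y))).
have eqv : {ae m01, forall x, (liftu u (s x) = g - prim (liftu v) (s x)) =
    (u x = g - kappa v + prim (W v) x)}.
  move/ae01: (lift_at ch u) => h; apply/ae01; apply: aeS h => x + x01 => -> //.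
  by rewrite prim_lift ?opprB 1?addrCA 1?addrC 1?addrAC//; case/andP: x01 => /ltW -> /ltW ->.
by split=> h; apply: aeS (aeI h eqv) => x [+ e]; rewrite e.
Qed.

Lemma fluxP u v g : flux u v g <->
  [/\ W11 u,
    L1_01_class (fun x => if fwd then - c x * weak_derivative u x
                         else c x * weak_derivative u x) = v &
    value_at u (if fwd then 0 else 1) = g].
Proof.
rewrite transport_componentE; split => [/fluxE h|[[w uw]]].
  have uw := prim_weak_derivative h.
  split; [by exists (slope v)|by rewrite (weak_derivativeE uw) speedK|].
  rewrite (continuous_rep_prim h); last by case: fwd; rewrite in_itv/= lexx ler01.
  by rewrite subrK.
rewrite (weak_derivativeE uw) => wv <-.
have wE : w = slope v by rewrite -wv slopeK.
have [g' h] := weak_derivative_prim uw; rewrite wE in h.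
have {}h : {ae m01, forall x, u x = ((g' + kappa v) - kappa v) + prim (W v) x}.
  by rewrite addrK.
rewrite (continuous_rep_prim h); last by case: fwd; rewrite in_itv/= lexx ler01.
by rewrite subrK; apply/fluxE.
Qed.

Lemma flux_outflow u v g : flux u v g ->
  value_at u (if fwd then 1 else 0) = g - prim (liftu v) tau.
Proof.
move=> /fluxE h; rewrite (continuous_rep_prim h); last by case: fwd; rewrite in_itv/= lexx ler01.
have -> : prim (liftu v) tau = prim (liftu v) (s (if fwd then 1 else 0)).
  congr (prim _ _); by have := chart_s0 ch; have := chart_s1 ch; case: fwd.
rewrite prim_lift; last by case: fwd; rewrite lexx ler01.
by rewrite opprB addrA addrAC -addrA.
Qed.

End boundary_flux.

(** * The transport flow and its generator *)

Section normed_facts.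
Context {R : realType}.

Lemma linear_bounded_cvg {V W : normedModType R} (f : V -> W) (C : R) :
  linear f -> (forall u, `|f u| <= C * `|u|) -> continuous f.
Proof.
move=> flin fC u; apply/cvgrPdist_lt => e e0.
(* C may be zero or negative; D can be divided by. *)
pose D := Num.max C 1.
have D0 : 0 < D by rewrite lt_max ltr01 orbT.
near=> v.
have -> : f u - f v = f (u - v).
  by rewrite [u - v]addrC -(scaleN1r v) flin scaleN1r addrC.
apply: le_lt_trans (fC _) _; apply: (@le_lt_trans _ _ (D * `|u - v|)).
  by apply: ler_wpM2r => //; rewrite le_max lexx.
rewrite mulrC -ltr_pdivlMr//; near: v; apply: cvgr_dist_lt => //.
by rewrite divr_gt0.
Unshelve. all: by end_near. Qed.

Lemma eq_cvg_right {V : normedModType R} (f g : R -> V) (l : V) :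
  f t @[t --> 0^'+] --> l -> (\forall t \near 0^'+, f t = g t) ->
  g t @[t --> 0^'+] --> l.
Proof. by move=> fl fg; apply: cvg_trans fl; exact: near_eq_cvg. Qed.

Lemma cvg_sum_seq {T I : Type} {V : normedModType R} {F : set_system T}
    {FF : Filter F} (r : seq I) (f : I -> T -> V) (l : I -> V) :
  (forall i, f i x @[x --> F] --> l i) ->
  \sum_(i <- r) f i x @[x --> F] --> \sum_(i <- r) l i.
Proof.
move=> fl; elim: r => [|i r IH].
  rewrite big_nil (_ : (fun x => _) = fun=> 0); first exact: cvg_cst.
  by apply/funext => x; rewrite big_nil.
rewrite big_cons (_ : (fun x => _) = fun x => f i x + \sum_(i <- r) f i x).
  by apply: cvgD.
by apply/funext => x; rewrite big_cons.
Qed.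

Lemma continuous_lin_comb {U : topologicalType} {I : Type} {V : normedModType R}
    (r : seq I) (a : I -> R) (f : I -> U -> V) (g : U -> V) :
  (forall i, continuous (f i)) -> continuous g ->
  continuous (fun u => \sum_(i <- r) a i *: f i u + g u).
Proof.
move=> cf cg u; apply: cvgD; last exact: cg.
by apply: cvg_sum_seq => i; apply: cvgZr; exact: cf.
Qed.

Lemma continuous_compose {U V W : topologicalType} (f : U -> V) (g : V -> W) :
  continuous f -> continuous g -> continuous (fun u => g (f u)).
Proof. by move=> cf cg u; apply: continuous_comp; [exact: cf|exact: cg]. Qed.

Context {I : finType} {V : normedModType R}.

Lemma ffun_norm_le (u : {ffun I -> V}) i : `|u i| <= `|u|.
Proof. by rewrite ffun_normE (bigD1 i)//= lerDl sumr_ge0. Qed.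

Lemma ffun_cvgP {T : Type} {F : set_system T} {FF : Filter F}
    (f : T -> {ffun I -> V}) (l : {ffun I -> V}) :
  f x @[x --> F] --> l <-> forall i, f x i @[x --> F] --> l i.
Proof.
split=> [fl i|fl].
  apply/cvgrPdist_lt => e e0; move/cvgrPdist_lt : fl => /(_ _ e0).
  apply: filterS => x; apply: le_lt_trans.
  by have := ffun_norm_le (l - f x) i; rewrite !ffunE.
apply/cvgrPdist_lt => e e0.
have : \sum_(i <- index_enum I) `|l i - f x i| @[x --> F] --> \sum_(i <- index_enum I) (0 : R).
  apply: cvg_sum_seq => i; rewrite -(@normr0 _ V).
  by apply: cvg_norm; rewrite -(subrr (l i)); apply: cvgB; [exact: cvg_cst|].
rewrite big1// => /cvgrPdist_lt/(_ _ e0); apply: filterS => x.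
rewrite sub0r normrN ger0_norm ?sumr_ge0// ffun_normE.
by under [X in _ -> X < _]eq_bigr do rewrite !ffunE.
Qed.

Lemma ffun_proj_continuous i : continuous (fun u : {ffun I -> V} => u i).
Proof.
apply: (@linear_bounded_cvg _ _ _ 1) => [a u v|u]; first by rewrite !ffunE.
by rewrite mul1r ffun_norm_le.
Qed.

Lemma ffun_continuous {U : topologicalType} (f : U -> {ffun I -> V}) :
  (forall i, continuous (fun u => f u i)) -> continuous f.
Proof. by move=> fc u; apply/ffun_cvgP => i; exact: fc. Qed.

End normed_facts.

Section translates.
Context {R : realType}.
Notation mu := (@lebesgue_measure R).

Lemma ae_shift (t : R) (P : R -> Prop) :
  {ae mu, forall x, P x} -> {ae mu, forall x, P (x - t)}.
Proof.
by move=> /(wbounded_ae (wbounded_shift t)); apply: aeS => x; apply; exact: oner_neq0.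
Qed.

Lemma prim_L1_lin a (u v : L1 mu) x :
  prim (a *: u + v : L1 mu) x = a * prim u x + prim v x.
Proof.
rewrite -prim_lin; try exact: L1_integrable.
apply: Rintegral_ae => //; try exact: L1_measurable.
  by apply: measurable_funD; [apply: measurable_funM => //|]; exact: L1_measurable.
by apply: aeS (L1_ae_lin a u v) => y e _.
Qed.

Lemma prim_L1_sum {I : Type} (r : seq I) (a : I -> R) (u : I -> L1 mu) x :
  prim (\sum_(i <- r) a i *: u i : L1 mu) x = \sum_(i <- r) a i * prim (u i) x.
Proof.
elim: r => [|i r IH]; last by rewrite !big_cons prim_L1_lin IH.
rewrite !big_nil; have := prim_L1_lin (-1) 0 0 x.
by rewrite scaler0 addr0 mulN1r addNr.
Qed.

Lemma L1_ae_sum {d} {T : measurableType d} (nu : {measure set T -> \bar R})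
    {I : Type} (r : seq I) (a : I -> R) (u : I -> L1 nu) :
  {ae nu, forall x, (\sum_(i <- r) a i *: u i) x = \sum_(i <- r) a i * u i x}.
Proof.
elim: r => [|i r IH].
  by rewrite big_nil; apply: aeS (@L1fun0 _ _ _ nu) => x e; rewrite big_nil; exact: e.
rewrite big_cons; apply: aeS (aeI IH (L1_ae_lin (a i) (u i) (\sum_(j <- r) a j *: u j))).
by move=> x [e1 e2]; apply: (etrans e2); rewrite big_cons; congr (_ + _); exact: e1.
Qed.

End translates.

(** * Signals and the local flow *)

Section network.
Context {R : realType} (m mplus : nat).
Notation mu := (@lebesgue_measure R).
Variables (c : 'I_(2 * m) -> R -> R) (B : 'M[R]_(2 * m)).
Variables (k s xi : 'I_(2 * m) -> R -> R) (tau p q : 'I_(2 * m) -> R).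
Hypothesis ch : forall j,
  travel_chart (c j) (Jplus mplus j) (k j) (s j) (xi j) (tau j) (p j) (q j).
Variable delta : R.
Hypotheses (delta_gt0 : 0 < delta) (delta_le : forall j, delta <= tau j).
Notation X := (X1 R m).
Implicit Types (u v : X) (j : 'I_(2 * m)).
Notation liftj j := (time_lift (xi j) (tau j)).

Let mD : measurable (`]- delta, 0[%classic : set (measurableTypeR R)).
Proof. exact: measurable_itv. Qed.

(** What sits at y + tau_j, a distance - y before the outflow end, leaves component j at time - y
    and is therefore recorded at y < 0. *)
Definition delay j : L1 mu -> L1 mu :=
  @wcomp _ _ _ _ R mu mu (\1_`]- delta, 0[) (fun y => y - - tau j).

Lemma delay_wbounded j :
  wbounded mu mu 1 (\1_`]- delta, 0[) (fun y : R => y - - tau j).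
Proof.
have := wbounded_comp (wbounded_shift (- tau j)) (wbounded_mask mu mD).
by rewrite mulr1; congr (wbounded _ _ _ _ _); apply/funext => y; rewrite mulr1.
Qed.

(* At y in (0, tau j), the present state; at y in (-delta, 0), what the boundary
   condition will let in [- y] time units from now. *)
Definition signal u j : L1 mu :=
  (\sum_k B j k *: delay k (liftj k (u k))) + liftj j (u j).

Definition translate (t : R) : L1 mu -> L1 mu :=
  @wcomp _ _ _ _ R mu mu (cst 1) (fun y => y - t).

(** Signals carry only delta units of incoming data, so the formula is the transport solution only
    for t <= delta. *)
Definition flow (t : R) u : X := [ffun j => time_pull (s j) (translate t (signal u j))].

Lemma translateE t f : {ae mu, forall y, translate t f y = f (y - t)}.
Proof. by apply: aeS (wcompE f (wbounded_shift t)) => y e; apply: (etrans e); rewrite mul1r. Qed.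

Lemma delayE j f : {ae mu, forall y, delay j f y =
  if - delta < y < 0 then f (y + tau j) else 0}.
Proof.
apply: aeS (wcompE f (delay_wbounded j)) => y e; apply: (etrans e).
rewrite indicE opprK; case: ifPn => h; first by rewrite mem_set ?mul1r//= in_itv.
by rewrite memNset ?mul0r//= in_itv/=; exact/negP.
Qed.

Lemma signalE u j : {ae mu, forall y, signal u j y =
  \sum_k B j k * (if - delta < y < 0 then liftj k (u k) (y + tau k) else 0) +
  (if 0 < y < tau j then u j (xi j y) else 0)}.
Proof.
have h : {ae mu, forall y i, delay i (liftj i (u i)) y =
    if - delta < y < 0 then liftj i (u i) (y + tau i) else 0}.
  by apply: filter_forall => i; exact: delayE.
have hsum := L1_ae_sum (index_enum _) (B j) (fun i => delay i (liftj i (u i))).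
have hadd := L1_aeD (\sum_i B j i *: delay i (liftj i (u i))) (liftj j (u j)).
apply: aeS (aeI (aeI h hadd) (aeI hsum (liftE (ch j) (u j)))).
move=> y [[e1 e2] [e3 e4]]; apply: (etrans e2); rewrite e4; congr (_ + _).
by apply: (etrans e3); apply: eq_bigr => i _; rewrite e1.
Qed.

Lemma signal_in u j : {ae mu, forall y, 0 < y < tau j ->
  signal u j y = liftj j (u j) y}.
Proof.
apply: aeS (aeI (signalE u j) (liftE (ch j) (u j))) => y [-> ->] /andP[y0 y1].
rewrite y0 y1/= big1 ?add0r// => i _.
by rewrite (lt_gtF y0) andbF mulr0.
Qed.

Lemma signal_delayed u j : {ae mu, forall y, - delta < y < 0 ->
  signal u j y = \sum_k B j k * liftj k (u k) (y + tau k)}.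
Proof.
apply: aeS (signalE u j) => y -> /andP[y0 y1].
rewrite (lt_gtF y1) addr0; apply: eq_bigr => i _.
by rewrite y0 y1.
Qed.

(** Since delta <= tau_k, the points y + tau_k lie in (0, tau_k), where signals and lifts agree.
    This functional equation for signals is what translation preserves. *)
Lemma signal_recursion u j : {ae mu, forall y, - delta < y < 0 ->
  signal u j y = \sum_k B j k * signal u k (y + tau k)}.
Proof.
have h : {ae mu, forall y i, 0 < y + tau i < tau i ->
    signal u i (y + tau i) = liftj i (u i) (y + tau i)}.
  apply: filter_forall => i; apply: aeS (ae_shift (- tau i) (signal_in u i)) => y.
  by rewrite opprK.
apply: aeS (aeI h (signal_delayed u j)) => y [e e'] yd.
rewrite e'//; case/andP: yd => y0 y1; apply: eq_bigr => i _; rewrite e//; have := delta_le i => di.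
by apply/andP; split; lra.
Qed.

Lemma flowE t u j : flow t u j = time_pull (s j) (translate t (signal u j)).
Proof. by rewrite ffunE. Qed.

Lemma lift_flow t u j : {ae mu, forall y, 0 < y < tau j ->
  liftj j (flow t u j) y = signal u j (y - t)}.
Proof.
rewrite flowE.
apply: aeS (aeI (lift_pull (ch j) (translate t (signal u j))) (translateE t (signal u j))).
by move=> y [h e] y0; rewrite h// e.
Qed.

(** Recomputing the signal after time t gives the translated one, on the part where the original
    still has data; hence the lower limit t - delta. *)
Lemma signal_flow t u j : 0 <= t <= delta -> {ae mu, forall y,
  t - delta < y < tau j -> signal (flow t u) j y = signal u j (y - t)}.
Proof.
move=> /andP[t0 td].
have h : {ae mu, forall y i, 0 < y + tau i < tau i ->
    liftj i (flow t u i) (y + tau i) = signal u i (y + tau i - t)}.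
  apply: filter_forall => i; apply: aeS (ae_shift (- tau i) (lift_flow t u i)) => y.
  by rewrite opprK.
move: (aeI h (ae_shift t (signal_recursion u j))).
move=> /aeI/(_ (aeI (signal_in (flow t u) j) (lift_flow t u j))).
move=> /aeI/(_ (aeI (signal_delayed (flow t u) j) (ae_neq 0))).
apply: aeS => y [[[e1 e2] [e3 e4]] [e5 y_neq0]] /andP[y0 y1].
(* For y > 0 this is [lift_flow]. For y < 0 the delayed components are translated signals, and the
   recursion at y - t > - delta reassembles them. *)
case: (ltgtP y 0) y_neq0 => // yz _; last by rewrite e3 ?yz ?y1// e4 ?yz ?y1.
rewrite e5; last by apply/andP; split; lra.
rewrite e2; last by apply/andP; split; lra.
apply: eq_bigr => i _; have := delta_le i => di.
rewrite e1; last by apply/andP; split; lra.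
by rewrite addrAC.
Qed.

Lemma flow0 u : flow 0 u = u.
Proof.
apply/ffunP => j; rewrite flowE; apply/(pull_eqP (ch j)).
apply: aeS (aeI (translateE 0 (signal u j)) (signal_in u j)) => y [-> e] y0.
by rewrite subr0 e.
Qed.

(** The point y - t with y > 0 must exceed r - delta for [signal_flow] to apply; this is exactly
    where t + r <= delta enters. *)
Lemma flowD t r u : 0 <= t -> 0 <= r -> t + r <= delta ->
  flow (t + r) u = flow t (flow r u).
Proof.
move=> t0 r0 trd; apply/ffunP => j; rewrite flowE; apply/(pull_eqP (ch j)).
have hr : 0 <= r <= delta by apply/andP; split; lra.
move: (aeI (lift_flow t (flow r u) j) (ae_shift t (signal_flow u j hr))).
move=> /aeI/(_ (translateE (t + r) (signal u j))).
apply: aeS => y [[e1 e2] ->] /andP[y0 y1]; rewrite e1 ?y0// e2.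
  by rewrite opprD addrA.
by apply/andP; split; lra.
Qed.

Lemma delay_linear j : linear (delay j).
Proof. exact: wcomp_linear (delay_wbounded j). Qed.

Lemma translate_linear t : linear (translate t).
Proof. exact: wcomp_linear (wbounded_shift t). Qed.

Lemma signal_linear j : linear (signal^~ j).
Proof.
move=> a u v; have e i : (a *: u + v) i = a *: u i + v i by rewrite !ffunE.
rewrite /signal e (time_lift_linear (ch j)) scalerDr addrACA.
congr (_ + _); rewrite scaler_sumr -big_split/=; apply: eq_bigr => i _.
by rewrite e (time_lift_linear (ch i)) delay_linear scalerDr !scalerA mulrC.
Qed.

Lemma flow_linear t : linear (flow t).
Proof.
move=> a u v; apply/ffunP => j.
have -> : (a *: flow t u + flow t v) j = a *: flow t u j + flow t v j.
  by rewrite [LHS]ffunE; congr (_ + _); rewrite ffunE.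
apply: (etrans (flowE t _ j)).
apply: (etrans _ (congr2 (fun x y => a *: x + y) (esym (flowE t u j)) (esym (flowE t v j)))).
rewrite -(time_pull_linear (ch j)) -translate_linear; congr (time_pull _ (translate t _)).
exact: signal_linear.
Qed.

Lemma signal_continuous j : continuous (signal^~ j).
Proof.
have cl i : continuous (fun u : X => liftj i (u i)).
  have h1 := linear_bounded_cvg (time_lift_linear (ch i)) (time_lift_norm (ch i)).
  have h2 := @ffun_proj_continuous R _ (L1_01 R) i.
  exact: (continuous_compose h2 h1).
have cd i : continuous (delay i).
  apply: (linear_bounded_cvg (delay_linear i)) => f.
  exact: (wcomp_norm f (delay_wbounded i)).
apply: continuous_lin_comb => [i|]; last exact: cl.
exact: (continuous_compose (cl i) (cd i)).
Qed.

Lemma flow_continuous t : continuous (flow t).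
Proof.
apply: ffun_continuous => j.
have -> : (fun u => flow t u j) = fun u => time_pull (s j) (translate t (signal u j)).
  by apply/funext => u; rewrite flowE.
have ct : continuous (translate t).
  apply: (linear_bounded_cvg (translate_linear t)) => w.
  exact: (wcomp_norm w (wbounded_shift t)).
have cp := linear_bounded_cvg (time_pull_linear (ch j)) (time_pull_norm (ch j)).
have cs := @signal_continuous j.
exact: (continuous_compose (continuous_compose cs ct) cp).
Qed.

(** * Primitives of signals and the boundary condition *)

Lemma prim_lift_le0 j w y : y <= 0 -> prim (liftj j w) y = 0.
Proof.
move=> y0; apply: (@etrans _ _ (\int[mu]_(t in `]-oo, y]) 0)).
  apply: Rintegral_ae => //; first exact: L1_measurable.
  apply: aeS (liftE (ch j) w) => z -> /=; rewrite in_itv/= => zy.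
  by rewrite le_gtF// (le_trans zy).
by rewrite Rintegral_cst//= mul0r.
Qed.

Lemma prim_signal_pos u j y : 0 <= y <= tau j ->
  prim (signal u j) y - prim (signal u j) 0 = prim (liftj j (u j)) y.
Proof.
move=> /andP[y0 y1]; rewrite -[RHS]subr0 -[in RHS](prim_lift_le0 j (u j) (lexx 0)).
rewrite !primB//; try exact: L1_integrable.
apply: Rintegral_ae => //; try exact: L1_measurable.
apply: aeS (aeI (signal_in u j) (ae_neq (tau j))) => z [e zt] /=.
rewrite in_itv/= => /andP[z0 zy]; apply: e; rewrite z0 lt_neqAle zt/=.
exact: le_trans y1.
Qed.

Lemma prim_delay j (f : L1 mu) y : - delta <= y <= 0 ->
  prim (delay j f) 0 - prim (delay j f) y =
  prim f (tau j) - prim f (y + tau j).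
Proof.
move=> /andP[y0 y1]; have intf := L1_integrable f.
have [intt _] := Rintegral_shift (- tau j) intf.
have -> : prim f (tau j) - prim f (y + tau j) =
    prim (fun x => f (x - - tau j)) 0 - prim (fun x => f (x - - tau j)) y.
  by rewrite !prim_shift// opprK add0r.
rewrite !primB//; first last.
  exact: L1_integrable.
apply: Rintegral_ae => //; first exact: L1_measurable.
  by case/integrableP : intt => /measurable_EFinP.
apply: aeS (aeI (delayE j f) (ae_neq 0)) => z [-> zt] /=.
rewrite in_itv/= => /andP[z0 zy]; rewrite opprK (le_lt_trans y0 z0) lt_neqAle zt.
by rewrite zy.
Qed.

(** The integrated boundary coupling: what enters component j during time - y is the B-combination
    of what leaves the components in that time. *)
Lemma prim_signal_neg u j y : - delta <= y <= 0 ->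
  prim (signal u j) 0 - prim (signal u j) y =
  \sum_i B j i * (prim (liftj i (u i)) (tau i) - prim (liftj i (u i)) (y + tau i)).
Proof.
move=> yd; have /andP[_ y1] := yd.
pose hist := \sum_i B j i *: delay i (liftj i (u i)).
have e x : x <= 0 -> prim (signal u j) x =
    \sum_i B j i * prim (delay i (liftj i (u i))) x.
  move=> x0; rewrite -prim_L1_sum -[RHS]addr0 -[in RHS](prim_lift_le0 j (u j) x0).
  by rewrite -[in RHS](mul1r (prim hist x)) -prim_L1_lin scale1r.
rewrite !e// -sumrB; apply: eq_bigr => i _.
by rewrite -mulrBr prim_delay.
Qed.

Definition outflow_flux (g : 'I_(2 * m) -> R) v j : R :=
  g j - prim (liftj j (v j)) (tau j).

(** Weak derivatives and boundary traces are eliminated here: the domain and the operator become one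
    flux identity per component together with a linear system for the inflow values g. *)
Lemma transport_fluxP u v :
  transport_dom mplus B u /\ transport_op mplus c u = v <->
  exists2 g : 'I_(2 * m) -> R,
    forall j, flux (xi j) (tau j) (u j) (v j) (g j) &
    forall j, g j = \sum_i B j i * outflow_flux g v i.
Proof.
have inE g : (forall j, flux (xi j) (tau j) (u j) (v j) (g j)) ->
    inflow mplus u = \col_j g j /\ outflow mplus u = \col_j outflow_flux g v j.
  move=> fl; split; apply/matrixP => j i; rewrite !mxE.
    by have [_ _ <-] := (fluxP (ch j) _ _ _).1 (fl j); case: Jplus.
  by rewrite /outflow_flux -(flux_outflow (ch j) (fl j)); case: Jplus.
split=> [[[W bc] Au]|[g fl bc]].
  pose g j := value_at (u j) (if Jplus mplus j then 0 else 1).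
  have fl j : flux (xi j) (tau j) (u j) (v j) (g j).
    by apply/(fluxP (ch j)); split => //; rewrite -Au ffunE.
  exists g => // j; have [e1 e2] := inE g fl.
  move: bc; rewrite e1 e2 => /matrixP/(_ j ord0); rewrite !mxE => ->.
  by apply: eq_bigr => i _; rewrite mxE.
have [e1 e2] := inE g fl; split; first split.
- by move=> j; have [] := (fluxP (ch j) _ _ _).1 (fl j).
- rewrite e1 e2; apply/matrixP => j i; rewrite !mxE bc.
  by apply: eq_bigr => l _; rewrite mxE.
- apply/ffunP => j; rewrite ffunE.
  by have [] := (fluxP (ch j) _ _ _).1 (fl j).
Qed.

(** The boundary condition makes the history and the present state meet at 0 with the common value g
    j. Hence the signal of u is minus a primitive of that of v across 0, with no jump, as
    translation across the inflow end requires. *)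
Lemma signal_flux u v (g : 'I_(2 * m) -> R) j :
  (forall i, flux (xi i) (tau i) (u i) (v i) (g i)) ->
  (forall i, g i = \sum_l B i l * outflow_flux g v l) ->
  {ae mu, forall y, - delta < y < tau j ->
    signal u j y = g j + prim (signal v j) 0 - prim (signal v j) y}.
Proof.
move=> fl bc.
have h : {ae mu, forall y i, 0 < y + tau i < tau i ->
    liftj i (u i) (y + tau i) = g i - prim (liftj i (v i)) (y + tau i)}.
  apply: filter_forall => i; apply: aeS (ae_shift (- tau i) (fl i)) => y.
  by rewrite opprK.
move: (aeI (aeI h (ae_neq 0)) (aeI (signal_in u j) (signal_delayed u j))).
move=> /aeI/(_ (fl j)).
apply: aeS => y [[[e1 y_neq0] [e2 e3]] e4] /andP[y0 y1].
case: (ltgtP y 0) y_neq0 => // yz _; last first.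
  rewrite e2 ?yz// e4 ?yz// -(@prim_signal_pos v) ?y1 ?ltW//.
  by rewrite opprB addrA.
rewrite e3 ?y0// -addrA prim_signal_neg; last by rewrite !ltW.
rewrite bc -big_split/=; apply: eq_bigr => i _; have := delta_le i => di.
rewrite e1; last by apply/andP; split; lra.
by rewrite -mulrDr /outflow_flux addrA subrK.
Qed.

(** * Strong continuity, and convergence of quotients on the domain *)

Lemma pull_cvg j (g : R -> L1 mu) (w : L1_01 R) :
  (forall e : R, 0 < e -> \forall t \near (0 : R)^'+,
    (\int[mu]_(y in `]0%R, tau j[) `|g t y - liftj j w y|%:E <= e%:E)%E) ->
  time_pull (s j) (g t) @[t --> 0^'+] --> w.
Proof.
move=> gw; apply/cvgrPdist_le => e e0.
have p0 := chart_p_gt0 (ch j).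
(* The factor p j compensates the norm bound 1 / p j of [time_pull]. *)
have pe0 : 0 < p j * e by rewrite mulr_gt0.
have pw : time_pull (s j) (liftj j w) = w := pull_lift (ch j) w.
move: (gw _ pe0); apply: filterS => t gt.
have -> : `|w - time_pull (s j) (g t)| = `|time_pull (s j) (-1 *: liftj j w + g t)|.
  by rewrite (time_pull_linear (ch j)) pw scaleN1r addrC distrC.
rewrite -lee_fin; apply: le_trans (pull_norm_le (ch j) _) _.
have mI : measurable (`]0, tau j[%classic : set (measurableTypeR R)).
  exact: measurable_itv.
rewrite (_ : e%:E = (p j)^-1%:E * (p j * e)%:E)%E; last first.
  by rewrite -EFinM mulrA mulVf ?gt_eqF// mul1r.
apply: lee_wpmul2l; first by rewrite lee_fin invr_ge0 ltW.
apply: le_trans gt; rewrite le_eqVlt; apply/orP; left; apply/eqP.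
apply: ge0_ae_eq_integral => //.
- by apply/measurable_EFinP/measurable_funTS/measurableT_comp => //; exact: L1_measurable.
- apply/measurable_EFinP/measurable_funTS/measurableT_comp => //.
  by apply: measurable_funB; exact: L1_measurable.
- apply: aeS (L1_ae_lin (-1) (liftj j w) (g t)) => y ey _.
  by congr (`|_|%:E); apply: (etrans ey); rewrite mulN1r addrC.
Qed.

Lemma translation_small u j (e : R) : 0 < e -> exists2 d : R, 0 < d &
  forall t, `|t| < d ->
  (\int[mu]_(y in `]0%R, tau j[) `|signal u j (y - t) - signal u j y|%:E <= e%:E)%E.
Proof.
move=> e0; have [d d0 h] := translation_continuous (tau j) (L1_integrable (signal u j)) e0.
exists d => // t /h; apply: le_trans.
have ms := L1_measurable (signal u j).
apply: ge0_subset_integral => //.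
- apply/measurable_EFinP/measurable_funTS/measurableT_comp => //.
  apply: measurable_funB => //; apply: measurableT_comp => //.
  exact: measurable_funB.
- move=> y /=; rewrite !in_itv/= => /andP[y0 y1]; rewrite (ltW y1) andbT.
  by apply: le_trans (ltW y0); rewrite oppr_le0 ltW// (chart_tau_gt0 (ch j)).
Qed.

Lemma flow_cvg0 u : flow t u @[t --> 0^'+] --> u.
Proof.
apply/ffun_cvgP => j; rewrite (_ : (fun t => flow t u j) =
    fun t => time_pull (s j) (translate t (signal u j))); last first.
  by apply/funext => t; exact: flowE.
apply: pull_cvg => e e0; have [d d0 h] := translation_small u j e0.
near=> t; apply: le_trans (h t _).
  rewrite le_eqVlt; apply/orP; left; apply/eqP.
  apply: ge0_ae_eq_integral => //.
  - apply/measurable_EFinP/measurable_funTS/measurableT_comp => //.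
    by apply: measurable_funB; exact: L1_measurable.
  - apply/measurable_EFinP/measurable_funTS/measurableT_comp => //.
    have ms := L1_measurable (signal u j).
    apply: measurable_funB => //; apply: measurableT_comp => //.
    exact: measurable_funB.
  apply: aeS (aeI (translateE t (signal u j)) (signal_in u j)) => y [e1 e2] /=.
  by rewrite in_itv/= => /e2 <-; rewrite e1.
by rewrite gtr0_norm.
Unshelve. all: by end_near. Qed.

(** By [signal_flux] at y and y - t, the difference quotient of signals is the average of the signal
    of v over ]y - t, y], and such averages converge in L1 by [average_le]. *)
Lemma generator_of_flux u v (g : 'I_(2 * m) -> R) :
  (forall i, flux (xi i) (tau i) (u i) (v i) (g i)) ->
  (forall i, g i = \sum_l B i l * outflow_flux g v l) ->
  t^-1 *: (flow t u - u) @[t --> 0^'+] --> v.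
Proof.
move=> fl bc; apply/ffun_cvgP => j.
pose f t : L1 mu := t^-1 *: (-1 *: liftj j (u j) + translate t (signal u j)).
rewrite (_ : (fun t => _) = fun t => time_pull (s j) (f t)); last first.
  apply/funext => t; rewrite /f -[X in time_pull _ X]addr0.
  have p0 : time_pull (s j) 0 = 0.
    have := time_pull_linear (ch j) 1 0 0; rewrite !scale1r addr0 => /eqP.
    by rewrite -subr_eq0 opprD addNKr oppr_eq0 => /eqP.
  rewrite (time_pull_linear (ch j)) p0 addr0 (time_pull_linear (ch j)) (pull_lift (ch j)).
  by rewrite !ffunE scaleN1r addrC.
apply: pull_cvg => e e0; have [d d0 h] := translation_small v j e0.
near=> t.
have t0 : 0 < t by near: t; exact: nbhs_right_gt.
have td : t < d by near: t; exact: nbhs_right_lt.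
(* This keeps y - t above - delta for every y in (0, tau j), inside the range of [signal_flux]. *)
have tdelta : t < delta by near: t; exact: nbhs_right_lt.
have mI : measurable (`]0, tau j[%classic : set (measurableTypeR R)).
  exact: measurable_itv.
have intv := L1_integrable (signal v j).
have mv := L1_measurable (signal v j).
have small : (\int[mu]_(y in `]0%R, tau j[)
    `|prim (signal v j) y - prim (signal v j) (y - t) - t * signal v j y|%:E
    <= (t * e)%:E)%E.
  apply: average_le => // r /andP[r0 rt]; apply: h.
  by rewrite ger0_norm//; exact: le_lt_trans td.
have mP : measurable_fun setT (prim (signal v j)).
  by apply: continuous_measurable_fun; exact: prim_continuous.
have mPt : measurable_fun setT (fun y : R => prim (signal v j) (y - t)).
  by apply: measurableT_comp mP _; exact: measurable_funB.
have -> : e%:E = (t^-1%:E * (t * e)%:E)%E.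
  by rewrite -EFinM mulrA mulVf ?gt_eqF// mul1r.
apply: le_trans (lee_wpmul2l _ small); last by rewrite lee_fin invr_ge0 ltW.
rewrite -ge0_integralZl//; first last.
- by rewrite lee_fin invr_ge0 ltW.
- apply/measurable_EFinP/measurable_funTS/measurableT_comp => //.
  by apply: measurable_funB; [exact: measurable_funB|exact: measurable_funM].
rewrite le_eqVlt; apply/orP; left; apply/eqP.
apply: ge0_ae_eq_integral => //.
- apply/measurable_EFinP/measurable_funTS/measurableT_comp => //.
  by apply: measurable_funB; exact: L1_measurable.
- apply: emeasurable_funM; first exact: measurable_cst.
  apply/measurable_EFinP/measurable_funTS/measurableT_comp => //.
  by apply: measurable_funB; [exact: measurable_funB|exact: measurable_funM].
- by move=> y _; rewrite -EFinM lee_fin mulr_ge0// invr_ge0 ltW.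
have sf := signal_flux j fl bc.
move: (aeI (aeI sf (ae_shift t sf)) (aeI (signal_in u j) (signal_in v j))).
move=> /aeI/(_ (aeI (translateE t (signal u j)) (L1_ae_lin (-1) (liftj j (u j))
  (translate t (signal u j))))).
move=> /aeI/(_ (L1_aeZ t^-1 (-1 *: liftj j (u j) + translate t (signal u j)))).
apply: aeS => y [[[[e1 e2] [e3 e4]] [e5 e6]] e7]; rewrite /= in_itv/= => y01.
have /andP[y0 y1] := y01.
rewrite -EFinM; congr EFin.
rewrite -{1}(gtr0_norm (x := t^-1)) ?invr_gt0// -normrM; congr (`|_|).
(* On (0, tau j) the lift of u may be replaced by its signal, so both terms are values of one
   function. *)
have -> : f t y = t^-1 * (signal u j (y - t) - signal u j y).
  apply: (etrans e7); congr (_ * _); apply: (etrans e6).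
  by rewrite e5 mulN1r addrC -e3.
rewrite e1; last by rewrite y1 (lt_trans _ y0)// oppr_lt0.
rewrite e2; last first.
  rewrite ltrBrDr ltrBlDr (lt_trans _ y0) ?(lt_trans y1) ?ltrDl//.
  by rewrite addrC subr_lt0.
rewrite -e4// [RHS]mulrBr mulKf ?gt_eqF//; congr (_ * _ - _).
by rewrite opprB addrC addrA subrK.
Unshelve. all: by end_near. Qed.

(** * From convergent difference quotients back to the domain *)

Lemma prim_lift_flow t u j b : 0 <= b <= tau j ->
  prim (liftj j (flow t u j)) b =
  prim (signal u j) (b - t) - prim (signal u j) (- t).
Proof.
move=> /andP[b0 b1]; have ints := L1_integrable (signal u j).
have [intt _] := Rintegral_shift t ints.
rewrite -[LHS]subr0 -[in LHS](prim_lift_le0 j (flow t u j) (lexx 0)).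
have -> : prim (signal u j) (b - t) - prim (signal u j) (- t) =
    prim (fun y => signal u j (y - t)) b - prim (fun y => signal u j (y - t)) 0.
  by rewrite !prim_shift// add0r.
rewrite !primB//; last exact: L1_integrable.
apply: Rintegral_ae => //; first exact: L1_measurable.
  by case/integrableP : intt => /measurable_EFinP.
apply: aeS (aeI (lift_flow t u j) (ae_neq (tau j))) => y [e yt].
rewrite /= in_itv/= => /andP[y0 yb]; apply: e.
by rewrite y0 lt_neqAle yt (le_trans yb).
Qed.

(** The integral of the lift over (0, b) is a bounded linear functional of the state, so it passes
    to the limit. Applied to the quotient it leaves one boundary term at b and one at 0, the latter
    independent of b. *)
Lemma difference_quotient_cvg u v j b : 0 <= b <= tau j ->
  t^-1 *: (flow t u - u) @[t --> 0^'+] --> v ->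
  t^-1 * (prim (signal u j) (b - t) - prim (signal u j) b) +
  t^-1 * (prim (signal u j) 0 - prim (signal u j) (- t)) @[t --> 0^'+] -->
  prim (liftj j (v j)) b.
Proof.
move=> b01 /ffun_cvgP/(_ j) uv.
have primlin : linear (fun w : L1_01 R => prim (liftj j w) b : R^o).
  by move=> a w w'; rewrite (time_lift_linear (ch j)) prim_L1_lin.
have primC w : `|prim (liftj j w) b : R^o| <= q j * `|w|.
  apply: le_trans (time_lift_norm (ch j) w).
  by apply: Rintegral_le_norm; exact: measurable_itv.
have cprim := linear_bounded_cvg primlin primC.
apply: (@eq_cvg_right _ R^o _ _ _ (continuous_cvg _ (cprim (v j)) uv)); near=> t.
have -> : (t^-1 *: (flow t u - u)) j = t^-1 *: (-1 *: u j + flow t u j) + 0.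
  by rewrite !ffunE addr0 scaleN1r addrC.
rewrite primlin (primlin (-1)) -(prim_signal_pos u b01) (prim_lift_flow t u b01).
have -> : prim (liftj j 0) b = 0.
  by have := primlin (-1) 0 0; rewrite scaler0 addr0 scaleN1r addNr.
rewrite addr0 -mulrDr /GRing.scale/=; congr (_ * _); ring.
Unshelve. all: by end_near. Qed.

Lemma left_difference_quotient (f : R -> R) (b : R) : derivable f b 1 ->
  t^-1 * (f (b - t) - f b) @[t --> 0^'+] --> - derive1 f b.
Proof.
move=> fb; rewrite derive1E.
have lim : h^-1 *: (f (h *: 1 + b) - f b) @[h --> 0^'] --> 'D_1 f b := fb.
have opp : (fun t : R => - t) @ 0^'+ --> 0^'.
  move=> A; rewrite /dnbhs/within/= => /nbhs_ballP[e /= e0 eA].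
  change (\forall t \near 0^'+, A (- t)).
  near=> t; have t0 : 0 < t by near: t; exact: nbhs_right_gt.
  have te : t < e by near: t; exact: nbhs_right_lt.
  apply: (eA (- t)); first by rewrite /ball/= sub0r opprK gtr0_norm.
  by rewrite oppr_eq0 gt_eqF.
apply: (@eq_cvg_right _ R^o _ _ _ (cvgN (cvg_comp _ _ opp lim))); near=> t.
by rewrite /= /GRing.scale/= mulr1 invrN mulNr opprK (addrC (- t)).
Unshelve. all: by end_near. Qed.

(** At a.e. b the term at b converges to minus the derivative of the primitive, that is to - u b.
    The term at 0 therefore converges to the sum of u b and the primitive of v at b; as it does not
    involve b, that sum is a constant g, which is the flux identity. *)
Lemma flux_of_generator u v j : t^-1 *: (flow t u - u) @[t --> 0^'+] --> v ->
  exists g, flux (xi j) (tau j) (u j) (v j) g /\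
    t^-1 * (prim (signal u j) 0 - prim (signal u j) (- t)) @[t --> 0^'+] --> g.
Proof.
move=> uv; set P := prim (signal u j).
have dP : {ae mu, forall y, 0 < y < tau j ->
    t^-1 * (P 0 - P (- t)) @[t --> 0^'+] -->
    prim (liftj j (v j)) y + liftj j (u j) y}.
  apply: aeS (aeI (prim_derive_ae (L1_integrable (signal u j))) (signal_in u j)).
  move=> y [[dy dE] e] /[dup] y01 /andP[y0 y1]; rewrite -e// -dE.
  have y01' : 0 <= y <= tau j by rewrite !ltW.
  rewrite -[X in _ + X]opprK.
  apply: (@eq_cvg_right _ R^o _ _ _ (cvgB (difference_quotient_cvg (j := j) y01' uv)
    (left_difference_quotient dy))); near=> t.
  by rewrite addrAC subrr add0r.
(* One good b is enough to obtain the limit g; uniqueness of limits extends the identity to almost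
   every other point. *)
have [b b01 /(_ b01) limb] := ae_exists (chart_tau_gt0 (ch j)) dP.
exists (prim (liftj j (v j)) b + liftj j (u j) b); split=> //.
apply: aeS dP => y /[apply] limy.
by rewrite (cvg_unique _ limb limy)// addrC addKr.
Unshelve. all: by end_near. Qed.

(** It remains to couple the inflow values g: for small t the quotients at the inflow ends are exact
    B-combinations of those at the outflow ends, and the relation passes to the limit. *)
Lemma generatorP u v : t^-1 *: (flow t u - u) @[t --> 0^'+] --> v <->
  transport_dom mplus B u /\ transport_op mplus c u = v.
Proof.
split=> [uv|/transport_fluxP[g fl bc]]; last exact: generator_of_flux fl bc.
have /choice[g gP] := fun j => flux_of_generator j uv.
apply/transport_fluxP; exists g => [j|j]; first by have [] := gP j.
(* With b = tau i, subtracting the limit of the sum of both boundary terms from the limit g i at 0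
   isolates the outflow term. *)
have out i : t^-1 * (prim (signal u i) (tau i) - prim (signal u i) (tau i - t))
    @[t --> 0^'+] --> outflow_flux g v i.
  have t01 : 0 <= tau i <= tau i by rewrite lexx ltW// (chart_tau_gt0 (ch i)).
  apply: (@eq_cvg_right _ R^o _ _ _ (cvgB (gP i).2
    (difference_quotient_cvg (j := i) t01 uv))); near=> t.
  by rewrite opprD addrCA subrr addr0 -mulrN opprB.
have sum_out : \sum_(i <- index_enum _) B j i * (t^-1 * (prim (signal u i) (tau i) -
    prim (signal u i) (tau i - t))) @[t --> 0^'+] --> \sum_i B j i * outflow_flux g v i.
  by apply: (@cvg_sum_seq R _ _ R^o) => i; apply: cvgMr; exact: out.
apply: (cvg_unique _ (gP j).2) => //; apply: (@eq_cvg_right _ R^o _ _ _ sum_out).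
near=> t.
have t0 : 0 < t by near: t; exact: nbhs_right_gt.
have td : t < delta by near: t; exact: nbhs_right_lt.
(* This needs t <= delta; the values at tau i - t are then converted to signals, as tau i - t >=
   0. *)
rewrite prim_signal_neg; last by apply/andP; split; lra.
rewrite mulr_sumr; apply: eq_bigr => i _; have di := delta_le i.
rewrite mulrCA; congr (_ * (_ * _)).
rewrite -!prim_signal_pos; [|by apply/andP; split; lra..].
by rewrite (addrC (- t)) opprB addrA subrK.
Unshelve. all: by end_near. Qed.

End network.

Theorem theorem4p10 (R : realType) (m mplus : nat) (c : 'I_(2 * m) -> R -> R)
    (B : 'M[R]_(2 * m)) :
  (mplus <= 2 * m)%N ->
  (forall j, {within `[0, 1], continuous (c j)}) ->
  (forall j x, x \in `[0, 1] -> 0 < c j x) ->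
  generates_C0_semigroup (transport_dom mplus B) (transport_op mplus c).
Proof.
move=> _ c_cont c_gt0.
have /choice[k /choice[s /choice[xi /choice[tau /choice[p /choice[q ch]]]]]] :=
  fun j => travel_chart_exists (Jplus mplus j) (c_cont j) (c_gt0 j).
(* The default 1 of the minimum keeps delta positive even when there are no components. *)
pose delta : R := \big[Num.min/1]_j tau j.
have delta_gt0 : 0 < delta.
  by apply: lt_bigmin => // j _; exact: chart_tau_gt0 (ch j).
have delta_le j : delta <= tau j by exact: bigmin_le.
have half : 0 < delta / 2 by rewrite divr_gt0.
(* The step is half of delta because the extension needs additivity up to twice its step, and
   [flowD] provides it up to delta. *)
apply: (@extend_semigroupP _ _ (flow B s xi tau delta) (delta / 2)).
- exact: half.
- by move=> t _; exact: (flow_linear B ch).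
- by move=> t _; exact: (@flow_continuous _ _ _ _ B _ _ _ _ _ _ ch).
- by move=> u; exact: (flow0 B ch).
- move=> t r t0 r0 tr u; apply: (flowD B ch delta_le) => //.
  by rewrite (splitr delta).
- by move=> u; exact: (flow_cvg0 B ch).
- by move=> u v; exact: (generatorP B ch delta_gt0 delta_le).
Qed.
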